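(* Assume $V,W$ satisfy assumptions (H) of the context. Assume that $u_0\in\mathcal P_{2m^2}(\mathbb R^d)$ and $u_0^{(N)}\in\mathcal P_2(\mathbb R^{dN})$ for every $N\ge 1$. Then there exists a constant $\mathrm C_{\rm init}>0$, depending only on $V,W,d$ and the initial laws, and independent of $t$ and $N$, such that for all $t\ge 0$ and all $N\ge1$, $$\sum_{i=1}^N \mathbb E\left[|X_t^{i,N}-\bar X_t^i|^2\right]\le 2e^{-2\beta t}\sum_{i=1}^N\mathbb E\left[|X_0^{i,N}-\bar X_0^i|^2\right]+\mathrm C_{\rm init}.$$ Moreover, let $p\ge 1$ be an integer. If $u_0\in\mathcal P_{2m^2p}(\mathbb R^d)$ and $u_0^{(N)}\in\mathcal P_{2p}(\mathbb R^{dN})$ for every $N\ge1$, and if either $d=1$ or $W(x)=\lambda_W\frac{|x|^2}{2}$, then there exists a constant $\mathrm C_{\rm init}>0$, depending only on $p,V,W,d$ and the initial laws, and independent of $t$ and $N$, such that for all $t\ge0$ and all $N\ge 1$, $$\sum_{i=1}^N \mathbb E\left[|X_t^{i,N}-\bar X_t^i|^{2p}\right]\le 2^pe^{-2p\beta t}\sum_{i=1}^N\mathbb E\left[|X_0^{i,N}-\bar X_0^i|^{2p}\right]+\frac{\mathrm C_{\rm init}}{N^{p-1}}.$$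
   Context: Let $V,W:\mathbb R^d\to\mathbb R$ be smooth potentials and $(B^i)_{i\ge1}$ independent Brownian motions on $\mathbb R^d$. Particle system: for each $N\ge1$, $(X^{1,N},\dots,X^{N,N})$ solves $$dX_t^{i,N}=\sqrt2\,dB_t^i-\nabla V(X_t^{i,N})\,dt-\frac1N\sum_{j=1}^N\nabla W(X_t^{i,N}-X_t^{j,N})\,dt,\quad 1\le i\le N,$$ with initial law $\mathcal L(X_0^{1,N},\dots,X_0^{N,N})=u_0^{(N)}$ (a probability measure on $\mathbb R^{dN}$, not assumed exchangeable or product). Limit particles: $\bar X^i$ solves, with the same Brownian motion $B^i$, the McKean-Vlasov equation $$d\bar X_t^i=\sqrt2\,dB_t^i-\nabla V(\bar X_t^i)\,dt-\nabla W\ast u_t(\bar X_t^i)\,dt,\qquad \mathcal L(\bar X_t^i)=u_t,$$ where the $\bar X_0^i$ are i.i.d. with law $u_0$. The joint law of the initial data $(X_0^{i,N})_i$ and $(\bar X_0^i)_i$ is arbitrary subject to these marginals (in particular $X_0^{i,N}=\bar X_0^i$ is not required); initial data are independent of the Brownian motions. Assumptions (H): - $\nabla W$ is odd: $\nabla W(-x)=-\nabla W(x)$; - $(\nabla W(x)-\nabla W(y))\cdot(x-y)\ge\lambda_W|x-y|^2$ for all $x,y$, with $\lambda_W\in\mathbb R$; - $(\nabla V(x)-\nabla V(y))\cdot(x-y)\ge\lambda_V|x-y|^2$ for all $x,y$, with $\lambda_V>0$; - $\lambda_V+2\lambda_W>0$; - $|\nabla W(x)-\nabla W(y)|\le M(|x-y|\wedge1)(1+|x|^m+|y|^m)$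 for all $x,y$, with $m\in\mathbb N$, $M>0$; - $\nabla V$ is locally Lipschitz with polynomial growth. $\beta=\lambda_V$ if $\lambda_W\ge0$, and $\beta=\lambda_V+2\lambda_W$ otherwise. $\mathcal P_q(\mathbb R^n)$ is the set of probability measures on $\mathbb R^n$ with finite moment of order $q$. *)

(* Defs.v *)
From HB Require Import structures.
From mathcomp Require Import all_boot all_order all_algebra.
From mathcomp Require Import all_classical all_reals all_analysis.

Set Implicit Arguments.
Unset Strict Implicit.
Unset Printing Implicit Defensive.

Import Order.TTheory GRing.Theory Num.Theory.
Import numFieldNormedType.Exports.

Local Open Scope classical_set_scope.
Local Open Scope ring_scope.

(* R^d is 'rV[R]_d and R^(dN) is 'M[R]_(N, d),
   row i being the position of particle i. Particles are numbered from 0. *)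

(* The library norm on matrices is the sup norm; [enorm] is the Euclidean norm
   of R^(m n), hence the usual |x| on row vectors. *)
Definition enorm (R : realType) (m n : nat) (A : 'M[R]_(m, n)) : R :=
  Num.sqrt (\sum_(i < m) \sum_(j < n) A i j ^+ 2).

Definition dotv (R : realType) (d : nat) (x y : 'rV[R]_d) : R :=
  \sum_(k < d) x ord0 k * y ord0 k.

Definition partial (R : realType) (d : nat) (k : 'I_d) (f : 'rV[R]_d -> R) :
    'rV[R]_d -> R :=
  fun x => 'D_(delta_mx ord0 k) (f : 'rV[R]_d -> R^o) x.

Definition iter_partial (R : realType) (d : nat) (s : seq 'I_d)
    (f : 'rV[R]_d -> R) : 'rV[R]_d -> R :=
  foldr (@partial R d) f s.

Definition smooth (R : realType) (d : nat) (f : 'rV[R]_d -> R) : Prop :=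
  forall s : seq 'I_d,
    (forall (k : 'I_d) (x : 'rV[R]_d),
       derivable (iter_partial s f : 'rV[R]_d -> R^o) x (delta_mx ord0 k)) /\
    continuous (iter_partial s f : 'rV[R]_d -> R^o).

Definition grad (R : realType) (d : nat) (f : 'rV[R]_d -> R) (x : 'rV[R]_d) :
    'rV[R]_d :=
  \row_(k < d) partial k f x.

Definition locally_lipschitz (R : realType) (d : nat)
    (F : 'rV[R]_d -> 'rV[R]_d) : Prop :=
  forall x0 : 'rV[R]_d, exists r L : R, 0 < r /\
    forall x y : 'rV[R]_d, enorm (x - x0) < r -> enorm (y - x0) < r ->
      enorm (F x - F y) <= L * enorm (x - y).

Definition polynomial_growth (R : realType) (d : nat)
    (F : 'rV[R]_d -> 'rV[R]_d) : Prop :=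
  exists (C : R) (q : nat), forall x : 'rV[R]_d,
    enorm (F x) <= C * (1 + enorm x ^+ q).

Record assumptions_H (R : realType) (d : nat) (V W : 'rV[R]_d -> R)
    (lV lW M : R) (m : nat) : Prop := {
  H_smoothV : smooth V ;
  H_smoothW : smooth W ;
  H_odd : forall x, grad W (- x) = - grad W x ;
  H_convW : forall x y,
    lW * enorm (x - y) ^+ 2 <= dotv (grad W x - grad W y) (x - y) ;
  H_convV : forall x y,
    lV * enorm (x - y) ^+ 2 <= dotv (grad V x - grad V y) (x - y) ;
  H_lV : 0 < lV ;
  H_lVW : 0 < lV + 2 * lW ;
  H_M : 0 < M ;
  H_growthW : forall x y,
    enorm (grad W x - grad W y) <=
      M * Num.min (enorm (x - y)) 1 * (1 + enorm x ^+ m + enorm y ^+ m) ;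
  H_lipV : locally_lipschitz (grad V) ;
  H_growthV : polynomial_growth (grad V) }.

Definition beta (R : realType) (lV lW : R) : R :=
  if 0 <= lW then lV else lV + 2 * lW.

(* Borel sigma-algebra on spaces of real matrices. *)
HB.instance Definition _ (R : realType) (m n : nat) :=
  Measurable.copy 'M[R]_(m, n)
    (g_sigma_algebraType (@open 'M[R]_(m, n))).

Definition finite_moment (R : realType) (m n : nat) (q : nat)
    (mu : probability 'M[R]_(m, n) R) : Prop :=
  (\int[mu]_x (enorm x ^+ q)%:E < +oo)%E.

Section Probability.
Context {dT : measure_display} {T : measurableType dT} {R : realType}.
Variable P : probability T R.

Definition has_law {d' : measure_display} {E : measurableType d'}
    (X : T -> E) (mu : set E -> \bar R) : Prop :=
  measurable_fun setT X /\
  forall A, measurable A -> P (X @^-1` A) = mu A.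

(* Generating sets of the sigma-algebra of the process (X_i), i in D. *)
Definition preimages {d' : measure_display} {E : measurableType d'} {I : Type}
    (D : set I) (X : I -> T -> E) : set (set T) :=
  \bigcup_(i in D) preimage_set_system setT (X i) measurable.

Definition sigma_of {d' : measure_display} {E : measurableType d'} {I : Type}
    (D : set I) (X : I -> T -> E) : set (set T) :=
  <<s preimages D X >>.

Definition independent2 (F G : set (set T)) : Prop :=
  forall A B, F A -> G B -> P (A `&` B) = (P A * P B)%E.

Definition mutually_independent {I : eqType} (F : I -> set (set T)) : Prop :=
  forall (J : seq I) (A : I -> set T), uniq J ->
    (forall i, i \in J -> F i (A i)) ->
    P (\bigcap_(i in [set` J]) A i) = (\prod_(i <- J) P (A i))%E.

(* Processes are indexed by R; only times t >= 0 are constrained. *)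
Definition brownian1 (b : R -> T -> R) : Prop :=
  [/\ (forall t, 0 <= t -> measurable_fun setT (b t)),
      {ae P, forall w, b 0 w = 0 /\
                       {within `[0, +oo[, continuous (b ^~ w)}},
      (forall s t, 0 <= s -> s < t ->
         has_law (fun w => b t w - b s w)
                 (normal_prob 0 (Num.sqrt (t - s)))) &
      (forall s t, 0 <= s -> s < t ->
         independent2
           (sigma_of [set r | 0 <= r <= s] b)
           (sigma_of [set: unit] (fun _ w => b t w - b s w)))].

Definition brownian {d : nat} (B : R -> T -> 'rV[R]_d) : Prop :=
  (forall k, brownian1 (fun t w => B t w ord0 k)) /\
  mutually_independent
    (fun k => sigma_of [set t | 0 <= t] (fun t w => B t w ord0 k)).

Definition augment (F : set (set T)) : set (set T) :=
  [set A | exists2 C, F C & P.-negligible ((A `\` C) `|` (C `\` A))].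

(* Strong solution on [0, +oo) of dX = sqrt 2 dB + b(t, X) dt: X is adapted to
   the augmented filtration generated by X_0 and B, has continuous paths, and
   satisfies the integrated equation (the noise being additive, no stochastic
   integral occurs). *)
Definition strong_solution {n d : nat} (B : R -> T -> 'M[R]_(n, d))
    (b : R -> 'M[R]_(n, d) -> 'M[R]_(n, d)) (X : R -> T -> 'M[R]_(n, d)) :
    Prop :=
  [/\ (forall t, 0 <= t -> measurable_fun setT (X t)),
      (forall t A, 0 <= t -> measurable A ->
         augment <<s preimages [set 0] X `|`
                     preimages [set s | 0 <= s <= t] B >> (X t @^-1` A)),
      {ae P, forall w, {within `[0, +oo[, continuous (X ^~ w)}} &
      {ae P, forall w, forall t i k, 0 <= t ->
         lebesgue_measure.-integrable `[0, t]
           (fun s => (b s (X s w) i k)%:E) /\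
         X t w i k = X 0 w i k + Num.sqrt 2 * B t w i k
           + \int[lebesgue_measure]_(s in `[0, t]) b s (X s w) i k}].

End Probability.

Definition particle_drift (R : realType) (d : nat) (V W : 'rV[R]_d -> R)
    (N : nat) (x : 'M[R]_(N, d)) : 'M[R]_(N, d) :=
  \matrix_(i < N, k < d)
    (- grad V (row i x)
     - N%:R^-1 *: \sum_(j < N) grad W (row i x - row j x)) ord0 k.

(* grad W * mu; meaningful under [conv_defined]. *)
Definition conv (R : realType) (d : nat) (F : 'rV[R]_d -> 'rV[R]_d)
    (mu : probability 'rV[R]_d R) (x : 'rV[R]_d) : 'rV[R]_d :=
  \row_(k < d) \int[mu]_y F (x - y) ord0 k.

Definition conv_defined (R : realType) (d : nat) (F : 'rV[R]_d -> 'rV[R]_d)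
    (mu : probability 'rV[R]_d R) : Prop :=
  forall (x : 'rV[R]_d) (k : 'I_d),
    mu.-integrable setT (fun y => (F (x - y) ord0 k)%:E).

Definition mckean_vlasov_solution {dT : measure_display}
    {T : measurableType dT} {R : realType} (P : probability T R) {d : nat}
    (V W : 'rV[R]_d -> R) (u : R -> probability 'rV[R]_d R)
    (B Xbar : R -> T -> 'rV[R]_d) : Prop :=
  [/\ (forall t, 0 <= t -> has_law P (Xbar t) (u t)),
      (forall t, 0 <= t -> conv_defined (grad W) (u t)) &
      strong_solution P B
        (fun t x => - grad V x - conv (grad W) (u t) x) Xbar].

(* [B i], [Xbar i] are the i-th Brownian motion and limit particle, [X N] is
   the system of N particles. Nothing is required of the joint law of the
   initial data beyond the marginals [u0] and [u0N N]. *)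
Record coupled_system {dT : measure_display} {T : measurableType dT}
    {R : realType} (P : probability T R) {d : nat} (V W : 'rV[R]_d -> R)
    (u0 : probability 'rV[R]_d R)
    (u0N : forall N : nat, probability 'M[R]_(N, d) R)
    (B : nat -> R -> T -> 'rV[R]_d)
    (X : forall N : nat, R -> T -> 'M[R]_(N, d))
    (u : R -> probability 'rV[R]_d R)
    (Xbar : nat -> R -> T -> 'rV[R]_d) : Prop := {
  cs_brownian : forall i, brownian P (B i) ;
  cs_brownian_indep :
    mutually_independent P (fun i => sigma_of [set t | 0 <= t] (B i)) ;
  cs_init_indep :
    independent2 P
      <<s preimages setT (fun i => Xbar i 0) `|`
          \bigcup_(N in [set N | (0 < N)%N])
            preimages [set: unit] (fun _ => X N 0) >>
      <<s \bigcup_i preimages [set t | 0 <= t] (B i) >> ;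
  cs_particles_init : forall N, (0 < N)%N -> has_law P (X N 0) (u0N N) ;
  cs_particles : forall N, (0 < N)%N ->
    strong_solution P
      (fun t w => \matrix_(i < N, k < d) B i t w ord0 k)
      (fun _ => particle_drift V W (N := N)) (X N) ;
  cs_limit_init : forall i, has_law P (Xbar i 0) u0 ;
  cs_limit_init_indep :
    mutually_independent P
      (fun i => sigma_of [set: unit] (fun _ => Xbar i 0)) ;
  cs_limit : forall i, mckean_vlasov_solution P V W u (B i) (Xbar i) }.

Definition coupling_moment {dT : measure_display} {T : measurableType dT}
    {R : realType} (P : probability T R) {d : nat}
    (X : forall N : nat, R -> T -> 'M[R]_(N, d))
    (Xbar : nat -> R -> T -> 'rV[R]_d) (q N : nat) (t : R) : \bar R :=
  (\sum_(i < N) 'E_P[fun w => (enorm (row i (X N t w) - Xbar i t w) ^+ q)%R])%E.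

(* Main.v *)
(* Write Y^i = X^i - Xbar^i and G^i = grad W * u_t (Xbar^i)
   - N^-1 sum_j grad W (Xbar^i - Xbar^j). The Brownian motions cancel in Y, so Y
   is pathwise absolutely continuous, and testing its equation against
   |Y^i|^(2p-2) Y^i, then symmetrizing the interaction by oddness, gives for
   S = (sum_i |Y^i|^(2p))^(1/(2p)) and H = (sum_i |G^i|^(2p))^(1/(2p)) the
   inequality S' <= - beta S + H. For p = 1 the interaction term is controlled by
   the convexity of W; for p > 1 this needs d = 1 or a quadratic W.

   It remains to bound E |G^i|^(2p) by C / N^p uniformly in time. Given Xbar^i,
   G^i is up to one term of order 1/N an average of independent centered
   variables, so a Marcinkiewicz-Zygmund bound applies, provided that
   E |Xbar^i - Xbar^j|^(2mp) is bounded. Only the difference of two limit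
   particles is needed: there the convolution with the unknown law u_t enters only
   as a lW-monotone drift, so the moments are bounded in terms of u_0 alone.
   As the noise is additive, this moment bound is obtained without stochastic
   calculus, from a one-step Lyapunov inequality on a time grid whose defect
   tends to zero almost surely, and Fatou's lemma. *)

From HB Require Import structures.
Require Import Defs.
From mathcomp Require Import all_boot all_order all_algebra.
From mathcomp Require Import all_classical all_reals all_analysis.
From mathcomp Require Import measurable_realfun.
From mathcomp Require Import ring lra zify.

Set Implicit Arguments.
Unset Strict Implicit.
Unset Printing Implicit Defensive.

Import Order.TTheory GRing.Theory Num.Theory.
Import numFieldNormedType.Exports.

Local Open Scope classical_set_scope.
Local Open Scope ring_scope.

(** * Elementary inequalities *)

(** No bound on the moments of u_t is assumed for t > 0, so a differential inequality for the
    moments of Xbar^i - Xbar^j would presuppose the integrability it should give. Instead, a level B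
    is shown to be invariant under one time step, on adapted events where the accumulated defect is
    at most 1: integrability travels along the grid together with the bound, and invariance, as
    opposed to accumulation, makes the bound uniform in time. The contraction rate of these
    differences is lV + lW, the half-sum of the positive numbers lV and lV + 2 lW. Nor is t -> u_t
    known to be measurable. Integrability of G^i along a path is read off from the equation of
    Xbar^i, and joint measurability from writing grad W * u_t as an expectation over a second,
    separate sample of a limit particle. In the final estimate Jensen's inequality is used with the
    weight exp(beta s), of mass at most exp(beta t) / beta on [0, t]; this is what makes the
    constant independent of t. The N particles contribute N^-p each, whence N^(1-p). All constants
    are produced before the probability space is introduced, so they depend only on the potentials,
    the exponent, the dimension and the initial laws. *)

Lemma exprD_taylor2 (R : realFieldType) (y z : R) (m : nat) :
  `|(y + z) ^+ m - y ^+ m - m%:R * y ^+ m.-1 * z| <=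
    (m * m.-1)%:R * z ^+ 2 * (`|y| + `|z|) ^+ (m - 2).
Proof.
case: m => [|m]; first by rewrite !expr0 mul0n !mul0r !subrr normr0.
elim: m => [|m IH].
  rewrite !expr1 muln0 !mul0r expr0 mulr1 mul1r.
  by rewrite (_ : _ - _ = 0) ?normr0//; ring.
have yz0 : 0 <= `|y| + `|z| by rewrite addr_ge0.
have -> : (y + z) ^+ m.+2 - y ^+ m.+2 - m.+2%:R * y ^+ m.+1 * z =
  (y + z) * ((y + z) ^+ m.+1 - y ^+ m.+1 - m.+1%:R * y ^+ m * z)
    + m.+1%:R * z ^+ 2 * y ^+ m.
  by rewrite -!natr1 !exprS; ring.
apply: (le_trans (ler_normD _ _)).
(* The first part of the coefficient pays for the induction hypothesis multiplied by y + z, the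
   second for the new term (m + 1) z^2 y^m. *)
rewrite (_ : (m.+2 * m.+1)%:R = (m.+1 * m)%:R + (2 * m.+1)%:R :> R); last first.
  by rewrite -natrD; congr _%:R; lia.
rewrite subSS subSS subn0 [X in _ <= X * _]mulrDl [leRHS]mulrDl lerD//.
  rewrite normrM.
  apply: (le_trans (ler_pM _ _ (ler_normD y z) IH)) => //.
  case: m {IH} => [|m]; first by rewrite muln0 !mul0r mulr0.
  have E (a b e : R) : e * (a * b * e ^+ m) = a * b * e ^+ m.+1.
    by rewrite exprS; ring.
  by rewrite !subSS subn0 /= le_eqVlt; apply/orP; left; apply/eqP; exact: E.
have F (a : R) : 0 <= a -> `|a * y ^+ m| <= a * `|y| ^+ m.
  by move=> a0; rewrite normrM normrX ger0_norm.
have a0 : 0 <= m.+1%:R * z ^+ 2 by rewrite mulr_ge0 ?sqr_ge0.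
apply: le_trans (F _ a0) _.
apply: ler_pM; rewrite ?exprn_ge0//.
- by rewrite ler_wpM2r ?sqr_ge0// ler_nat leq_pmull.
- by rewrite lerXn2r ?nnegrE// lerDl.
Qed.

(** Comparison with |I| times the largest term replaces convexity; the constant |I|^j is cruder than
    |I|^(j-1), but only its independence of the a i matters. *)
Lemma expr_sum_le (R : realFieldType) (I : finType) (a : I -> R) (j : nat) :
  (forall i, 0 <= a i) -> (0 < j)%N ->
  (\sum_i a i) ^+ j <= #|I|%:R ^+ j * \sum_i a i ^+ j.
Proof.
move=> a0 j0; case: (pickP (xpredT : pred I)) => [i0 _|no]; last first.
  rewrite !big_pred0// expr0n; case: j j0 => //= j _.
  by rewrite mulr0.
have [i _ hi] := @arg_maxP _ R I i0 xpredT a isT.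
have S : \sum_k a k <= #|I|%:R * a i.
  rewrite mulr_natl -sumr_const; apply: ler_sum => k _; exact: hi.
apply: (@le_trans _ _ ((#|I|%:R * a i) ^+ j)).
  by apply: lerXn2r => //; rewrite nnegrE ?mulr_ge0// sumr_ge0.
rewrite exprMn ler_wpM2l ?exprn_ge0//.
by rewrite (bigD1 i)//= lerDl sumr_ge0// => k _; rewrite exprn_ge0.
Qed.

Lemma exprD_le2 (R : realFieldType) (a b : R) (j : nat) :
  0 <= a -> 0 <= b -> (a + b) ^+ j <= 2 ^+ j * (a ^+ j + b ^+ j).
Proof.
move=> a0 b0; case: j => [|j]; first by rewrite !expr0; lra.
have := @expr_sum_le R bool (fun t => if t then a else b) j.+1.
by rewrite card_bool !big_bool; apply => // -[].
Qed.

Lemma even_expr_ge0 (R : realDomainType) (x : R) (j : nat) : 0 <= x ^+ (2 * j).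
Proof. by rewrite exprM exprn_ge0// sqr_ge0. Qed.

Lemma norm_exprM2 (R : realDomainType) (x : R) (j : nat) :
  `|x| ^+ (2 * j) = x ^+ (2 * j).
Proof. by rewrite !exprM real_normK ?num_real. Qed.

(** The first-order term is kept exact because it vanishes in mean when x is centered and
    independent of s. The Taylor remainder is reduced to its two extreme monomials, so that only
    moments of x of order 2 and 2 (q + 1) enter. *)
Lemma even_exprD_le (R : realFieldType) (q : nat) : exists2 C : R, 0 <= C &
  forall s x : R, (s + x) ^+ (2 * q.+1) <= s ^+ (2 * q.+1)
    + (2 * q.+1)%:R * s ^+ (2 * q).+1 * x
    + C * (s ^+ (2 * q) * x ^+ 2 + x ^+ (2 * q.+1)).
Proof.
pose K : R := (2 * q.+1 * (2 * q).+1)%:R * 2 ^+ (2 * q).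
exists K => [|s x]; first by rewrite mulr_ge0// exprn_ge0.
have := exprD_taylor2 s x (2 * q.+1).
rewrite (_ : (2 * q.+1).-1 = (2 * q).+1)//; last by rewrite mulnS.
rewrite (_ : (2 * q.+1 - 2)%N = (2 * q)%N); last by rewrite mulnS addKn.
move=> /(le_trans (ler_norm _)).
suff H : x ^+ 2 * (`|s| + `|x|) ^+ (2 * q) <=
    2 ^+ (2 * q) * (s ^+ (2 * q) * x ^+ 2 + x ^+ (2 * q.+1)).
  have : (2 * q.+1 * (2 * q).+1)%:R * (x ^+ 2 * (`|s| + `|x|) ^+ (2 * q)) <=
    (2 * q.+1 * (2 * q).+1)%:R * (2 ^+ (2 * q) * (s ^+ (2 * q) * x ^+ 2 + x ^+ (2 * q.+1))).
    by rewrite ler_wpM2l.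
  rewrite !mulrA -/K; lra.
apply: le_trans (_ : x ^+ 2 * (2 ^+ (2 * q) * (`|s| ^+ (2 * q) + `|x| ^+ (2 * q))) <= _).
  by rewrite ler_wpM2l ?sqr_ge0// exprD_le2.
by rewrite !norm_exprM2 mulnS exprD; lra.
Qed.

(** Here th stands for a shifted |D|^2, xi for the noise of the step and z for D . xi. The power q +
    1 is expanded to second order around th; the term linear in z stays exact since its mean is
    zero. As th >= 1 and z^2 <= th |xi|^2, the square of the increment costs one factor th and not
    two, so the whole error is of order th^q only. *)
Lemma lyapunov_step (R : realFieldType) (d q : nat) (k : R) : 0 <= k ->
  exists2 K : R, 0 <= K &
  forall (h th th' z : R) (xi : 'I_d -> R), 0 <= h -> k * h <= 1 -> 1 <= th ->
    z ^+ 2 <= th * \sum_l xi l ^+ 2 -> 0 <= th' ->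
    (1 + k * h) * th' <= th + 2 * (k * h) + 2 * z + \sum_l xi l ^+ 2 ->
    (1 + k * h) * th' ^+ q.+1 <= th ^+ q.+1 + (2 * q.+1)%:R * (th ^+ q * z)
      + K * (th ^+ q * (h + \sum_l (xi l ^+ 2 + xi l ^+ (2 * q.+1)))).
Proof.
move=> k0.
(* K1 collects the first- and second-order Taylor coefficients, both errors being multiples of th^q
   (k h + x) (1 + x)^q with x = |xi|^2; K2 then reduces (k h + x) (1 + x)^q to h and the power sums
   of the noise. *)
pose K1 : R := q.+1%:R * 2 + (q.+1 * q)%:R * (12 * 4 ^+ q).
pose K2 : R := 2 ^+ q * (2 * k + 1 + 2 * d%:R ^+ q.+1).
have K10 : 0 <= K1 by rewrite addr_ge0// !mulr_ge0// exprn_ge0.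
exists (K1 * K2) => [|h th th' z xi h0 kh1 th1 zle th'0 th'le].
  by rewrite mulr_ge0// mulr_ge0 ?exprn_ge0// !addr_ge0// mulr_ge0// exprn_ge0.
set x := \sum_l xi l ^+ 2 in zle th'le *.
have x0 : 0 <= x by rewrite sumr_ge0// => l _; rewrite sqr_ge0.
have kh0 : 0 <= k * h by rewrite mulr_ge0.
have th0 : 0 <= th by lra.
set zeta := 2 * (k * h) + 2 * z + x.
have th'y : (1 + k * h) * th' <= th + zeta by rewrite /zeta; lra.
have absz : `|z| <= (th + x) / 2.
  rewrite -(@ler_pXn2r _ 2) ?nnegrE//; last by lra.
  by rewrite real_normK ?num_real//; have := sqr_ge0 (th - x); move: zle; lra.
have abszeta : `|zeta| <= 3 * th + 2 * x.
  rewrite ler_norml; move: absz; rewrite ler_norml => /andP[? ?].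
  by rewrite /zeta; apply/andP; split; nra.
have sqzeta : zeta ^+ 2 <= 12 * th * ((k * h + x) * (1 + x)).
  have : zeta ^+ 2 <= 3 * ((2 * (k * h)) ^+ 2 + (2 * z) ^+ 2 + x ^+ 2).
    rewrite /zeta; have := sqr_ge0 (2 * (k * h) - 2 * z).
    by have := sqr_ge0 (2 * (k * h) - x); have := sqr_ge0 (2 * z - x); lra.
  have : (k * h) ^+ 2 <= k * h by rewrite expr2; nra.
  have : 0 <= k * h * x by rewrite mulr_ge0.
  have : 0 <= x ^+ 2 by rewrite sqr_ge0.
  rewrite !exprMn => ? ? ? ?.
  have : zeta ^+ 2 <= 12 * (k * h + th * x + x ^+ 2) by lra.
  move=> /le_trans; apply.
  by rewrite -mulrA ler_wpM2l//; nra.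
have powle : (q.+1 * q)%:R * (zeta ^+ 2 * (`|th| + `|zeta|) ^+ (q.+1 - 2)) <=
   (q.+1 * q)%:R * (12 * 4 ^+ q) * (th ^+ q * ((k * h + x) * (1 + x) ^+ q)).
  case: q @K1 @K2 K10 => [|q] K1 K2 K10; first by rewrite muln0 !mul0r.
  rewrite -mulrA ler_wpM2l// !subSS subn0.
  apply: (@le_trans _ _ (12 * th * ((k * h + x) * (1 + x)) * (4 * th * (1 + x)) ^+ q)).
    apply: ler_pM; rewrite ?sqr_ge0 ?exprn_ge0 ?addr_ge0//.
    apply: lerXn2r; rewrite ?nnegrE ?addr_ge0 ?mulr_ge0//; try lra.
    by rewrite (ger0_norm th0); nra.
  rewrite !exprMn !exprS.
  set L := (X in X <= _).
  have L0 : 0 <= L by rewrite !mulr_ge0 ?exprn_ge0//; lra.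
  by rewrite [leRHS](_ : _ = 4 * L); [lra|rewrite /L; ring].
have powx : (k * h + x) * (1 + x) ^+ q <=
    K2 * (h + \sum_l (xi l ^+ 2 + xi l ^+ (2 * q.+1))).
  have xq : x ^+ q.+1 <= d%:R ^+ q.+1 * \sum_l xi l ^+ (2 * q.+1).
    have := @expr_sum_le R 'I_d (fun l => xi l ^+ 2) q.+1
      (fun l => sqr_ge0 _) isT.
    rewrite card_ord => /le_trans; apply; rewrite ler_wpM2l ?exprn_ge0//.
    by rewrite le_eqVlt (eq_bigr _ (fun l _ => esym (exprM _ _ _))) eqxx.
  have S0 : 0 <= \sum_l xi l ^+ (2 * q.+1).
    by rewrite sumr_ge0// => l _; exact: even_expr_ge0.
  have D0 : 0 <= d%:R ^+ q.+1 :> R by rewrite exprn_ge0.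
  have xqle : x ^+ q <= 1 + x ^+ q.+1.
    have [x1|x1] := leP x 1.
      by rewrite (le_trans (exprn_ile1 _ _ _))// lerDl exprn_ge0.
    by rewrite exprS; apply: (@le_trans _ _ (x * x ^+ q)); rewrite ?lerDr// ler_peMl ?exprn_ge0// ltW.
  have kxq : k * h * x ^+ q <= k * h + x ^+ q.+1.
    have := @ler_wpM2l _ _ kh0 _ _ xqle.
    rewrite mulrDr mulr1 => /le_trans; apply; rewrite lerD2l.
    by rewrite ler_piMl// exprn_ge0.
  apply: (@le_trans _ _ ((k * h + x) * (2 ^+ q * (1 + x ^+ q)))).
    rewrite ler_wpM2l ?addr_ge0//.
    by have := @exprD_le2 _ 1 x q ler01 x0; rewrite expr1n.
  rewrite /K2 mulrCA -[leRHS]mulrA ler_wpM2l ?exprn_ge0// big_split/= -/x.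
  have : 0 <= x ^+ q.+1 by rewrite exprn_ge0.
  have : 0 <= k * x by rewrite mulr_ge0.
  have : 0 <= d%:R ^+ q.+1 * h by rewrite mulr_ge0.
  have : 0 <= d%:R ^+ q.+1 * x by rewrite mulr_ge0.
  have : 0 <= k * \sum_l xi l ^+ (2 * q.+1) by rewrite mulr_ge0.
  move: xq kxq S0; rewrite (exprS x q).
  set X := x ^+ q; set S := \sum_l _; set DD := d%:R ^+ q.+1.
  move=> *; lra.
have yz : q.+1%:R * th ^+ q * (2 * (k * h) + x) <=
    q.+1%:R * 2 * (th ^+ q * ((k * h + x) * (1 + x) ^+ q)).
  rewrite -!mulrA ler_wpM2l// [leRHS]mulrCA.
  rewrite ler_wpM2l ?exprn_ge0//.
  have : 1 <= (1 + x) ^+ q by rewrite exprn_ege1// lerDl.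
  have : 0 <= k * h + x by rewrite addr_ge0.
  set E := (1 + x) ^+ q; nra.
apply: (@le_trans _ _ ((th + zeta) ^+ q.+1)).
  (* Of the q + 1 factors 1 + k h only one is kept, the others being at least 1. *)
  apply: (@le_trans _ _ (((1 + k * h) * th') ^+ q.+1)).
    rewrite exprMn ler_wpM2r ?exprn_ge0// exprS ler_peMr ?addr_ge0//.
    by rewrite exprn_ege1// lerDl.
  have u0 : 0 <= (1 + k * h) * th' by rewrite mulr_ge0// addr_ge0.
  by apply: lerXn2r; rewrite ?nnegrE//; exact: le_trans th'y.
have := exprD_taylor2 th zeta q.+1.
rewrite -[X in _ <= X]mulrA => /(le_trans (ler_norm _)) /le_trans /(_ powle) /=.
have thq0 : 0 <= th ^+ q by rewrite exprn_ge0.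
have := ler_wpM2l (mulr_ge0 K10 thq0) powx.
have -> : q.+1%:R * th ^+ q * zeta = q.+1%:R * th ^+ q * (2 * (k * h) + x) +
  (2 * q.+1)%:R * (th ^+ q * z) by rewrite natrM /zeta; ring.
rewrite (_ : K1 * K2 * _ = K1 * th ^+ q * (K2 * (h + \sum_l (xi l ^+ 2 + xi l ^+ (2 * q.+1))))); last by ring.
have -> : K1 * th ^+ q * ((k * h + x) * (1 + x) ^+ q) =
   q.+1%:R * 2 * (th ^+ q * ((k * h + x) * (1 + x) ^+ q)) +
   (q.+1 * q)%:R * (12 * 4 ^+ q) * (th ^+ q * ((k * h + x) * (1 + x) ^+ q)).
  by rewrite /K1; ring.
lra.
Qed.

(* The exact factor [2 ^ p] (rather than [2 ^ (2 p - 1)]) is what the rate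
   [sqrt 2] in front of [a] gives once [b] is small compared with [a]. *)
Lemma exprD_le_pow2 (R : rcfType) (p : nat) : exists2 C : R, 0 <= C &
  forall a b : R, 0 <= a -> 0 <= b ->
    (a + b) ^+ (2 * p) <= 2 ^+ p * a ^+ (2 * p) + C * b ^+ (2 * p).
Proof.
(* If 4 b <= a then (a + b)^2 <= (25 / 16) a^2 <= 2 a^2; otherwise a + b < 5 b. *)
exists (5 ^+ (2 * p)) => [|a b a0 b0]; first exact: exprn_ge0.
have [ab|ab] := leP (4 * b) a.
  rewrite (@le_trans _ _ (2 ^+ p * a ^+ (2 * p)))//; last first.
    by rewrite lerDl mulr_ge0// exprn_ge0.
  rewrite !exprM -exprMn; apply: lerXn2r; rewrite ?nnegrE.
  - exact: sqr_ge0.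
  - by rewrite mulr_ge0// sqr_ge0.
  - by nra.
rewrite (@le_trans _ _ (5 ^+ (2 * p) * b ^+ (2 * p)))//; last first.
  by rewrite lerDr mulr_ge0// exprn_ge0.
rewrite -exprMn; apply: lerXn2r; rewrite ?nnegrE; lra.
Qed.

(** Young's inequality for the conjugate exponents (n + 1) / n and n + 1, by induction from (x - y)
    (x^(n+1) - y^(n+1)) >= 0. It is also the tangent-line inequality of the power n + 1, and is used
    as such for Jensen's inequality. *)
Lemma young_expr (R : realFieldType) (n : nat) (x y : R) : 0 <= x -> 0 <= y ->
  n.+1%:R * (x ^+ n * y) <= n%:R * x ^+ n.+1 + y ^+ n.+1.
Proof.
move=> x0 y0; elim: n => [|n IH]; first by rewrite expr0 !mul1r mul0r add0r.
have A : 0 <= (x - y) * (x ^+ n.+1 - y ^+ n.+1).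
  have [xy|/ltW yx] := leP x y.
    by apply: mulr_le0; rewrite subr_le0//; apply: lerXn2r.
  by apply: mulr_ge0; rewrite subr_ge0//; apply: lerXn2r.
have := ler_wpM2l x0 IH; move: A; rewrite -!natr1 !exprS.
set X := x ^+ n; set Y := y ^+ n; nra.
Qed.

(** The norms A and B are given through their powers, which avoids roots. After normalization to A =
    B = 1, Young's inequality is summed term by term; a zero norm forces a zero family. *)
Lemma hoelder_sum (R : realFieldType) (I : finType) (n : nat) (a b : I -> R)
    (A B : R) : (forall i, 0 <= a i) -> (forall i, 0 <= b i) ->
  0 <= A -> 0 <= B ->
  \sum_i a i ^+ n.+1 = A ^+ n.+1 -> \sum_i b i ^+ n.+1 = B ^+ n.+1 ->
  \sum_i a i ^+ n * b i <= A ^+ n * B.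
Proof.
move=> a0 b0 A0 B0 hA hB.
have zero (f : I -> R) (F : R) : (forall i, 0 <= f i) ->
    \sum_i f i ^+ n.+1 = F ^+ n.+1 -> F = 0 -> forall i, f i = 0.
  move=> f0 + F0 i; rewrite F0 expr0n/= => /eqP.
  rewrite psumr_eq0; last by move=> j _; rewrite exprn_ge0.
  by move=> /allP/(_ i (mem_index_enum _)) /=; rewrite expf_eq0/= => /eqP.
case: n hA hB zero => [|n] hA hB zero.
  by rewrite expr0 mul1r -(expr1 B) -hB; apply: ler_sum => i _; rewrite mul1r.
have [Az|An0] := eqVneq A 0.
  rewrite big1 ?mulr_ge0 ?exprn_ge0// => i _.
  by rewrite (zero _ _ a0 hA Az) expr0n/= mul0r.
have [Bz|Bn0] := eqVneq B 0.
  rewrite big1 ?mulr_ge0 ?exprn_ge0// => i _.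
  by rewrite (zero _ _ b0 hB Bz) mulr0.
have Y : \sum_i n.+2%:R * ((a i / A) ^+ n.+1 * (b i / B)) <=
     \sum_i (n.+1%:R * (a i / A) ^+ n.+2 + (b i / B) ^+ n.+2).
  by apply: ler_sum => i _; apply: young_expr; rewrite divr_ge0.
move: Y; rewrite big_split/= -!mulr_sumr.
under [X in _ <= _ * X + _]eq_bigr do rewrite expr_div_n.
under [X in _ <= _ + X]eq_bigr do rewrite expr_div_n.
rewrite -!mulr_suml hA hB !divff ?expf_neq0// mulr1 natr1 -[leRHS]mulr1.
rewrite ler_pM2l ?ltr0n// => Y.
have -> : \sum_i a i ^+ n.+1 * b i =
    A ^+ n.+1 * B * \sum_i (a i / A) ^+ n.+1 * (b i / B).
  rewrite mulr_sumr; apply: eq_bigr => i _.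
  by rewrite expr_div_n; field; rewrite Bn0 expf_neq0.
by rewrite ler_piMr// mulr_ge0// exprn_ge0.
Qed.

(** Cauchy-Schwarz by Lagrange's identity. *)
Lemma sqr_sum_mul_le (R : realFieldType) (I : finType) (a b : I -> R) :
  (\sum_i a i * b i) ^+ 2 <= (\sum_i a i ^+ 2) * \sum_i b i ^+ 2.
Proof.
have : 0 <= \sum_i \sum_j (a i * b j - a j * b i) ^+ 2.
  by apply: sumr_ge0 => i _; apply: sumr_ge0 => j _; exact: sqr_ge0.
have -> : \sum_i \sum_j (a i * b j - a j * b i) ^+ 2 =
    2 * ((\sum_i a i ^+ 2) * \sum_i b i ^+ 2) - 2 * (\sum_i a i * b i) ^+ 2.
  rewrite expr2 !big_distrlr/=.
  transitivity (\sum_i \sum_j a i ^+ 2 * b j ^+ 2 + \sum_i \sum_j a j ^+ 2 * b i ^+ 2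
      - \sum_i \sum_j 2 * (a i * b i * (a j * b j))).
    rewrite -big_split -sumrB/=; apply: eq_bigr => i _.
    by rewrite -big_split -sumrB/=; apply: eq_bigr => j _; ring.
  rewrite [X in _ + X - _]exchange_big/=; congr (_ - _); first by ring.
  by rewrite mulr_sumr; apply: eq_bigr => i _; rewrite mulr_sumr.
lra.
Qed.

(** * Time grids and a pathwise energy inequality *)

Section lincomb.
Context d (T : measurableType d) (R : realType) (mu : {measure set T -> \bar R}).

Lemma integrable_EFinD (D : set T) (f g : T -> R) : measurable D ->
  mu.-integrable D (EFin \o f) -> mu.-integrable D (EFin \o g) ->
  mu.-integrable D (EFin \o (fun x => f x + g x)).
Proof. by move=> mD fi gi; have := integrableD mD fi gi. Qed.

Lemma integrable_EFinZl (D : set T) (c : R) (f : T -> R) : measurable D ->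
  mu.-integrable D (EFin \o f) -> mu.-integrable D (EFin \o (fun x => c * f x)).
Proof.
move=> mD fi.
rewrite (_ : _ \o _ = (fun x => c%:E * (EFin \o f) x)%E)//.
exact: integrableZl.
Qed.

Lemma Rintegral_lincomb (D : set T) (I : Type) (r : seq I) (c : I -> R)
    (f : I -> T -> R) : measurable D ->
  (forall i, mu.-integrable D (EFin \o f i)) ->
  mu.-integrable D (EFin \o (fun x => \sum_(i <- r) c i * f i x)) /\
  \int[mu]_(x in D) (\sum_(i <- r) c i * f i x) =
    \sum_(i <- r) c i * \int[mu]_(x in D) f i x.
Proof.
move=> mD fi; elim: r => [|i r [IH1 IH2]].
  split; first by under eq_fun do rewrite big_nil; exact: integrable0.
  rewrite big_nil; under eq_Rintegral do rewrite big_nil.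
  by rewrite Rintegral_cst// mul0r.
have ci : mu.-integrable D (EFin \o (fun x => c i * f i x)).
  exact: integrable_EFinZl.
split.
  under eq_fun do rewrite big_cons.
  pose g x := \sum_(j <- r) c j * f j x.
  rewrite (_ : _ \o _ = ((EFin \o (fun x => (c i * f i x)%R)) \+ (EFin \o g))%E)//.
  exact: integrableD.
rewrite big_cons; under eq_Rintegral do rewrite big_cons.
by rewrite RintegralD// IH2 RintegralZl.
Qed.

End lincomb.

Section paths.
Variable R : realType.
Notation mu := (@lebesgue_measure R).
Notation int f a b := (\int[mu]_(x in `[a, b]) f x).

(** Heine's theorem with one modulus for a whole finite family, so that a single mesh size serves
    all paths at once. *)
Lemma uniform_continuity_itv (I : finType) (f : I -> R -> R) (t e : R) : 0 < e ->
  (forall i, {within `[0, t], continuous (f i)}) ->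
  exists2 del : R, 0 < del & forall i x y, 0 <= x <= t -> 0 <= y <= t ->
    `|x - y| < del -> `|f i x - f i y| < e.
Proof.
move=> e0 cf.
have one i : exists del : R, 0 < del /\ forall x y, 0 <= x <= t -> 0 <= y <= t ->
    `|x - y| < del -> `|f i x - f i y| < e.
  have := @segment_compact R 0 t; rewrite compact_near_coveringP -near_covering_withinP.
  move=> ncov.
  have hK : \forall del \near (0 : R)^'+, `[0, t] `<=` [set x | forall y,
      0 <= y <= t -> `|x - y| < del -> `|f i x - f i y| < e].
    apply: ncov.
    move=> x Kx; have /subspace_continuousP/(_ x Kx)/cvgrPdist_lt := cf i.
    move=> /(_ (e / 2)) /(_ ltac:(by rewrite divr_gt0)).
    rewrite near_withinE => -[rr/= rr0 hr].
    exists (ball x (rr / 2), `]-oo, (rr / 2)[%classic).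
      split; first by apply: nbhsx_ballx; rewrite divr_gt0.
      by rewrite /=; apply: nbhs_right_lt; rewrite divr_gt0.
    move=> -[x' del] [/= x'x +] Kx' y Ky xy; rewrite in_itv/= => drr.
    have A : `|f i x - f i x'| < e / 2.
      by apply: hr => //=; apply: lt_trans x'x _; rewrite ltr_pdivrMr//; lra.
    have B : `|f i x - f i y| < e / 2.
      apply: hr; rewrite /= ?in_itv//=.
      have : `|x - y| <= `|x - x'| + `|x' - y|.
        by rewrite (_ : x - y = (x - x') + (x' - y)) ?ler_normD//; ring.
      by move: x'x; rewrite /ball/=; lra.
    rewrite (_ : f i x' - f i y = - (f i x - f i x') + (f i x - f i y)); last by ring.
    by rewrite (le_lt_trans (ler_normD _ _))// normrN; lra.
  have [del [/= del0 hd]] := filter_ex (filterI (nbhs_right_gt (0 : R)) hK).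
  by exists del; split=> // x y x0t; apply: hd; rewrite /= in_itv.
have [del hdel] := choice one.
(* The default 1 provides a modulus when the family is empty. *)
exists (\big[Num.min/1]_i del i).
  by apply: lt_bigmin => // i _; have [] := hdel i.
move=> i x y xt yt; have [_ h] := hdel i.
by move=> xy; apply: h => //; apply: lt_le_trans xy _; exact: bigmin_le_cond.
Qed.

Lemma within_continuous_sum (A : set R) (I : finType) (f : I -> R -> R) :
  (forall i, {within A, continuous (f i)}) ->
  {within A, continuous (fun s => \sum_i f i s)}.
Proof.
move=> cf x; apply: cvg_big => [|i _]; first exact: add_continuous.
exact: cf.
Qed.

Lemma within_continuousX (A : set R) (f : R -> R) (n : nat) :
  {within A, continuous f} -> {within A, continuous (fun s => f s ^+ n)}.
Proof.
move=> cf x; apply: (@cvg_comp _ _ _ f (fun y => y ^+ n) _ _ _ (cf x)).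
exact: exprn_continuous.
Qed.

Definition grid (t : R) (n k : nat) : R := k%:R * (t / n%:R).

Lemma grid0 t n : grid t n 0 = 0. Proof. by rewrite /grid mul0r. Qed.

Lemma gridn t n : (0 < n)%N -> grid t n n = t.
Proof. by move=> n0; rewrite /grid; field; rewrite pnatr_eq0; lia. Qed.

Lemma gridS t n k : grid t n k.+1 = grid t n k + t / n%:R.
Proof. by rewrite /grid -natr1; ring. Qed.

Lemma grid_ge0 t n k : 0 <= t -> 0 <= grid t n k.
Proof. by move=> t0; rewrite mulr_ge0// divr_ge0. Qed.

Lemma grid_homo t n k l : 0 <= t -> (k <= l)%N -> grid t n k <= grid t n l.
Proof. by move=> t0 kl; rewrite ler_wpM2r ?divr_ge0// ler_nat. Qed.

Lemma grid_le t n k : 0 <= t -> (k <= n)%N -> grid t n k <= t.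
Proof.
case: n => [|n] t0 kn; first by rewrite (_ : k = 0%N) ?grid0//; lia.
by rewrite -[leRHS](@gridn t n.+1)//; exact: grid_homo.
Qed.

Lemma Rint_chasles (f : R -> R) (t a b : R) : mu.-integrable `[0, t] (EFin \o f) ->
  0 <= a -> a <= b -> b <= t -> int f 0 b = int f 0 a + int f a b.
Proof.
move=> fi a0 ab bt.
have fib : mu.-integrable `[0, b] (EFin \o f).
  by apply: integrableS fi => //; apply: subset_itvl; rewrite bnd_simp.
have := @Rintegral_itvB R f (BLeft 0) (BRight b) a fib.
rewrite !bnd_simp => /(_ a0 ab).
rewrite Rintegral_itv_obnd_cbnd; last first.
  by apply: integrableS fib => //; apply: subset_itvr; rewrite bnd_simp.
by move=> <-; ring.
Qed.

Lemma integrable_subitv (f : R -> R) (t a b : R) :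
  mu.-integrable `[0, t] (EFin \o f) -> 0 <= a -> b <= t ->
  mu.-integrable `[a, b] (EFin \o f).
Proof.
by move=> fi a0 bt; apply: integrableS fi => //; apply: subset_itv; rewrite bnd_simp.
Qed.

Lemma Rint_cst (r a b : R) : a <= b -> int (fun=> r) a b = r * (b - a).
Proof.
move=> ab; rewrite Rintegral_cst//=; congr (_ * _).
have /= -> := lebesgue_measure_itv `[a, b]; rewrite lte_fin.
by move: ab; rewrite le_eqVlt => /predU1P[->|->]; rewrite ?ltxx ?subrr.
Qed.

Lemma sum_Rint_grid (f : R -> R) (t : R) (n : nat) : 0 <= t -> (0 < n)%N ->
  mu.-integrable `[0, t] (EFin \o f) ->
  \sum_(k < n) int f (grid t n k) (grid t n k.+1) = int f 0 t.
Proof.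
move=> t0 n0 fi; rewrite -[in RHS](gridn t n0).
suff H m : (m <= n)%N -> \sum_(k < m) int f (grid t n k) (grid t n k.+1) =
    int f 0 (grid t n m) by exact: H.
elim: m => [_|m IH mn].
  by rewrite big_ord0 grid0 set_itv1 Rintegral_set1.
rewrite big_ord_recr/= IH 1?ltnW//.
by rewrite (@Rint_chasles f t (grid t n m) (grid t n m.+1))// ?grid_ge0 ?grid_le ?grid_homo.
Qed.

Lemma integrable_abs (D : set R) (f : R -> R) : mu.-integrable D (EFin \o f) ->
  mu.-integrable D (EFin \o (fun x => `|f x|)).
Proof. by move=> fi; have := integrable_norm fi. Qed.

(* The drift is taken implicitly, at the end point [y] of the step: the moment
   recursion then needs no positivity of [1 - 2 c h]. *)
Definition energy_defect (d : nat) (c h : R) (x y eta : 'I_d -> R) : R :=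
  Num.max 0 ((1 + 2 * c * h) * \sum_l y l ^+ 2 - \sum_l x l ^+ 2
    - 2 * \sum_l x l * eta l - \sum_l eta l ^+ 2).

(* Writing the increment of [|D|^2] with the endpoint value of [D] and absorbing
   the cross term with the noise by [2 u v - u^2 <= v^2] leaves only the drift
   against the oscillation of [D], which is small by uniform continuity. *)
Lemma energy_defect_sum (d : nat) (D a eta : 'I_d -> R -> R) (t c : R) :
  0 <= t -> 0 <= c ->
  (forall l, {within `[0, t], continuous (D l)}) ->
  (forall l, mu.-integrable `[0, t] (EFin \o a l)) ->
  (forall l s, 0 <= s <= t -> D l s = D l 0 + eta l s + int (a l) 0 s) ->
  (forall s, 0 <= s <= t -> \sum_l D l s * a l s <= - c * \sum_l D l s ^+ 2) ->
  forall e, 0 < e -> exists n0, forall n, (n0 <= n)%N -> (0 < n)%N ->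
    \sum_(k < n) energy_defect c (t / n%:R)
      (fun l => D l (grid t n k)) (fun l => D l (grid t n k.+1))
      (fun l => eta l (grid t n k.+1) - eta l (grid t n k)) <= e.
Proof.
move=> t0 c0 cD ia eqD diss e e0.
pose A := \sum_l int (fun s => `|a l s|) 0 t.
have A0 : 0 <= A by apply: sumr_ge0 => l _; apply: Rintegral_ge0.
(* The errors of all steps add up to e1 (2 A + 2 c t), hence to at most e; the summand 1 keeps the
   denominator positive. *)
pose e1 := e / (2 * A + 2 * c * t + 1).
have den0 : 0 < 2 * A + 2 * c * t + 1.
  by rewrite ltr_wpDl// addr_ge0// !mulr_ge0.
have e10 : 0 < e1 by rewrite divr_gt0.
pose f (o : option 'I_d) := if o is Some l then D l else fun s => \sum_l D l s ^+ 2.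
have cf o : {within `[0, t], continuous (f o)}.
  case: o => [l|]; first exact: cD.
  by apply: within_continuous_sum => l; apply: within_continuousX; exact: cD.
have [del del0 hdel] := uniform_continuity_itv e10 cf.
pose n0 := (Num.truncn (t / del)).+1.
exists n0 => n n0n npos.
have hn : t / n%:R < del.
  rewrite ltr_pdivrMr ?ltr0n// mulrC -ltr_pdivrMr//.
  by rewrite (lt_le_trans (truncnS_gt _))// ler_nat.
have h0 : 0 <= t / n%:R by rewrite divr_ge0.
have step k : (k < n)%N ->
    energy_defect c (t / n%:R)
      (fun l => D l (grid t n k)) (fun l => D l (grid t n k.+1))
      (fun l => eta l (grid t n k.+1) - eta l (grid t n k)) <=
    2 * e1 * (c * (t / n%:R)
      + \sum_l int (fun s => `|a l s|) (grid t n k) (grid t n k.+1)).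
  move=> kn; set x := grid t n k; set y := grid t n k.+1.
  have x0 : 0 <= x by exact: grid_ge0.
  have yt : y <= t by exact: grid_le.
  have xy : y = x + t / n%:R by exact: gridS.
  have xley : x <= y by rewrite xy lerDl.
  have xin : 0 <= x <= t by apply/andP; split => //; exact: le_trans yt.
  have yin : 0 <= y <= t by apply/andP; split => //; exact: le_trans xley.
  pose I l := int (a l) x y.
  have incr l : D l y = D l x + (eta l y - eta l x) + I l.
    rewrite (eqD l y)// (eqD l x)// (@Rint_chasles (a l) t x y)//.
    by rewrite /I; ring.
  have ial l : mu.-integrable `[x, y] (EFin \o a l).
    exact: integrable_subitv (ia l) _ _.
  have iabs l : mu.-integrable `[x, y] (EFin \o (fun s => `|a l s|)).
    exact: integrable_abs.
  have [i1 E1] := @Rintegral_lincomb _ _ R mu `[x, y]%classic _ (index_enum 'I_d)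
    (fun l => D l y) a (measurable_itv _) ial.
  have [i2 E2] := @Rintegral_lincomb _ _ R mu `[x, y]%classic _ (index_enum 'I_d)
    (fun=> e1) (fun l s => `|a l s|) (measurable_itv _) iabs.
  pose r := \sum_l D l y ^+ 2.
  have icst : mu.-integrable `[x, y] (EFin \o (fun=> - c * r + c * e1)).
    by apply: continuous_compact_integrable; [exact: segment_compact|exact: cst_continuous].
  have key : \sum_l D l y * I l <= (- c * r + c * e1) * (t / n%:R)
      + e1 * \sum_l int (fun s => `|a l s|) x y.
    rewrite -E1 [X in _ + X]mulr_sumr -E2.
    rewrite (_ : t / n%:R = y - x); last by rewrite xy; ring.
    rewrite -Rint_cst// -RintegralD//.
    apply: le_Rintegral => //.
      exact: (@integrable_EFinD _ _ R mu `[x, y]%classic _ _ (measurable_itv _) icst i2).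
    move=> s /=; rewrite in_itv/= => /andP[xs sy].
    have sin : 0 <= s <= t by rewrite (le_trans x0 xs) (le_trans sy yt).
    have osc o : `|f o s - f o x| < e1 /\ `|f o y - f o s| < e1.
      split; apply: hdel => //; rewrite ger0_norm; lra.
    have : \sum_l D l y * a l s <= \sum_l D l s * a l s + \sum_l e1 * `|a l s|.
      rewrite -big_split/=; apply: ler_sum => l _.
      rewrite -lerBlDl -mulrBl (le_trans (ler_norm _))// normrM ler_wpM2r//.
      by have [_ /ltW] := osc (Some l).
    move=> /le_trans; apply; rewrite lerD2r (le_trans (diss _ sin))//.
    have [/= _ +] := osc None; rewrite -/r ltr_norml => /andP[_ rs].
    by nra.
  rewrite /energy_defect ge_max; apply/andP; split.
    apply: mulr_ge0; first by rewrite mulr_ge0// ltW.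
    apply: addr_ge0; first exact: mulr_ge0.
    by apply: sumr_ge0 => l _; apply: Rintegral_ge0.
  have rE : r = \sum_l D l x ^+ 2 + 2 * (\sum_l D l x * (eta l y - eta l x))
    + \sum_l (eta l y - eta l x) ^+ 2 + 2 * \sum_l D l y * I l - \sum_l I l ^+ 2.
    rewrite /r !mulr_sumr -!big_split -sumrN -big_split/=; apply: eq_bigr => l _.
    by rewrite incr; ring.
  have : 0 <= \sum_l I l ^+ 2 by apply: sumr_ge0 => l _; exact: sqr_ge0.
  rewrite -/r mulrDl mul1r [X in X + _ - _ - _ - _]rE.
  by move: key; clear; lra.
apply: le_trans; first by apply: ler_sum => k _; exact: step.
rewrite -mulr_sumr big_split/= sumr_const card_ord exchange_big/=.
under [X in _ + X]eq_bigr do rewrite sum_Rint_grid ?integrable_abs//.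
rewrite -/A.
have -> : c * (t / n%:R) *+ n = c * t.
  by rewrite -mulr_natr; field; rewrite pnatr_eq0; lia.
have -> : 2 * e1 * (c * t + A) = e1 * (2 * A + 2 * c * t) by ring.
have E : e1 * (2 * A + 2 * c * t + 1) = e by rewrite /e1; field; rewrite gt_eqF.
by rewrite -[leRHS]E ler_wpM2l ?lerDl// ltW.
Qed.

End paths.

(** * A Gronwall inequality for the norm of an absolutely continuous path *)

Section gronwall.
Variable R : realType.
Notation mu := (@lebesgue_measure R).
Notation int f a b := (\int[mu]_(x in `[a, b]) f x).

Lemma expRM_continuous (b : R) : continuous (fun s : R => expR (b * s)).
Proof.
by move=> s; apply: continuous_comp; [exact: mulrl_continuous|exact: continuous_expR].
Qed.

Lemma integrable_expM (b t : R) (H : R -> R) : 0 <= b ->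
  mu.-integrable `[0, t] (EFin \o H) ->
  mu.-integrable `[0, t] (EFin \o (fun s => expR (b * s) * H s)).
Proof.
move=> b0 iH.
have := @integrableMr _ _ R mu `[0, t]%classic (measurable_itv _)
  (fun s => expR (b * s)) (EFin \o H).
apply => //.
  apply: (measurableT_comp (f := expR) (g := *%R b)); first exact: measurable_expR.
  exact: mulrl_measurable.
exists (expR (b * t)); split; first exact: num_real.
move=> N hN s /=; rewrite in_itv/= => /andP[s0 st].
rewrite ger0_norm ?expR_ge0// (le_trans _ (ltW hN))// ler_expR.
by rewrite ler_wpM2l.
Qed.

Lemma sum_affine (N : nat) (a e c x : R) (J Q : nat -> R) :
  \sum_(k < N) (a + e * (c + J k + Q k) / x) =
    N%:R * a + e * (N%:R * c + \sum_(k < N) J k + \sum_(k < N) Q k) / x.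
Proof.
elim: N => [|N IH]; first by rewrite !big_ord0; ring.
by rewrite !big_ord_recr/= IH -natr1; ring.
Qed.

(* Implicit Euler step on a grid. Since [S] may vanish, the inequality
   [S' ^ (n + 1) <= S' ^ n * (...)] is divided by [S' ^ n] only when [S' > del];
   the recursion is therefore run on [max S del]. *)
Lemma gronwall_norm (I : finType) (Y y phi : I -> R -> R) (S H : R -> R)
    (n : nat) (t b : R) : 0 <= t -> 0 <= b ->
  (forall i, {within `[0, t], continuous (phi i)}) ->
  {within `[0, t], continuous S} ->
  (forall i, mu.-integrable `[0, t] (EFin \o y i)) ->
  mu.-integrable `[0, t] (EFin \o H) ->
  (forall s, 0 <= s <= t -> 0 <= S s) ->
  (forall s, 0 <= s <= t -> 0 <= H s) ->
  (forall i s, 0 <= s <= t -> Y i s = Y i 0 + int (y i) 0 s) ->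
  (forall a c, 0 <= a <= t -> 0 <= c <= t ->
    \sum_i phi i c * Y i a <= S c ^+ n * S a) ->
  (forall c, 0 <= c <= t -> \sum_i phi i c * Y i c = S c ^+ n.+1) ->
  (forall s, 0 <= s <= t ->
    \sum_i phi i s * y i s <= - b * S s ^+ n.+1 + S s ^+ n * H s) ->
  expR (b * t) * S t <= S 0 + int (fun s => expR (b * s) * H s) 0 t.
Proof.
move=> t0 b0 cphi cS iy iH S0 H0 eqY hphi hphiS diss.
apply/ler_addgt0Pr => e e0.
set K := expR (b * t).
have K0 : 0 < K by exact: expR_gt0.
pose J0 := int H 0 t.
have J00 : 0 <= J0 by apply: Rintegral_ge0 => s /=; rewrite in_itv/=; exact: H0.
pose A := \sum_i int (fun s => `|y i s|) 0 t.
have A0 : 0 <= A by apply: sumr_ge0 => i _; apply: Rintegral_ge0.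
(* Half of e pays for the truncation level: del at time 0 and K b t del over the whole grid. *)
pose del := e / (2 * (1 + K * (b * t))).
have kbt : 0 <= K * (b * t) by rewrite mulr_ge0 ?mulr_ge0// ltW.
have del0 : 0 < del by rewrite divr_gt0// mulr_gt0// ltr_wpDr.
have deln0 : 0 < del ^+ n by exact: exprn_gt0.
pose mm := b * t + J0 + A.
have mm0 : 0 <= mm by rewrite !addr_ge0// mulr_ge0.
(* The other half pays for the oscillations within a step. It is fixed after del, because division
   by the power n of S costs up to del^-n. *)
pose eps := e / (2 * (1 + K * (b * t) + K * (mm / del ^+ n) + J0)).
have den0 : 0 < 1 + K * (b * t) + K * (mm / del ^+ n) + J0.
  by rewrite ltr_wpDr// ltr_wpDr ?ltr_wpDr// mulr_ge0 ?(ltW K0)// divr_ge0// ltW.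
have eps0 : 0 < eps by rewrite divr_gt0// mulr_gt0.
(* The multipliers, S, its powers n and n + 1 and the exponential are put into one finite family, so
   that one mesh size controls all their oscillations. *)
pose f (o : option (option (option (option I)))) : R -> R :=
  match o with
  | Some (Some (Some (Some i))) => phi i
  | Some (Some (Some None)) => S
  | Some (Some None) => fun s => S s ^+ n
  | Some None => fun s => S s ^+ n.+1
  | None => fun s => expR (b * s)
  end.
have cf o : {within `[0, t], continuous (f o)}.
  case: o => [[[[i|]|]|]|].
  - exact: cphi.
  - exact: cS.
  - exact: within_continuousX.
  - exact: within_continuousX.
  - exact/continuous_subspaceT/expRM_continuous.
have [rho rho0 hrho] := uniform_continuity_itv eps0 cf.
pose N := (Num.truncn (t / rho)).+1.
pose h := t / N%:R.
have hn : h < rho.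
  by rewrite ltr_pdivrMr ?ltr0n// mulrC -ltr_pdivrMr// truncnS_gt.
have h0 : 0 <= h by rewrite divr_ge0.
pose g := grid t N.
pose m k := Num.max (S (g k)) del.
pose E k := expR (b * g k).
pose J k := int H (g k) (g k.+1).
pose Q k := \sum_i int (fun s => `|y i s|) (g k) (g k.+1).
pose G := fun s => expR (b * s) * H s.
have iG : mu.-integrable `[0, t] (EFin \o G) by exact: integrable_expM.
have step k : (k < N)%N ->
  E k.+1 * m k.+1 - E k * m k <= int G (g k) (g k.+1) + eps * J k +
     K * (b * h * eps + b * h * del + eps * (b * h + J k + Q k) / del ^+ n).
  move=> kN; rewrite /E /m /J /Q; set x := g k; set z := g k.+1.
  have x0 : 0 <= x by exact: grid_ge0.
  have zt : z <= t by exact: grid_le.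
  have xz : z = x + h by exact: gridS.
  have xlez : x <= z by rewrite xz lerDl.
  have xin : 0 <= x <= t by apply/andP; split => //; exact: le_trans zt.
  have zin : 0 <= z <= t by apply/andP; split => //; exact: le_trans xlez.
  set Jk := int H x z; set Qk := \sum_i _.
  have sin s : x <= s <= z -> 0 <= s <= t.
    by move=> /andP[xs sz]; rewrite (le_trans x0 xs) (le_trans sz zt).
  have osc o s : x <= s <= z -> `|f o s - f o z| < eps.
    move=> xsz; apply: hrho => //; first exact: sin.
    move/andP: xsz => [xs sz]; rewrite distrC ger0_norm; move: xz hn xs sz; clear; lra.
  have xx : x <= x <= z by rewrite lexx.
  have iyl i : mu.-integrable `[x, z] (EFin \o y i) by exact: integrable_subitv (iy i) _ _.
  have iHk : mu.-integrable `[x, z] (EFin \o H) by exact: integrable_subitv iH _ _.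
  have iGk : mu.-integrable `[x, z] (EFin \o G) by exact: integrable_subitv iG _ _.
  have iabs i : mu.-integrable `[x, z] (EFin \o (fun s => `|y i s|)) by exact: integrable_abs.
  have mxz : measurable `[x, z]%classic := measurable_itv _.
  have Jk0 : 0 <= Jk.
    by apply: Rintegral_ge0 => s /=; rewrite in_itv/= => /sin; exact: H0.
  have Qk0 : 0 <= Qk by apply: sumr_ge0 => i _; apply: Rintegral_ge0.
  have [i1 E1] := @Rintegral_lincomb _ _ R mu `[x, z]%classic _ (index_enum I)
    (fun i => phi i z) y mxz iyl.
  have [i2 E2] := @Rintegral_lincomb _ _ R mu `[x, z]%classic _ (index_enum I)
    (fun=> eps) (fun i s => `|y i s|) mxz iabs.
  have icst (r : R) : mu.-integrable `[x, z] (EFin \o (fun=> r)).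
    by apply: continuous_compact_integrable; [exact: segment_compact|exact: cst_continuous].
  have iHz (r : R) : mu.-integrable `[x, z] (EFin \o (fun s => r * H s)).
    exact: (@integrable_EFinZl _ _ R mu `[x, z]%classic).
  pose c1 := - b * S z ^+ n.+1 + b * eps.
  have key : \sum_i phi i z * int (y i) x z <=
     c1 * h + (S z ^+ n + eps) * Jk + eps * Qk.
    rewrite -E1 [X in _ + X]mulr_sumr -E2 (_ : h = z - x); last by rewrite xz; ring.
    rewrite -Rint_cst// /Jk -RintegralZl// -RintegralD// -RintegralD//; last first.
      exact: (@integrable_EFinD _ _ R mu `[x, z]%classic).
    apply: le_Rintegral => //.
      apply: (@integrable_EFinD _ _ R mu `[x, z]%classic) => //.
      exact: (@integrable_EFinD _ _ R mu `[x, z]%classic).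
    move=> s /=; rewrite in_itv/= => xsz.
    have : \sum_i phi i z * y i s <= \sum_i phi i s * y i s + \sum_i eps * `|y i s|.
      rewrite -big_split/=; apply: ler_sum => i _.
      rewrite -lerBlDl -mulrBl (le_trans (ler_norm _))// normrM ler_wpM2r// distrC.
      exact: ltW (osc (Some (Some (Some (Some i)))) _ xsz).
    move=> /le_trans; apply; rewrite lerD2r (le_trans (diss _ (sin _ xsz)))//.
    have := osc (Some None) _ xsz; have := osc (Some (Some None)) _ xsz.
    rewrite /= !ltr_norml => /andP[_ B1] /andP[B2 _].
    have := H0 _ (sin _ xsz); rewrite /c1 => Hs.
    have : S s ^+ n * H s <= (S z ^+ n + eps) * H s by rewrite ler_wpM2r//; move: B1; clear; lra.
    have : b * (S z ^+ n.+1 - eps) <= b * S s ^+ n.+1.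
      by rewrite ler_wpM2l//; move: B2; clear; lra.
    by clear; lra.
  have Yz i : Y i z = Y i x + int (y i) x z.
    rewrite (eqY i z)// (eqY i x)// (@Rint_chasles _ (y i) t x z)//.
    by ring.
  (* The multiplier is frozen at the right end z: paired with Y z it gives the power n + 1 of S z,
     and paired with Y x it is bounded by duality, so no derivative of S is needed. *)
  have main : S z ^+ n.+1 <= S z ^+ n * S x + (c1 * h + (S z ^+ n + eps) * Jk + eps * Qk).
    rewrite -(hphiS z zin); under eq_bigr do rewrite Yz mulrDr.
    by rewrite big_split/= lerD//; exact: hphi.
  have Sz0 : 0 <= S z by exact: S0.
  set m' := Num.max (S z) del; set m0 := Num.max (S x) del.
  have mstep : m' * (1 + b * h) <= m0 + b * h * del + Jk
      + eps * (b * h + Jk + Qk) / del ^+ n.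
    have err0 : 0 <= eps * (b * h + Jk + Qk).
      by rewrite mulr_ge0 ?(ltW eps0)// !addr_ge0// mulr_ge0.
    have err1 : 0 <= eps * (b * h + Jk + Qk) / del ^+ n.
      by rewrite divr_ge0// ltW.
    have m0d : del <= m0 by rewrite le_max lexx orbT.
    have m0x : S x <= m0 by rewrite le_max lexx.
    rewrite /m'; case: (leP (S z) del) => [_|dS]; first by move: m0d err1 Jk0; clear; lra.
    have Sn0 : 0 < S z ^+ n by rewrite exprn_gt0// (lt_trans del0).
    have : S z * (1 + b * h) <= S x + Jk + eps * (b * h + Jk + Qk) / S z ^+ n.
      rewrite -(ler_pM2l Sn0) [leRHS]mulrDr.
      rewrite [X in _ <= _ + X]mulrC divfK ?gt_eqF//.
      by move: main; rewrite /c1 exprS; clear; lra.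
    have : eps * (b * h + Jk + Qk) / S z ^+ n <= eps * (b * h + Jk + Qk) / del ^+ n.
      rewrite ler_wpM2l// lef_pV2 ?posrE//.
      by apply: lerXn2r; rewrite ?nnegrE ?(ltW del0)// ltW.
    have := mulr_ge0 (mulr_ge0 b0 h0) (ltW del0).
    by move: m0x; clear; lra.
  have EK : expR (b * z) <= K by rewrite ler_expR ler_wpM2l.
  have Eexp : expR (b * z) - expR (b * x) <= b * h * expR (b * z).
    rewrite (_ : b * x = b * z - b * h); last by rewrite xz; ring.
    rewrite expRD; have := expR_ge1Dx (- (b * h)).
    have := expR_gt0 (b * z); set u := expR _; set v := expR _ => u0 v1.
    have : u * (1 - b * h) <= u * v by rewrite ler_wpM2l// ltW.
    by clear; lra.
  have m00 : 0 <= m0 by rewrite le_max (ltW del0) orbT.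
  have mdiff : m0 - m' <= eps.
    have := osc (Some (Some (Some None))) _ xx; rewrite /= ltr_norml => /andP[_].
    rewrite /m0 /m'; move: eps0.
    by case: (leP (S x) del); case: (leP (S z) del); clear; lra.
  have EJ : expR (b * z) * Jk <= int G x z + eps * Jk.
    rewrite /Jk -!RintegralZl// -RintegralD//.
    apply: le_Rintegral => //.
      exact: (@integrable_EFinD _ _ R mu `[x, z]%classic).
    move=> s /=; rewrite in_itv/= => xsz.
    have := osc None _ xsz; rewrite /= ltr_norml => /andP[B3 _].
    by rewrite /G -mulrDl ler_wpM2r ?H0 ?sin//; move: B3; clear; lra.
  have Ez0 := expR_gt0 (b * z).
  set W := b * h * eps + b * h * del + eps * (b * h + Jk + Qk) / del ^+ n.
  have W0 : 0 <= W.
    apply: addr_ge0; first apply: addr_ge0.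
    - exact: mulr_ge0 (mulr_ge0 b0 h0) (ltW eps0).
    - exact: mulr_ge0 (mulr_ge0 b0 h0) (ltW del0).
    rewrite divr_ge0 ?(ltW deln0)// mulr_ge0 ?(ltW eps0)//.
    exact: addr_ge0 (addr_ge0 (mulr_ge0 b0 h0) Jk0) Qk0.
  have T1 : expR (b * z) * m' - expR (b * x) * m0 <= expR (b * z) * (W + Jk).
    have : expR (b * z) * m' <= expR (b * z) * (m0 - b * h * m' + b * h * del + Jk
      + eps * (b * h + Jk + Qk) / del ^+ n) by rewrite ler_wpM2l ?(ltW Ez0)//; move: mstep; clear; lra.
    have : (expR (b * z) - expR (b * x)) * m0 <= b * h * expR (b * z) * m0 by rewrite ler_wpM2r.
    have : expR (b * z) * (b * h) * (m0 - m') <= expR (b * z) * (b * h) * eps.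
      by rewrite ler_wpM2l// !mulr_ge0// ltW.
    rewrite /W; clear; lra.
  have : expR (b * z) * W <= K * W by rewrite ler_wpM2r.
  move: T1 EJ; clear; set z1 := expR _; set z2 := expR _; lra.
pose cc k := int G (g k) (g k.+1) + eps * J k +
  K * (b * h * eps + b * h * del + eps * (b * h + J k + Q k) / del ^+ n).
have sumstep j : (j <= N)%N -> E j * m j <= m 0%N + \sum_(k < j) cc k.
  elim: j => [_|j IH jN]; first by rewrite big_ord0 addr0 /E /g grid0 mulr0 expR0 mul1r.
  rewrite big_ord_recr/= addrA; apply: le_trans (lerD (IH (ltnW jN)) (step j jN)).
  by rewrite addrC subrK.
have := sumstep N (leqnn _).
have hN : N%:R * h = t by rewrite /h; field; rewrite pnatr_eq0.
have sJ : \sum_(k < N) J k = J0 by exact: sum_Rint_grid.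
have sQ : \sum_(k < N) Q k = A.
  by rewrite /Q exchange_big; apply: eq_bigr => i _; rewrite sum_Rint_grid// integrable_abs.
have sG : \sum_(k < N) int G (g k) (g k.+1) = int G 0 t by exact: sum_Rint_grid.
have -> : \sum_(k < N) cc k = int G 0 t + eps * J0
    + K * (b * t * eps + b * t * del + eps * mm / del ^+ n).
  rewrite -sG -sJ /mm -sJ -sQ -hN /cc.
  rewrite [in LHS]big_split/= [in LHS]big_split/= -[in LHS]mulr_sumr -[in LHS]mulr_sumr.
  congr (_ + _ + _ * _).
  by rewrite sum_affine; congr (_ + _ * _ / _); ring.
have -> : E N = K by rewrite /E /g gridn.
have -> : m 0%N = Num.max (S 0) del by rewrite /m /g grid0.
have : S t <= m N by rewrite /m /g gridn// le_max lexx.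
have := S0 0; rewrite lexx t0 => /(_ isT) S00.
have : Num.max (S 0) del <= S 0 + del.
  by rewrite ge_max lerDl lerDr S00 (ltW del0).
have : eps * (1 + K * (b * t) + K * (mm / del ^+ n) + J0) = e / 2.
  by move: den0; rewrite /eps; set D := _ + J0 => D0; field; rewrite gt_eqF.
have : del * (1 + K * (b * t)) = e / 2.
  have : 0 < 1 + K * (b * t) by rewrite ltr_wpDr.
  by rewrite /del; set D := 1 + _ => D0; field; rewrite gt_eqF.
rewrite -[eps * mm / _]mulrA.
move: eps0 K0; clear; set u := mm / _; set v := int _ _ _.
move=> eps0 K0 E1 E2 E3 E4 E5.
have : K * S t <= K * m N by rewrite ler_wpM2l// ltW.
lra.
Qed.
End gronwall.

(** * Measurability and independence *)

Section matrix_measurability.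
Variable R : realType.

Lemma continuous_measurable_mx (m n : nat) (f : 'M[R]_(m, n) -> R) :
  continuous f -> measurable_fun setT f.
Proof.
move=> /continuousP cf; apply: (measurability _ (RGenOpens.measurableE R)).
move=> _ [_ [a [b ->] <-]]; rewrite setTI; apply: sub_sigma_algebra.
exact/cf/interval_open.
Qed.

Lemma measurable_mxE (m n : nat) (i : 'I_m) (j : 'I_n) :
  measurable_fun setT (fun A : 'M[R]_(m, n) => A i j).
Proof. by apply: continuous_measurable_mx; exact: coord_continuous. Qed.

(* Every open set is a countable union of boxes with rational centers and radii. *)
Lemma measurable_fun_mx (d : measure_display) (T : measurableType d) (m n : nat)
    (X : T -> 'M[R]_(m, n)) :
  (forall i j, measurable_fun setT (fun w => X w i j)) -> measurable_fun setT X.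
Proof.
move=> mX; apply: (@measurability _ _ _ _ _ _ (@open 'M[R]_(m, n))) => //.
move=> _ [U oU <-]; rewrite setTI.
pose box (q : 'M[rat]_(m, n) * nat) : set 'M[R]_(m, n) :=
  [set A | forall i j, `|A i j - ratr (q.1 i j)| < q.2.+1%:R^-1].
have mbox q : measurable (X @^-1` box q).
  rewrite (_ : _ @^-1` _ = \bigcap_(i in [set: 'I_m]) \bigcap_(j in [set: 'I_n])
     [set w | `|X w i j - ratr (q.1 i j)| < q.2.+1%:R^-1]); last first.
    by apply/seteqP; split=> w /= h; [move=> i _ j _; exact: h|move=> i j; exact: h].
  apply: fin_bigcap_measurable => // i _; apply: fin_bigcap_measurable => // j _.
  have := mX i j measurableT _ (measurable_itv
    `](ratr (q.1 i j) - q.2.+1%:R^-1), (ratr (q.1 i j) + q.2.+1%:R^-1)[).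
  congr (measurable _); rewrite setTI; apply/seteqP.
  by split=> w /=; rewrite in_itv/= ltr_distl.
have -> : X @^-1` U = \bigcup_(q in [set q | box q `<=` U]) X @^-1` box q.
  apply/seteqP; split=> [w /= Uw|w /= [q /= qU] /qU//].
  have := open_nbhs_nbhs (conj oU Uw); rewrite -nbhs_ballE => -[/= e e0 he].
  pose k := Num.truncn (2 / e).
  have ke : 2 * k.+1%:R^-1 < e.
    by rewrite ltr_pdivrMr ?ltr0n// -ltr_pdivrMl// mulrC truncnS_gt.
  have k0 : 0 < k.+1%:R^-1 :> R by rewrite invr_gt0.
  have hq i j : exists q : rat, `|X w i j - ratr q| < k.+1%:R^-1.
    move: (k.+1%:R^-1) k0 => u u0.
    have : X w i j - u < X w i j + u by lra.
    move=> /rat_in_itvoo[q]; rewrite in_itv/= => /andP[? ?]; exists q.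
    by rewrite ltr_norml; apply/andP; split; lra.
  have [q hq'] := choice (fun ij => hq ij.1 ij.2).
  exists (\matrix_(i, j) q (i, j), k); last by move=> i j; rewrite mxE; exact: (hq' (i, j)).
  move=> A /= hA; apply: he; split => // i j.
  have := hA i j; have := hq' (i, j); rewrite mxE /= => h1 h2.
  rewrite /ball/= (_ : X w i j - A i j = (X w i j - ratr (q (i, j))) - (A i j - ratr (q (i, j)))); last by ring.
  rewrite (le_lt_trans (ler_normB _ _))//; apply: lt_trans ke.
  by move: h1 h2; set u := _^-1; lra.
rewrite bigcup_mkcond; apply: countable_bigcupT_measurable => // q.
by case: ifPn => // _; exact: measurable0.
Qed.

End matrix_measurability.

Section independence.
Context {dT : measure_display} {T : measurableType dT} {R : realType}.
Variable P : probability T R.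
Local Open Scope ereal_scope.

Lemma sub_g_sigma_measurable (G : set (set T)) :
  G `<=` measurable -> <<s G >> `<=` measurable.
Proof. exact: smallest_sub (@sigma_algebra_measurable _ T). Qed.

Lemma independent2_sym (F G : set (set T)) :
  independent2 P F G -> independent2 P G F.
Proof. by move=> FG A B GA FB; rewrite setIC FG// muleC. Qed.

(** For fixed B, the finite measures A -> P (A [&] B) and A -> P B P A agree on the pi-system F,
    hence on the sigma-algebra it generates. *)
Lemma independent2_gl (F G : set (set T)) :
  F `<=` measurable -> G `<=` measurable -> setI_closed F -> F setT ->
  independent2 P F G -> independent2 P <<s F >> G.
Proof.
move=> mF mG FI FT FG A B FA GB.
have mB := mG _ GB.
pose r : {nonneg R} := NngNum (fine_ge0 (measure_ge0 P B)).
have : mrestr P mB A = mscale r P A; last first.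
  by rewrite /mrestr /mscale/= fineK ?fin_num_measure// muleC.
apply: (@g_sigma_algebra_measure_unique _ R T F mF (fun=> setT)) => //.
- by apply/seteqP; split=> // x _; exists 0%N.
- by move=> C FC; rewrite /= /mrestr /mscale/= fineK ?fin_num_measure// FG// muleC.
- move=> _; rewrite /= /mrestr setTI.
  by rewrite (le_lt_trans (probability_le1 P mB))// ltry.
Qed.

Lemma independent2_g (F G : set (set T)) :
  F `<=` measurable -> G `<=` measurable -> setI_closed F -> setI_closed G ->
  F setT -> G setT ->
  independent2 P F G -> independent2 P <<s F >> <<s G >>.
Proof.
move=> mF mG FI GI FT GT FG.
apply: independent2_gl => //; first exact: sub_g_sigma_measurable.
apply: independent2_sym; apply: independent2_gl => //.
exact: independent2_sym.
Qed.

(** P need not be complete, so a member of [augment] may fail to be measurable; the intersection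
    keeps a sigma-algebra of measurable sets. *)
Definition maugment (F : set (set T)) : set (set T) :=
  measurable `&` augment P F.

Lemma probability_sym_diff (A C B : set T) : measurable A -> measurable C ->
  measurable B -> P.-negligible ((A `\` C) `|` (C `\` A)) ->
  P (A `&` B) = P (C `&` B).
Proof.
move=> mA mC mB.
have mN : measurable ((A `\` C) `|` (C `\` A)).
  by apply: measurableU; exact: measurableD.
move=> /(negligibleP _ mN) N0.
have le (X Y : set T) : measurable X -> measurable Y ->
    (X `\` Y `<=` (A `\` C) `|` (C `\` A))%classic -> P (X `&` B) <= P (Y `&` B).
  move=> mX mY XY; apply: (@le_trans _ _ (P ((Y `&` B) `|` ((A `\` C) `|` (C `\` A))))).
    apply: le_measure; rewrite ?inE//; first exact: measurableI.
      by apply: measurableU => //; exact: measurableI.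
    move=> x [Xx Bx]; have [Yx|nYx] := pselect (Y x); first by left.
    by right; apply: XY.
  apply: (le_trans (measureU2 _ _ _)) => //; first exact: measurableI.
  by rewrite N0 adde0.
apply/eqP; rewrite eq_le; apply/andP; split; apply: le => //.
Qed.

Lemma independent2_maugment (F G : set (set T)) : F `<=` measurable ->
  G `<=` measurable -> independent2 P F G ->
  independent2 P (maugment F) (maugment G).
Proof.
move=> mF mG FG A B [mA [C FC AC]] [mB [D GD BD]].
rewrite (probability_sym_diff mA (mF _ FC) mB AC) setIC.
rewrite (probability_sym_diff mB (mG _ GD) (mF _ FC) BD) setIC FG//.
have := probability_sym_diff mA (mF _ FC) measurableT AC.
have := probability_sym_diff mB (mG _ GD) measurableT BD.
by rewrite !setIT => -> ->.
Qed.

Lemma sub_maugment (F : set (set T)) : F `<=` measurable -> F `<=` maugment F.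
Proof.
move=> mF A FA; split; first exact: mF.
by exists A => //; rewrite setDv setU0; exact: negligible_set0.
Qed.

Lemma sigma_algebra_maugment (F : set (set T)) :
  sigma_algebra setT F -> sigma_algebra setT (maugment F).
Proof.
move=> [F0 FC FU]; split.
- split; first exact: measurable0.
  by exists set0 => //; rewrite setDv setU0; exact: negligible_set0.
- move=> A [mA [C FC' AC]]; split; first by rewrite setTD; exact: measurableC.
  exists (setT `\` C); first exact: FC.
  apply: negligibleS AC; rewrite !setTD => x [[/= nA nnC]|[/= nC nnA]].
    by right; split => //; exact: contrapT.
  by left; split => //; exact: contrapT.
- move=> A hA; split; first by apply: bigcupT_measurable => k; case: (hA k).
  have [C hC] := choice (fun k => let: conj _ (ex_intro2 C h1 h2) := hA k in
     ex_intro (fun C => F C /\ P.-negligible ((A k `\` C) `|` (C `\` A k))) C (conj h1 h2)).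
  exists (\bigcup_k C k); first by apply: FU => k; case: (hC k).
  have := negligible_bigcup (fun k => (hC k).2); apply: negligibleS.
  move=> x [[[k _ Ak] nC]|[[k _ Ck] nA]]; exists k => //.
    by left; split => // Ck; apply: nC; exists k.
  by right; split => // Ak; apply: nA; exists k.
Qed.

End independence.

(** * Integration against a variable independent of a sigma-algebra *)

Section fubini_independent.
Context {dT : measure_display} {T : measurableType dT} {R : realType}.
Variable P : probability T R.
Context {dE : measure_display} {E : measurableType dE}.
Variables (mu : probability E R) (X : T -> E) (G : set (set T)).
Hypotheses (lawX : has_law P X mu) (mG : G `<=` measurable).
Hypothesis indep : independent2 P (preimage_set_system setT X measurable) <<s G >>.
Local Open Scope ereal_scope.

(** The second factor is the sample space itself with the coarser sigma-algebra generated by G, so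
    that a G-measurable quantity need not be written as a function of finitely many variables. *)
Let TG : measurableType _ := g_sigma_algebraType G.
Let idG : T -> TG := id.

Let midG : measurable_fun setT idG.
Proof. by move=> _ A mA; rewrite setTI; exact: sub_g_sigma_measurable mA. Qed.

HB.instance Definition _ := isMeasurableFun.Build _ _ _ _ idG midG.

Let PG : probability TG R := distribution P idG.

Let pair : T -> E * TG := fun w => (X w, w).

Let mpair : measurable_fun setT pair.
Proof. by apply/measurable_fun_pairP; split => //; exact: lawX.1. Qed.

HB.instance Definition _ := isMeasurableFun.Build _ _ _ _ pair mpair.

Let joint (A : set (E * TG)) : measurable A ->
  (mu \x PG) A = distribution P pair A.
Proof.
move=> mA; apply: product_measure_unique mA => /= B C mB mC.
rewrite /distribution /pushforward/=.
rewrite (_ : pair @^-1` _ = X @^-1` B `&` C)// indep ?lawX.2//.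
by exists B => //; rewrite setTI.
Qed.

(** Independence says that the law of w -> (X w, w) is the product mu \x PG. Tonelli then integrates
    X out with the G-measurable argument frozen; this plays the role of a conditional expectation
    given G. *)
Lemma ge0_integral_independent (f : E * TG -> \bar R) :
  measurable_fun setT f -> (forall z, 0 <= f z) ->
  \int[P]_w f (X w, w) = \int[P]_w \int[mu]_x f (x, w).
Proof.
move=> mf f0.
transitivity (\int[distribution P pair]_z f z).
  by rewrite ge0_integral_distribution.
transitivity (\int[mu \x PG]_z f z).
  by apply: eq_measure_integral => A mA _; first [exact: joint | exact/esym/joint].
rewrite fubini_tonelli2// /fubini_G ge0_integral_distribution//.
  exact: measurable_fun_fubini_tonelli_G.
by move=> y; exact: integral_ge0.
Qed.

Lemma measurable_integral_independent (f : E * TG -> \bar R) :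
  measurable_fun setT f -> (forall z, 0 <= f z) ->
  measurable_fun setT (fun w : T => \int[mu]_x f (x, w)).
Proof.
move=> mf f0; have := measurable_fun_fubini_tonelli_G (m1 := mu) f mf f0.
by move=> /measurableT_comp/(_ midG).
Qed.

End fubini_independent.

(** * Moments of sums of independent variables *)

Section lin2.
Context d (T : measurableType d) (R : realType) (mu : {measure set T -> \bar R}).

Lemma Rintegral_lin2 (D : set T) (a b : R) (f g : T -> R) : measurable D ->
  mu.-integrable D (EFin \o f) -> mu.-integrable D (EFin \o g) ->
  mu.-integrable D (EFin \o (fun x => a * f x + b * g x)) /\
  \int[mu]_(x in D) (a * f x + b * g x) =
    a * \int[mu]_(x in D) f x + b * \int[mu]_(x in D) g x.
Proof.
move=> mD fi gi.
have afi := integrable_EFinZl a mD fi; have bgi := integrable_EFinZl b mD gi.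
by split; [exact: integrable_EFinD|rewrite RintegralD// !RintegralZl].
Qed.

Lemma EFin_Rintegral (D : set T) (f : T -> R) : measurable D ->
  mu.-integrable D (EFin \o f) ->
  (\int[mu]_(x in D) (f x)%:E = (\int[mu]_(x in D) f x)%R%:E)%E.
Proof. by move=> mD fi; rewrite /Rintegral fineK//; exact: integrable_fin_num. Qed.

Lemma integrable_even_expr (D : set T) (g : T -> R) (r : nat) : measurable D ->
  measurable_fun D g -> (\int[mu]_(x in D) (g x ^+ (2 * r))%:E < +oo)%E ->
  mu.-integrable D (EFin \o (fun x => g x ^+ (2 * r))).
Proof.
move=> mD mg h; apply/integrableP; split.
  by apply/measurable_EFinP; exact: measurable_funX.
apply: le_lt_trans h; rewrite le_eqVlt; apply/orP; left; apply/eqP.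
by apply: eq_integral => x _ /=; rewrite ger0_norm// even_expr_ge0.
Qed.

End lin2.

(** A Marcinkiewicz-Zygmund bound by a double induction, on q and on J. Adding an independent
    centered term to S kills the linear part of the expansion, and what remains involves E S^(2q),
    known to be of order |J|^q; summing over the terms gains one power of |J|. *)
Lemma sum_independent_moment_normalized (R : realType) (q : nat) :
  exists2 C : R, 0 <= C &
  forall (dT : measure_display) (T : measurableType dT) (P : probability T R)
    (dE : measure_display) (E : measurableType dE) (mu : probability E R)
    (X : nat -> T -> E) (g : E -> R),
  (forall j, has_law P (X j) mu) ->
  (forall (J : seq nat) n, n \notin J ->
    independent2 P (preimage_set_system setT (X n) measurable)
      (sigma_of [set` J] X)) ->
  measurable_fun setT g -> mu.-integrable setT (EFin \o g) ->
  \int[mu]_x g x = 0 ->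
  (forall r, (r <= q)%N -> (\int[mu]_x (g x ^+ (2 * r))%:E <= 2%:E)%E) ->
  forall J : seq nat, uniq J ->
    (\int[P]_w ((\sum_(j <- J) g (X j w)) ^+ (2 * q))%:E <=
       (C * (size J)%:R ^+ q)%:E)%E.
Proof.
elim: q => [|q [C C0 IH]].
  exists 1 => // dT T P dE E mu X g _ _ _ _ _ _ J _.
  under eq_integral do rewrite muln0 expr0.
  by rewrite integral_cst//= probability_setT expr0 !mule1 mulr1.
have [C1 C10 hC1] := @even_exprD_le R q.
(* Passing from n to n + 1 terms adds at most C1 (2 C n^q + 2), which is at most A (n + 1)^q, and (n
   + 1)^q <= (n + 1)^(q+1) - n^(q+1). *)
pose A := C1 * (2 * C + 2).
have A0 : 0 <= A by rewrite mulr_ge0// addr_ge0// mulr_ge0.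
exists A => // dT T P dE E mu X g lawX indX mg ig g0 gle.
elim=> [|n J IHJ].
  move=> _; under eq_integral do rewrite big_nil expr0n/=.
  by rewrite integral0 lee_fin mulr_ge0// exprn_ge0.
rewrite cons_uniq => /andP[nJ uJ].
pose S w := \sum_(j <- J) g (X j w).
have mX j : measurable_fun setT (X j) := (lawX j).1.
have mS : measurable_fun setT S.
  by apply: measurable_sum => j; exact: measurableT_comp.
pose G := preimages [set` J] X.
have mG : G `<=` measurable.
  by move=> _ [j _ [B mB <-]]; exact: mX.
pose TG : measurableType _ := g_sigma_algebraType G.
have mSG : measurable_fun setT (S : TG -> R).
  (* Measurability of a sum is asked of every term, also for indices outside J, where X j need not
     be G-measurable; these terms are set to 0. *)
  rewrite (_ : S = fun w => \sum_(j <- J) if j \in J then g (X j w) else 0); last first.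
    by apply/funext => w; rewrite /S big_seq big_mkcond.
  apply: measurable_sum => j; have [jJ|_] := boolP (j \in J); last exact: measurable_cst.
  apply: (measurableT_comp mg) => _ B mB; rewrite setTI.
  by apply: sub_sigma_algebra; exists j => //; exists B => //; rewrite setTI.
have int2 : mu.-integrable setT (EFin \o (fun x => g x ^+ (2 * 1))).
  by apply: integrable_even_expr => //; rewrite (le_lt_trans (gle 1%N _))// ltry.
have int2q : mu.-integrable setT (EFin \o (fun x => g x ^+ (2 * q.+1))).
  by apply: integrable_even_expr => //; rewrite (le_lt_trans (gle q.+1 _))// ltry.
have R2 : \int[mu]_x g x ^+ (2 * 1) <= 2.
  by rewrite -lee_fin -EFin_Rintegral// gle.
have R2q : \int[mu]_x g x ^+ (2 * q.+1) <= 2.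
  by rewrite -lee_fin -EFin_Rintegral// gle.
have i1 : mu.-integrable setT (EFin \o (fun=> 1)).
  exact: finite_measure_integrable_cst.
pose f (z : E * TG) : \bar R := ((S z.2 + g z.1) ^+ (2 * q.+1))%:E.
have mf : measurable_fun setT f.
  apply/measurable_EFinP/measurable_funX; apply: measurable_funD.
    exact: (measurableT_comp mSG).
  exact: (measurableT_comp mg).
have f0 z : (0 <= f z)%E by rewrite lee_fin even_expr_ge0.
rewrite (_ : (\int[P]_w _ = \int[P]_w f (X n w, w))%E); last first.
  by apply: eq_integral => w _; rewrite /f/= big_cons addrC.
rewrite (ge0_integral_independent (lawX n) mG)//; last exact: indX.
have inner s : (\int[mu]_x ((s + g x) ^+ (2 * q.+1))%:E <=
    (s ^+ (2 * q.+1) + C1 * (2 * s ^+ (2 * q) + 2))%:E)%E.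
  have [j1 E1] := Rintegral_lin2 (s ^+ (2 * q.+1))
    ((2 * q.+1)%:R * s ^+ (2 * q).+1) measurableT i1 ig.
  have [j2 E2] := Rintegral_lin2 (s ^+ (2 * q)) 1 measurableT int2 int2q.
  have [j3 E3] := Rintegral_lin2 1 C1 measurableT j1 j2.
  apply: (@le_trans _ _ (\int[mu]_x (1 * (s ^+ (2 * q.+1) * 1 +
      (2 * q.+1)%:R * s ^+ (2 * q).+1 * g x)
     + C1 * (s ^+ (2 * q) * g x ^+ (2 * 1) + 1 * g x ^+ (2 * q.+1)))%:E)%E).
    have le x : (s + g x) ^+ (2 * q.+1) <= 1 * (s ^+ (2 * q.+1) * 1 +
      (2 * q.+1)%:R * s ^+ (2 * q).+1 * g x)
     + C1 * (s ^+ (2 * q) * g x ^+ (2 * 1) + 1 * g x ^+ (2 * q.+1)).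
      by rewrite !mul1r mulr1 muln1; exact: hC1.
    apply: ge0_le_integral => //.
    - by move=> x _; rewrite lee_fin even_expr_ge0.
    - apply/measurable_EFinP/measurable_funX; exact: measurable_funD.
    - exact: measurable_int j3.
    - by move=> x _; rewrite lee_fin.
  rewrite EFin_Rintegral// lee_fin E3 E1 E2 g0 mulr0 addr0 !mul1r.
  rewrite Rintegral_cst//= probability_setT/= !mulr1 lerD2l ler_wpM2l//.
  by rewrite lerD// mulrC ler_wpM2r// even_expr_ge0.
apply: (@le_trans _ _ (\int[P]_w (S w ^+ (2 * q.+1) + C1 * (2 * S w ^+ (2 * q) + 2))%:E)%E).
  apply: ge0_le_integral => //.
  - by move=> w _; apply: integral_ge0 => x _; exact: f0.
  - exact: (measurable_integral_independent mu mG mf f0).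
  - apply/measurable_EFinP; apply: measurable_funD; first exact: measurable_funX.
    apply: measurable_funM => //; apply: measurable_funD => //.
    by apply: measurable_funM => //; exact: measurable_funX.
  - by move=> w _; exact: (inner (S w)).
under eq_integral do rewrite EFinD.
rewrite ge0_integralD//; last 4 first.
- by move=> w _; rewrite lee_fin even_expr_ge0.
- exact/measurable_EFinP/measurable_funX.
- by move=> w _; rewrite lee_fin !(addr_ge0, mulr_ge0)// even_expr_ge0.
- apply/measurable_EFinP; apply: measurable_funM => //; apply: measurable_funD => //.
  by apply: measurable_funM => //; exact: measurable_funX.
have -> : (\int[P]_w (C1 * (2 * S w ^+ (2 * q) + 2))%:E = C1%:E *
   (2%:E * \int[P]_w (S w ^+ (2 * q))%:E + 2%:E))%E.
  under eq_integral do rewrite EFinM.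
  rewrite ge0_integralZl_EFin//; last 2 first.
  - by move=> w _; rewrite lee_fin !(addr_ge0, mulr_ge0)// even_expr_ge0.
  - apply/measurable_EFinP; apply: measurable_funD => //.
    by apply: measurable_funM => //; exact: measurable_funX.
  congr (_ * _)%E; under eq_integral do rewrite EFinD EFinM.
  rewrite ge0_integralD//; last 2 first.
  - by move=> w _; rewrite -EFinM lee_fin !(addr_ge0, mulr_ge0)// even_expr_ge0.
  - by apply/measurable_EFinP; apply: measurable_funM => //; exact: measurable_funX.
  rewrite integral_cst//= probability_setT mule1; congr (_ + _)%E.
  rewrite ge0_integralZl_EFin//.
  - by move=> w _; rewrite lee_fin even_expr_ge0.
  - exact/measurable_EFinP/measurable_funX.
have gle' r : (r <= q)%N -> (\int[mu]_x (g x ^+ (2 * r))%:E <= 2%:E)%E.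
  by move=> rq; apply: gle; exact: leqW.
have IHq := IH _ _ P _ _ mu X g lawX indX mg ig g0 gle' J uJ.
apply: (@le_trans _ _ ((A * (size J)%:R ^+ q.+1)%:E
   + (C1 * (2 * (C * (size J)%:R ^+ q) + 2))%:E)%E).
  apply: leeD; first exact: IHJ.
  have -> : (C1 * (2 * (C * (size J)%:R ^+ q) + 2))%:E =
      (C1%:E * (2%:E * (C * (size J)%:R ^+ q)%:E + 2%:E))%E by [].
  by rewrite lee_wpmul2l// leeD2r// lee_wpmul2l.
rewrite -EFinD lee_fin /A /= -[(size J).+1%:R]natr1.
have s0 : 0 <= (size J)%:R :> R by [].
set n' := (size J)%:R.
have n1 : 1 <= (n' + 1) ^+ q by rewrite exprn_ege1// lerDr.
have nn : n' ^+ q <= (n' + 1) ^+ q by apply: lerXn2r; rewrite ?nnegrE ?addr_ge0 ?lerDl.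
rewrite !exprS; move: C10 C0 s0 n1 nn; clear.
rewrite -/n'; move: n' ((n' + 1) ^+ q) (n' ^+ q) => n' v u C10 C0 n0 v1 uv.
have vu : 0 <= v - u by rewrite subr_ge0.
have v1' : 0 <= v - 1 by rewrite subr_ge0.
have D0 : 0 <= 2 * C + 2 by lra.
have := mulr_ge0 C10 (mulr_ge0 C0 vu); have := mulr_ge0 C10 v1'.
have := mulr_ge0 (mulr_ge0 C10 D0) (mulr_ge0 n0 vu).
lra.
Qed.

(** Reduction to the normalized case: g is divided by k with k^(2p) = 1 + E g^(2p). Then E g'^(2p)
    <= 1, and y^r <= 1 + y^p bounds all lower even moments by 2. *)
Lemma sum_independent_moment (R : realType) (p : nat) : (0 < p)%N ->
  exists2 C : R, 0 < C &
  forall (dT : measure_display) (T : measurableType dT) (P : probability T R)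
    (dE : measure_display) (E : measurableType dE) (mu : probability E R)
    (X : nat -> T -> E) (g : E -> R),
  (forall j, has_law P (X j) mu) ->
  (forall (J : seq nat) n, n \notin J ->
    independent2 P (preimage_set_system setT (X n) measurable)
      (sigma_of [set` J] X)) ->
  measurable_fun setT g -> mu.-integrable setT (EFin \o g) ->
  \int[mu]_x g x = 0 ->
  forall J : seq nat, uniq J ->
    (\int[P]_w ((\sum_(j <- J) g (X j w)) ^+ (2 * p))%:E <=
       (C * (size J)%:R ^+ p)%:E * (1 + \int[mu]_x (g x ^+ (2 * p))%:E))%E.
Proof.
move=> p0; have [C C0 hC] := sum_independent_moment_normalized R p.
exists (C + 1) => [|dT T P dE E mu X g lawX indX mg ig g0 J uJ]; first by rewrite ltr_wpDl.
(* If E g^(2p) is infinite, the right-hand side is infinite only for a positive coefficient; hence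
   the separate empty list and the constant C + 1. *)
have [->|J0] := eqVneq J [::].
  under eq_integral do rewrite big_nil expr0n muln_eq0/= (gtn_eqF p0).
  by rewrite integral0 /= expr0n (gtn_eqF p0) mulr0 mul0e.
have Kge0 : (0 <= \int[mu]_x (g x ^+ (2 * p))%:E)%E.
  by apply: integral_ge0 => x _; rewrite lee_fin even_expr_ge0.
have nJ0 : 0 < (C + 1) * (size J)%:R ^+ p.
  by rewrite mulr_gt0 ?ltr_wpDl// exprn_gt0// ltr0n lt0n size_eq0.
have [Koo|] := eqVneq (\int[mu]_x (g x ^+ (2 * p))%:E)%E +oo%E.
  by rewrite Koo addey// gt0_muley ?lte_fin// leey.
rewrite -ltey => Kfin.
have ik := integrable_even_expr measurableT mg Kfin.
move: Kfin Kge0; rewrite EFin_Rintegral//; set K := (\int[mu]_x _)%R => _.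
rewrite lee_fin => K0.
pose k := (1 + K) `^ (2 * p)%:R^-1.
have K1 : 0 < 1 + K by rewrite ltr_pwDl.
have k0 : 0 < k by exact: powR_gt0.
have kE : k ^+ (2 * p) = 1 + K.
  rewrite -powR_mulrn ?ltW// -powRrM mulVf ?powRr1 ?ltW//.
  by rewrite pnatr_eq0 muln_eq0 (gtn_eqF p0).
pose g' x := k^-1 * g x.
have mg' : measurable_fun setT g' by exact: measurable_funM.
have ig' : mu.-integrable setT (EFin \o g') by exact: integrable_EFinZl.
have g'0 : \int[mu]_x g' x = 0 by rewrite RintegralZl// g0 mulr0.
have i1 : mu.-integrable setT (EFin \o (fun=> 1)).
  exact: finite_measure_integrable_cst.
have g'le r : (r <= p)%N -> (\int[mu]_x (g' x ^+ (2 * r))%:E <= 2%:E)%E.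
  move=> rp.
  have [j1 E1] := Rintegral_lin2 1 (k^-1 ^+ (2 * p)) measurableT i1 ik.
  apply: (@le_trans _ _ (\int[mu]_x (1 * 1 + k^-1 ^+ (2 * p) * g x ^+ (2 * p))%:E)%E).
    apply: ge0_le_integral => //.
    - by move=> x _; rewrite lee_fin even_expr_ge0.
    - exact/measurable_EFinP/measurable_funX.
    - exact: measurable_int j1.
    - move=> x _; rewrite lee_fin mulr1 -exprMn -/(g' x) !exprM.
      have y0 := sqr_ge0 (g' x); set y := g' x ^+ 2 in y0 *.
      have [y1|y1] := leP y 1.
        by rewrite (le_trans (exprn_ile1 _ _ _))// lerDl exprn_ge0.
      by rewrite (@le_trans _ _ (y ^+ p))// ?lerDr// ler_weXn2l// ltW.
  rewrite EFin_Rintegral// lee_fin E1 Rintegral_cst//= probability_setT/= !mul1r.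
  rewrite -/K exprVn kE [leRHS](_ : 2 = 1 + 1)// lerD2l mulrC ler_pdivrMr// mul1r.
  by rewrite lerDr.
have := hC _ _ P _ _ mu X g' lawX indX mg' ig' g'0 g'le J uJ.
under eq_integral do rewrite /g' -mulr_sumr exprMn EFinM.
rewrite ge0_integralZl_EFin//; last 3 first.
- by move=> x _; rewrite lee_fin even_expr_ge0.
- apply/measurable_EFinP/measurable_funX; apply: measurable_sum => j.
  exact: measurableT_comp (lawX j).1.
- by rewrite even_expr_ge0.
rewrite exprVn kE => h.
rewrite (@le_trans _ _ ((1 + K)%:E * (C * (size J)%:R ^+ p)%:E)%E)//.
  by rewrite -lee_pdivrMl.
rewrite -EFinD -!EFinM lee_fin mulrC ler_wpM2r ?(ltW K1)//.
by rewrite ler_wpM2r ?exprn_ge0// lerDl.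
Qed.

(** * Moments of dissipative processes with small independent increments *)

Definition adapted {dT : measure_display} {T : measurableType dT} {R : realType}
    (G : set (set T)) (Y : T -> R) : Prop :=
  measurable_fun setT (Y : g_sigma_algebraType G -> R).

(** Conditional moments given G, tested against G-measurable weights Y: zero conditional mean, and
    conditional moments of order 2 and 2 r at most proportional to the step h. Integrability of Y xi
    is part of the second property because Y is only assumed integrable. *)
Record small_noise {dT : measure_display} {T : measurableType dT} {R : realType}
    (P : probability T R) (G : set (set T)) (h M : R) (r : nat) (xi : T -> R) :
    Prop := {
  noise_measurable : measurable_fun setT xi ;
  noise_power : forall Y : T -> R, adapted G Y -> (forall w, 0 <= Y w) ->
    (\int[P]_w (Y w * (xi w ^+ 2 + xi w ^+ (2 * r)))%:E <=
      (M * h)%:E * \int[P]_w (Y w)%:E)%E ;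
  noise_centered : forall Y : T -> R, adapted G Y ->
    P.-integrable setT (EFin \o Y) ->
    P.-integrable setT (EFin \o (fun w => Y w * xi w)) /\
    \int[P]_w (Y w * xi w) = 0 }.

(** Beyond x = K / e the power q + 1 dominates; below it the left-hand side is at most its value
    there. *)
Lemma expr_absorb (R : realFieldType) (q : nat) (K e : R) : 0 <= K -> 0 < e ->
  exists2 C : R, 0 <= C & forall x : R, 0 <= x -> K * x ^+ q <= e * x ^+ q.+1 + C.
Proof.
move=> K0 e0; have r0 : 0 <= K / e by rewrite divr_ge0// ltW.
exists (K * (K / e) ^+ q) => [|x x0]; first by rewrite mulr_ge0// exprn_ge0.
have [xr|rx] := leP x (K / e).
  rewrite (@le_trans _ _ (K * (K / e) ^+ q))//; last first.
    by rewrite lerDr mulr_ge0 ?(ltW e0)// exprn_ge0.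
  by rewrite ler_wpM2l//; apply: lerXn2r; rewrite ?nnegrE.
rewrite (@le_trans _ _ (e * x ^+ q.+1))//; last first.
  by rewrite lerDl mulr_ge0// exprn_ge0.
rewrite exprS mulrA ler_wpM2r ?exprn_ge0//.
by move: rx; rewrite ltr_pdivrMr// mulrC => /ltW.
Qed.

(** Taking means in [lyapunov_step], the martingale term vanishes and the error K2 h E th^q is
    absorbed as h ((k / 2) E th^(q+1) + C). The new moment times 1 + k h is thus at most (1 + k h /
    2) B + C h, which is at most (1 + k h) B once B >= 2 C / k: the level B is preserved. The weight
    carries the indicator of A, which belongs to the past, whereas A' also depends on the noise of
    the step. *)
Lemma lyapunov_expectation_step (R : realType) (d q : nat) (k M : R) :
  0 < k -> 0 <= M -> exists2 B0 : R, 0 <= B0 &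
  forall (dT : measure_display) (T : measurableType dT) (P : probability T R)
    (G : set (set T)) (h : R) (D xi : 'I_d -> T -> R) (th th' : T -> R)
    (A A' : set T),
  G `<=` measurable -> 0 <= h -> k * h <= 1 ->
  (forall l, adapted G (D l)) -> adapted G th -> <<s G >> A ->
  (forall l, small_noise P G h M q.+1 (xi l)) ->
  measurable_fun setT th' -> measurable A' -> A' `<=` A ->
  (forall w, A w -> 1 <= th w) ->
  (forall w, A w -> \sum_l D l w ^+ 2 <= th w) ->
  (forall w, A' w -> 0 <= th' w) ->
  (forall w, A' w -> (1 + k * h) * th' w <=
    th w + 2 * (k * h) + 2 * (\sum_l D l w * xi l w) + \sum_l xi l w ^+ 2) ->
  forall B : R, B0 <= B ->
  (\int[P]_w (\1_A w * th w ^+ q.+1)%:E <= B%:E)%E ->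
  (\int[P]_w (\1_A' w * th' w ^+ q.+1)%:E <= B%:E)%E.
Proof.
move=> k0 M0; have [K K0 hK] := @lyapunov_step R d q k (ltW k0).
pose K2 := K * (1 + d%:R * M).
have K20 : 0 <= K2 by rewrite mulr_ge0// addr_ge0// mulr_ge0.
have [C C0 hC] := expr_absorb q K20 (divr_gt0 k0 (ltr0Sn R 1)).
exists (2 * C / k) => [|dT T P G h D xi th th' A A' mG h0 kh1 aD ath GA noise
  mth' mA' A'A th1 Dth th'0 hth' B B0B uB]; first by rewrite divr_ge0 ?mulr_ge0// ltW.
have kh0 : 0 <= k * h by rewrite mulr_ge0// ltW.
have adaptedW (Y : T -> R) : adapted G Y -> measurable_fun setT Y.
  move=> aY _ S mS; have := aY measurableT S mS.
  by rewrite !setTI; apply: sub_g_sigma_measurable.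
have mA : measurable A by exact: sub_g_sigma_measurable GA.
have a1A : adapted G (\1_A : T -> R).
  exact: (@measurable_indic _ (g_sigma_algebraType G) R setT A GA).
pose u w : R := \1_A w * th w ^+ q.+1.
pose Y w : R := \1_A w * th w ^+ q.
have au : adapted G u by apply: measurable_funM => //; exact: measurable_funX.
have aY : adapted G Y by apply: measurable_funM => //; exact: measurable_funX.
have u0 w : 0 <= u w.
  rewrite /u indicE; have [/set_mem Aw|_] := boolP (w \in A); last by rewrite mul0r.
  by rewrite mul1r exprn_ge0// (le_trans ler01)// th1.
have Y0 w : 0 <= Y w.
  rewrite /Y indicE; have [/set_mem Aw|_] := boolP (w \in A); last by rewrite mul0r.
  by rewrite mul1r exprn_ge0// (le_trans ler01)// th1.
(* The bound on the mean of u is the only source of integrability: on A, th >= 1 and |D|^2 <= th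
   make the weights Y and Y D l smaller than u. *)
have dom (f : T -> R) : measurable_fun setT f -> (forall w, `|f w| <= u w) ->
    P.-integrable setT (EFin \o f).
  move=> mf fu; apply: (@le_integrable _ _ _ P setT _ _ (EFin \o u)) => //.
  - exact/measurable_EFinP.
  - by move=> w _ /=; rewrite lee_fin (ger0_norm (u0 w)).
  apply/integrableP; split; first by apply/measurable_EFinP; exact: adaptedW.
  apply: le_lt_trans (ltry B); apply: le_trans uB.
  by under eq_integral do rewrite /= ger0_norm//.
have iu : P.-integrable setT (EFin \o u).
  by apply: dom => [|w]; [exact: adaptedW|rewrite ger0_norm].
have iY : P.-integrable setT (EFin \o Y).
  apply: dom => [|w]; first exact: adaptedW.
  rewrite ger0_norm// /Y /u indicE.
  have [/set_mem Aw|_] := boolP (w \in A); last by rewrite !mul0r.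
  by rewrite !mul1r exprS ler_peMl ?th1// exprn_ge0// (le_trans ler01)// th1.
have iYD l : P.-integrable setT (EFin \o (fun w => Y w * D l w)).
  apply: dom => [|w]; first by apply: measurable_funM; exact: adaptedW.
  rewrite /Y /u indicE.
  have [/set_mem Aw|_] := boolP (w \in A); last by rewrite !mul0r normr0.
  have th10 := th1 _ Aw; have th00 : 0 <= th w by exact: le_trans th10.
  rewrite !mul1r exprSr normrM ger0_norm ?exprn_ge0//.
  rewrite ler_wpM2l ?exprn_ge0// -(@ler_pXn2r _ 2) ?nnegrE//.
  rewrite real_normK ?num_real//.
  apply: (@le_trans _ _ (th w)); last by rewrite expr2 ler_peMl.
  apply: le_trans (Dth _ Aw); rewrite (bigD1 l)//= lerDl.
  by apply: sumr_ge0 => j _; exact: sqr_ge0.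
have aYD l : adapted G (fun w => Y w * D l w).
  by apply: measurable_funM; [exact: aY|exact: aD].
have i1 : P.-integrable setT (EFin \o (fun=> 1)) by exact: finite_measure_integrable_cst.
pose RY := (\int[P]_w Y w)%R; pose Ru := (\int[P]_w u w)%R.
have iV l : P.-integrable setT
    (EFin \o (fun w => Y w * (xi l w ^+ 2 + xi l w ^+ (2 * q.+1)))).
  apply/integrableP; split.
    apply/measurable_EFinP; apply: measurable_funM; first exact: adaptedW.
    by apply: measurable_funD; apply: measurable_funX; exact: noise_measurable (noise l).
  have := noise_power (noise l) aY Y0.
  rewrite [X in (_ <= _ * X)%E](EFin_Rintegral measurableT iY) => /le_lt_trans.
  move=> /(_ +oo%E (ltry _)); apply: le_lt_trans.
  rewrite le_eqVlt; apply/orP; left; apply/eqP; apply: eq_integral => w _ /=.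
  by rewrite ger0_norm// mulr_ge0// addr_ge0 ?sqr_ge0// even_expr_ge0.
have [j1 E1] := Rintegral_lincomb (index_enum 'I_d) (fun=> 1) measurableT
  (fun l => (noise_centered (noise l) (aYD l) (iYD l)).1).
have [j2 E2] := Rintegral_lincomb (index_enum 'I_d) (fun=> 1) measurableT iV.
have [j3 E3] := Rintegral_lin2 h 1 measurableT iY j2.
have [j4 E4] := Rintegral_lin2 1 (2 * q.+1)%:R measurableT iu j1.
have [j5 E5] := Rintegral_lin2 1 K measurableT j4 j3.
set f5 := (X in EFin \o X) in j5.
have f5ge w : 0 <= (1 + k * h) * (\1_A' w * th' w ^+ q.+1) <= f5 w.
  have f5E : A w -> f5 w = th w ^+ q.+1
     + (2 * q.+1)%:R * (th w ^+ q * (\sum_l D l w * xi l w))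
     + K * (th w ^+ q * (h + \sum_l (xi l w ^+ 2 + xi l w ^+ (2 * q.+1)))).
    move=> Aw; rewrite /f5 /u /Y indicE mem_set// !mul1r.
    rewrite (eq_bigr (fun l => th w ^+ q * (D l w * xi l w))); last first.
      by move=> l _; rewrite !mul1r mulrA.
    rewrite [X in K * (_ + X)](eq_bigr (fun l =>
      th w ^+ q * (xi l w ^+ 2 + xi l w ^+ (2 * q.+1)))); last first.
      by move=> l _; rewrite !mul1r.
    by rewrite -!mulr_sumr; ring.
  have f5out : ~ A w -> f5 w = 0.
    move=> nAw; rewrite /f5 /u /Y indicE memNset// !mul0r.
    by rewrite !big1 ?mulr0 ?addr0 ?mulr0 ?addr0// => l _; rewrite !mul0r mulr0.
  have CS : A w -> (\sum_l D l w * xi l w) ^+ 2 <= th w * \sum_l xi l w ^+ 2.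
    move=> Aw; apply: le_trans (sqr_sum_mul_le _ _) _.
    by rewrite ler_wpM2r ?Dth//; apply: sumr_ge0 => l _; exact: sqr_ge0.
  have kh1' : 0 <= 1 + k * h by rewrite addr_ge0.
  have [A'w|nA'w] := pselect (A' w).
    have Aw := A'A _ A'w.
    rewrite indicE mem_set// mul1r f5E// mulr_ge0 ?exprn_ge0 ?th'0//=.
    by apply: hK => //; [exact: th1|exact: CS|exact: th'0|exact: hth'].
  rewrite indicE memNset// mul0r mulr0 lexx/=.
  have [Aw|nAw] := pselect (A w); last by rewrite f5out.
  (* On A outside A', nothing is known about th', but the upper bound must still be nonnegative
     there for the indicator of A' to be replaced by that of A. This is the algebraic step with th'
     = 0, whose hypothesis follows from |D + xi|^2 >= 0. *)
  rewrite f5E//; have := hK h (th w) 0 (\sum_l D l w * xi l w) (xi ^~ w) h0 kh1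
    (th1 _ Aw) (CS Aw) (lexx _).
  rewrite mulr0 expr0n mulr0; apply.
  have : 0 <= \sum_l (D l w + xi l w) ^+ 2 by apply: sumr_ge0 => l _; exact: sqr_ge0.
  have -> : \sum_l (D l w + xi l w) ^+ 2 = \sum_l D l w ^+ 2
      + 2 * (\sum_l D l w * xi l w) + \sum_l xi l w ^+ 2.
    by rewrite mulr_sumr -!big_split/=; apply: eq_bigr => l _; ring.
  by have := Dth _ Aw; move: kh0; clear; lra.
have RYle : K2 * RY <= k / 2 * Ru + C.
  have [j6 E6] := Rintegral_lin2 (k / 2) C measurableT iu i1.
  rewrite /RY -RintegralZl//.
  have -> : k / 2 * Ru + C = \int[P]_x (k / 2 * u x + C * 1).
    by rewrite E6 Rintegral_cst//= probability_setT/= !mulr1.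
  apply: le_Rintegral => //; first exact: integrable_EFinZl.
  move=> w _; rewrite /Y /u mulr1 indicE.
  have [/set_mem Aw|_] := boolP (w \in A); last by rewrite !mul0r !mulr0 add0r.
  by rewrite !mul1r hC// (le_trans ler01)// th1.
have RuB : Ru <= B by rewrite -lee_fin -EFin_Rintegral.
have f5B : (\int[P]_w f5 w)%R <= (1 + k * h) * B.
  rewrite E5 E4 E3 E1 E2 big1; last by move=> l _; rewrite (noise_centered (noise l) (aYD l) (iYD l)).2 mulr0.
  rewrite !mul1r mulr0 addr0 -/Ru -/RY.
  have SV : \sum_l 1 * (\int[P]_w (Y w * (xi l w ^+ 2 + xi l w ^+ (2 * q.+1))))%R
      <= d%:R * (M * h * RY).
    rewrite -[X in X%:R]card_ord mulr_natl -sumr_const; apply: ler_sum => l _.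
    have := noise_power (noise l) aY Y0.
    by rewrite mul1r !EFin_Rintegral// -EFinM lee_fin.
  have := ler_wpM2l K0 SV; have := ler_wpM2l h0 RYle.
  have : 2 * C * h <= k * h * B.
    have := B0B; rewrite ler_pdivrMr// => H; have := ler_wpM2l h0 H; lra.
  have := ler_wpM2l kh0 RuB.
  rewrite /K2; move: (\sum_l _) => S; lra.
have kh1' : 0 < 1 + k * h by rewrite ltr_pwDl.
rewrite -(lee_pmul2l _ (_ : (0 < (1 + k * h)%:E)%E))// -ge0_integralZl_EFin//; last 3 first.
- move=> w _; rewrite lee_fin; have /andP[+ _] := f5ge w.
  by rewrite pmulr_rge0.
- apply/measurable_EFinP; apply: measurable_funM; last exact: measurable_funX.
  exact: measurable_indic.
- exact: ltW.
apply: (@le_trans _ _ (\int[P]_w (f5 w)%:E)%E).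
  apply: ge0_le_integral => //.
  - by move=> w _; rewrite -EFinM lee_fin; have /andP[] := f5ge w.
  - apply/measurable_EFinP; apply: measurable_funM => //; apply: measurable_funM.
      exact: measurable_indic.
    exact: measurable_funX.
  - exact: measurable_int j5.
  - by move=> w _; rewrite -EFinM lee_fin; have /andP[] := f5ge w.
by rewrite EFin_Rintegral// -EFinM lee_fin.
Qed.

Section fatou_bound.
Context d (T : measurableType d) (R : realType) (mu : {measure set T -> \bar R}).
Local Open Scope ereal_scope.

(** No convergence is asked: eventual domination at almost every point places f below the lower
    limit of the g n, to which Fatou's lemma applies. *)
Lemma fatou_bound (f : T -> \bar R) (g : (T -> \bar R)^nat) (B : \bar R) :
  measurable_fun setT f -> (forall w, 0 <= f w) ->
  (forall n, measurable_fun setT (g n)) -> (forall n w, 0 <= g n w) ->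
  {ae mu, forall w, exists n0, forall n, (n0 <= n)%N -> f w <= g n w} ->
  (forall n, \int[mu]_w g n w <= B) -> \int[mu]_w f w <= B.
Proof.
move=> mf f0 mg g0 fg gB.
have mlim : measurable_fun setT (fun w => limn_einf (g ^~ w)).
  apply: measurableT_comp => //; apply: measurable_fun_limn_esup => n.
  exact: measurableT_comp.
have lim0 w : 0 <= limn_einf (g ^~ w).
  rewrite limn_einf_lim; apply: lime_ge; first exact: is_cvg_einfs.
  by apply: nearW => n; apply: le_ereal_inf_tmp => _ [m /= nm <-]; exact: g0.
apply: (@le_trans _ _ (\int[mu]_w limn_einf (g ^~ w))).
  apply: ae_ge0_le_integral => //.
  apply: filterS fg => w [n0 hn0] _.
  rewrite limn_einf_lim; apply: lime_ge; first exact: is_cvg_einfs.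
  exists n0 => // n /= n0n; apply: le_ereal_inf_tmp => _ [m /= nm <-].
  by apply: hn0; exact: leq_trans nm.
apply: le_trans; first exact: fatou.
rewrite limn_einf_lim; apply: lime_le; first exact: is_cvg_einfs.
apply: nearW => n; apply: le_trans (gB n).
by apply: ereal_inf_lbound; exists n => /=.
Qed.

End fatou_bound.

(** Subtracting the accumulated defect turns the approximate energy inequality into an exact
    one-step inequality, so the level B is preserved along each grid on the adapted events where
    this defect is at most 1. Almost every w lies in these events for all fine enough grids. *)
Lemma diffusion_moment (R : realType) (d q : nat) (c M : R) :
  0 < c -> 0 <= M -> exists2 B0 : R, 0 <= B0 &
  forall (dT : measure_display) (T : measurableType dT) (P : probability T R)
    (t : R) (G : R -> set (set T)) (D eta : 'I_d -> R -> T -> R),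
  0 <= t ->
  (forall s, 0 <= s <= t -> G s `<=` measurable) ->
  (forall s s', 0 <= s -> s <= s' -> s' <= t -> <<s G s >> `<=` <<s G s' >>) ->
  (forall l s, 0 <= s <= t -> adapted (G s) (D l s)) ->
  (forall l s, 0 <= s <= t -> adapted (G s) (eta l s)) ->
  (forall l s s', 0 <= s -> s <= s' -> s' <= t -> s' - s <= 1 ->
    small_noise P (G s) (s' - s) M q.+1 (fun w => eta l s' w - eta l s w)) ->
  {ae P, forall w, exists n0, forall n, (n0 <= n)%N -> (0 < n)%N ->
    \sum_(k < n) energy_defect c (t / n%:R)
      (fun l => D l (grid t n k) w) (fun l => D l (grid t n k.+1) w)
      (fun l => eta l (grid t n k.+1) w - eta l (grid t n k) w) <= 1} ->
  forall B : R, B0 <= B ->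
  (\int[P]_w ((\sum_l D l 0 w ^+ 2 + 2) ^+ q.+1)%:E <= B%:E)%E ->
  (\int[P]_w ((\sum_l D l t w ^+ 2) ^+ q.+1)%:E <= B%:E)%E.
Proof.
move=> c0 M0.
have [B0 B00 hB0] := @lyapunov_expectation_step R d q (2 * c) M (mulr_gt0 (ltr0Sn R 1) c0) M0.
exists B0 => // dT T P t G D eta t0 mG monoG aD aeta noise aedef B B0B iniB.
(* Grids with at least this many steps satisfy (2 c + 1) h <= 1, hence both 2 c h <= 1 and h <=
   1. *)
pose N0 := (Num.truncn ((2 * c + 1) * t)).+1.
pose N n := (N0 + n)%N.
have Npos n : (0 < N n)%N by rewrite /N addSn.
pose h n := t / (N n)%:R.
have h0 n : 0 <= h n by rewrite divr_ge0.
have hsmall n : (2 * c + 1) * h n <= 1.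
  rewrite /h mulrA ler_pdivrMr ?ltr0n// mul1r.
  rewrite (@le_trans _ _ N0%:R) ?ler_nat ?leq_addr//.
  by rewrite ltW// truncnS_gt.
have ch0 n : 0 <= 2 * c * h n by rewrite !mulr_ge0// ltW.
have kh1 n : 2 * c * h n <= 1 by have := hsmall n; have := h0 n; lra.
have h1 n : h n <= 1 by have := hsmall n; have := ch0 n; lra.
pose g n k := grid t (N n) k.
have g0 n k : 0 <= g n k by exact: grid_ge0.
have gt n k : (k <= N n)%N -> g n k <= t by exact: grid_le.
have gin n k : (k <= N n)%N -> 0 <= g n k <= t by move=> kn; rewrite g0 gt.
pose xi n k l w := eta l (g n k.+1) w - eta l (g n k) w.
pose dk n k w := energy_defect c (h n) (fun l => D l (g n k) w)
  (fun l => D l (g n k.+1) w) (fun l => xi n k l w).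
have dk0 n k w : 0 <= dk n k w by rewrite /dk /energy_defect le_max lexx.
pose Err n j w := \sum_(k < j) dk n k w.
have Err0 n j w : 0 <= Err n j w by apply: sumr_ge0.
pose r n j w := \sum_l D l (g n j) w ^+ 2.
have r0 n j w : 0 <= r n j w by apply: sumr_ge0 => l _; exact: sqr_ge0.
(* With the defect at most 1, the shift by 2 gives th >= 1 and th >= |D|^2. It costs the term 2 (k
   h) of the one-step inequality, where k = 2 c. *)
pose th n j w := r n j w + 2 - Err n j w.
pose A n j := [set w | Err n j w <= 1].
have adapted_mono (s s' : R) (Y : T -> R) : 0 <= s -> s <= s' -> s' <= t ->
    adapted (G s) Y -> adapted (G s') Y.
  move=> s0 ss' s't aY mT S mS; have := aY measurableT S mS.
  by rewrite !setTI; exact: monoG.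
have ar n j : (j <= N n)%N -> adapted (G (g n j)) (r n j).
  move=> jn; apply: measurable_sum => l; apply: measurable_funX.
  by apply: aD; exact: gin.
have aErr n j : (j <= N n)%N -> adapted (G (g n j)) (Err n j).
  move=> jn; apply: measurable_sum => k.
  have kj : (k < j)%N by [].
  have kn : (k.+1 <= N n)%N by exact: leq_trans jn.
  have lift (Y : T -> R) k' : (k' <= j)%N -> adapted (G (g n k')) Y -> adapted (G (g n j)) Y.
    by move=> k'j; apply: adapted_mono => //; [exact: grid_homo|exact: gt].
  have aDk l k' : (k' <= j)%N -> adapted (G (g n j)) (D l (g n k')).
    by move=> k'j; apply: (lift _ _ k'j); apply: aD; apply: gin; exact: leq_trans jn.
  have aek l k' : (k' <= j)%N -> adapted (G (g n j)) (eta l (g n k')).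
    by move=> k'j; apply: (lift _ _ k'j); apply: aeta; apply: gin; exact: leq_trans jn.
  have axi l : adapted (G (g n j)) (xi n k l).
    by apply: measurable_funB; apply: aek => //; exact: ltnW.
  apply: (@measurable_maxr _ _ _ _ (cst 0)) => //.
  apply: measurable_funB; last first.
    by apply: measurable_sum => l; apply: measurable_funX; exact: axi.
  apply: measurable_funB; last first.
    apply: measurable_funM => //; apply: measurable_sum => l.
    by apply: measurable_funM; [apply: aDk; exact: ltnW|exact: axi].
  apply: measurable_funB; last first.
    by apply: measurable_sum => l; apply: measurable_funX; apply: aDk; exact: ltnW.
  apply: measurable_funM => //.
  by apply: measurable_sum => l; apply: measurable_funX; apply: aDk.
have ath n j : (j <= N n)%N -> adapted (G (g n j)) (th n j).
  move=> jn; apply: measurable_funB; last exact: aErr.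
  by apply: measurable_funD => //; exact: ar.
have adaptedW s (Y : T -> R) : 0 <= s <= t -> adapted (G s) Y -> measurable_fun setT Y.
  move=> st aY _ S mS; have := aY measurableT S mS.
  by rewrite !setTI; apply: sub_g_sigma_measurable; exact: mG.
have GA n j : (j <= N n)%N -> <<s G (g n j) >> (A n j).
  move=> jn; have AE : A n j = Err n j @^-1` `]-oo, 1].
    by apply/seteqP; split=> w; rewrite /A /preimage/= in_itv.
  have := aErr n j jn measurableT _ (measurable_itv `]-oo, 1]).
  by rewrite setTI AE.
have main n j : (j <= N n)%N ->
    (\int[P]_w (\1_(A n j) w * th n j w ^+ q.+1)%:E <= B%:E)%E.
  elim: j => [_|j IH jn].
    apply: le_trans iniB; rewrite le_eqVlt; apply/orP; left; apply/eqP.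
    apply: eq_integral => w _; rewrite indicE mem_set; last by rewrite /A/= /Err big_ord0.
    by rewrite mul1r /th /Err big_ord0 subr0 /r /g grid0.
  have jn' := ltnW jn.
  have ErrS w : Err n j.+1 w = Err n j w + dk n j w by rewrite /Err big_ord_recr.
  apply: (hB0 _ _ P (G (g n j)) (h n) (fun l => D l (g n j)) (xi n j) (th n j)
    (th n j.+1) (A n j) (A n j.+1)) => //.
  - by apply: mG; exact: gin.
  - by move=> l; apply: aD; exact: gin.
  - exact: ath.
  - exact: GA.
  - move=> l; have hE : h n = g n j.+1 - g n j by rewrite /g gridS addrC addKr.
    rewrite hE; apply: noise => //; first exact: grid_homo.
      exact: gt.
    by rewrite -hE.
  - by apply: (adaptedW (g n j.+1)); [exact: gin|exact: ath].
  - by apply: (sub_g_sigma_measurable (mG _ (gin n j.+1 jn))); exact: GA.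
  - by move=> w; rewrite /A /= ErrS; have := dk0 n j w; lra.
  - by move=> w; rewrite /A /= /th; have := r0 n j w; lra.
  - by move=> w; rewrite /A /= /th -/(r n j w); lra.
  - by move=> w; rewrite /A /= /th; have := r0 n j.+1 w; lra.
  - move=> w _; rewrite /th ErrS.
    have : (1 + 2 * c * h n) * r n j.+1 w - r n j w
        - 2 * (\sum_l D l (g n j) w * xi n j l w) - \sum_l xi n j l w ^+ 2 <= dk n j w.
      by rewrite /dk /energy_defect le_max lexx orbT.
    have := mulr_ge0 (ch0 n) (Err0 n j w); have := mulr_ge0 (ch0 n) (dk0 n j w).
    clear; lra.
  exact: IH.
pose f n w := (\1_(A n (N n)) w * th n (N n) w ^+ q.+1)%:E.
have gN n : g n (N n) = t by exact: gridn.
apply: (@fatou_bound _ _ _ P _ f) => //.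
- apply/measurable_EFinP/measurable_funX/measurable_sum => l; apply: measurable_funX.
  by apply: (adaptedW t); [rewrite t0 lexx|apply: aD; rewrite t0 lexx].
- by move=> w; rewrite lee_fin exprn_ge0// sumr_ge0// => l _; exact: sqr_ge0.
- move=> n; apply/measurable_EFinP; apply: measurable_funM.
    apply: measurable_indic; apply: (sub_g_sigma_measurable (mG _ (gin n (N n) (leqnn _)))).
    exact: GA.
  apply: measurable_funX; apply: (adaptedW (g n (N n))); first exact: gin.
  exact: ath.
- move=> n w; rewrite lee_fin indicE.
  have [/set_mem Aw|_] := boolP (w \in A n (N n)); last by rewrite mul0r.
  by rewrite mul1r exprn_ge0// /th; move: Aw; rewrite /A/=; have := r0 n (N n) w; lra.
- apply: filterS aedef => w [n0 hn0]; exists n0 => n n0n.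
  have Aw : A n (N n) w.
    by apply: (hn0 (N n)) => //; rewrite /N; exact: leq_trans (leq_addl _ _).
  rewrite lee_fin indicE mem_set// mul1r.
  have rE : \sum_l D l t w ^+ 2 = r n (N n) w by rewrite /r gN.
  have := r0 n (N n) w; move: Aw; rewrite rE /A/= /th => Aw rr.
  by apply: lerXn2r; rewrite ?nnegrE; move: Aw rr; clear; lra.
- by move=> n; exact: main.
Qed.

(** * Gaussian increments and the Brownian filtration *)

Section normal_moments.
Variable R : realType.
Notation mu := (@lebesgue_measure R).
Local Open Scope ereal_scope.

Lemma ge0_integral_normal (m s : R) (f : R -> \bar R) :
  measurable_fun setT f -> (forall x, 0 <= f x) ->
  \int[normal_prob m s]_x f x = \int[mu]_x (f x * (normal_pdf m s x)%:E).
Proof.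
move=> mf f0; have dom := normal_prob_dominates m s.
rewrite -(Radon_Nikodym_SigmaFinite.change_of_variables dom)//.
apply: ae_eq_integral => //.
- apply: emeasurable_funM => //; apply: (measurable_int mu).
  exact: Radon_Nikodym_SigmaFinite.f_integrable.
- apply: emeasurable_funM => //; apply/measurable_EFinP.
  exact: measurable_normal_pdf.
- apply: ae_eqe_mul2l; apply: integral_ae_eq => //.
  + exact: Radon_Nikodym_SigmaFinite.f_integrable.
  + by apply/measurable_EFinP; exact: measurable_normal_pdf.
  + by move=> E _ mE; rewrite -Radon_Nikodym_SigmaFinite.f_integral.
Qed.

Lemma expr_le_expR (r : nat) (y : R) : (0 <= y)%R -> (y ^+ r <= r`!%:R * expR y)%R.
Proof.
move=> y0; case: r => [|r]; first by rewrite expr0 fact0 mul1r -expR0 ler_expR.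
have := expR_ge1Dxn r y0; rewrite -ler_pdivrMl ?ltr0n ?fact_gt0// mulrC.
by apply: le_trans; rewrite lerDr.
Qed.

(** With y = x^2 / (4 s^2), the bound y^r <= r! exp y trades the power for half of the Gaussian
    exponent: what is left is the density of variance 2 s^2, of total mass 1. The ratio of the two
    peaks is sqrt 2 and the scaling of x gives 4^r. *)
Lemma normal_even_moment (r : nat) : exists2 C : R, (0 <= C)%R &
  forall s : R, (0 < s)%R ->
  \int[normal_prob 0 s]_x (x ^+ (2 * r))%:E <= (C * s ^+ (2 * r))%:E.
Proof.
exists (r`!%:R * 4 ^+ r * Num.sqrt 2)%R => [|s s0].
  by rewrite !mulr_ge0// exprn_ge0.
have s2 : (0 < 4 * s ^+ 2)%R by rewrite mulr_gt0// exprn_gt0.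
pose s' : R := (Num.sqrt 2 * s)%R.
have s'0 : (0 < s')%R by rewrite mulr_gt0// sqrtr_gt0.
have s'2 : (s' ^+ 2 = 2 * s ^+ 2)%R by rewrite exprMn sqr_sqrtr.
rewrite ge0_integral_normal//; last 2 first.
- by apply/measurable_EFinP; exact: measurable_funX.
- by move=> x; rewrite lee_fin even_expr_ge0.
apply: (@le_trans _ _ (\int[mu]_x ((r`!%:R * 4 ^+ r * Num.sqrt 2 * s ^+ (2 * r))%:E
    * (normal_pdf 0 s' x)%:E))); last first.
  rewrite ge0_integralZl//=.
  - by rewrite integral_normal_pdf mule1.
  - by apply/measurable_EFinP; exact: measurable_normal_pdf.
  - by move=> x _; rewrite lee_fin normal_pdf_ge0.
  - by rewrite lee_fin !mulr_ge0// exprn_ge0// ltW.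
apply: ge0_le_integral => //.
- by move=> x _; rewrite -EFinM lee_fin mulr_ge0 ?normal_pdf_ge0 ?even_expr_ge0.
- apply: emeasurable_funM; apply/measurable_EFinP; first exact: measurable_funX.
  exact: measurable_normal_pdf.
- apply: emeasurable_funM; apply/measurable_EFinP => //.
  exact: measurable_normal_pdf.
move=> x _; rewrite -!EFinM lee_fin !normal_pdfE ?gt_eqF//.
rewrite /normal_fun !subr0.
pose y := (x ^+ 2 / (4 * s ^+ 2))%R.
have y0 : (0 <= y)%R by rewrite divr_ge0 ?sqr_ge0// ltW.
have -> : (x ^+ (2 * r) = (4 * s ^+ 2) ^+ r * y ^+ r)%R.
  by rewrite -exprMn /y mulrC divfK ?gt_eqF// exprM.
have -> : (- x ^+ 2 / (s ^+ 2 *+ 2) = - y + - y)%R.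
  by rewrite /y; field; rewrite gt_eqF.
have -> : (- x ^+ 2 / (s' ^+ 2 *+ 2) = - y)%R.
  by rewrite s'2 /y; field; rewrite gt_eqF.
have -> : normal_peak s = (Num.sqrt 2 * normal_peak s')%R.
  rewrite /normal_peak s'2 (_ : 2 * s ^+ 2 * pi *+ 2 = 2 * (s ^+ 2 * pi *+ 2))%R; last first.
    by rewrite mulrnAr mulrA.
  by rewrite (sqrtrM _ (ler0n _ 2)) invfM mulrA divff ?mul1r// gt_eqF// sqrtr_gt0.
rewrite expRD exprMn -exprM.
have e1 : (expR y * expR (- y) = 1)%R by rewrite -expRD subrr expR0.
have := expr_le_expR r y0 => h.
have p0 := normal_peak_ge0 s'; have q0 := expR_ge0 (- y).
have r20 : (0 <= Num.sqrt 2 :> R)%R by [].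
rewrite [leLHS](_ : _ = (4 ^+ r * s ^+ (2 * r) * Num.sqrt 2 * normal_peak s' * expR (- y)) * (y ^+ r * expR (- y)))%R; last by ring.
rewrite [leRHS](_ : _ = (4 ^+ r * s ^+ (2 * r) * Num.sqrt 2 * normal_peak s' * expR (- y)) * r`!%:R)%R; last by ring.
rewrite ler_wpM2l//.
  by rewrite !mulr_ge0// ?exprn_ge0// ltW.
apply: (@le_trans _ _ (r`!%:R * expR y * expR (- y))%R); first by rewrite ler_wpM2r.
by rewrite -mulrA e1 mulr1.
Qed.

Lemma normal_probN (s : R) (A : set R) : s != 0%R -> measurable A ->
  normal_prob 0 s (-%R @^-1` A) = normal_prob 0 s A.
Proof.
move=> s0 mA; rewrite /normal_prob.
transitivity (\int[mu]_(x in (-%R : R -> measurableTypeR R) @^-1` A)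
    ((fun y : measurableTypeR R => (normal_pdf 0 s y)%:E) \o -%R) x).
  apply: eq_integral => x _ /=; congr (_%:E).
  by rewrite !normal_pdfE// /normal_fun !subr0 sqrrN.
rewrite -ge0_integral_pushforward//=.
- by apply: eq_measure_integral => B mB _; exact: lebesgue_measureN.
- by apply/measurable_EFinP/measurable_funTS; exact: measurable_normal_pdf.
- by move=> x _; rewrite lee_fin normal_pdf_ge0.
Qed.

End normal_moments.

Section normal_increment.
Context {dT : measure_display} {T : measurableType dT} {R : realType}.
Variables (P : probability T R) (G : set (set T)) (s : R) (X : T -> R).
Hypotheses (s0 : 0 < s) (mG : G `<=` measurable).
Hypothesis lawX : has_law P X (normal_prob 0 s).
Hypothesis indep : independent2 P (preimage_set_system setT X measurable) <<s G >>.
Local Notation TG := (g_sigma_algebraType G).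
Local Notation RL := (measurableTypeR R).

Let lawXL : has_law P (X : T -> RL) (@normal_prob R 0 s : probability RL R).
Proof. exact: lawX. Qed.

Let indepL : independent2 P
  (preimage_set_system setT (X : T -> RL) measurable) <<s G >>.
Proof. exact: indep. Qed.

Let measurable_idL : measurable_fun setT (id : RL -> R).
Proof. by move=> _ A mA; rewrite setTI. Qed.

Lemma adapted_measurable (Y : T -> R) : adapted G Y -> measurable_fun setT Y.
Proof.
move=> aY _ S mS; have := aY measurableT S mS.
by rewrite !setTI; apply: sub_g_sigma_measurable.
Qed.

Lemma integral_normal_opp (g : R -> \bar R) : measurable_fun setT g ->
  (forall x, 0 <= g x)%E ->
  (\int[normal_prob 0 s]_x g (- x)%R = \int[normal_prob 0 s]_x g x)%E.
Proof.
move=> mg g0.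
pose phi : R -> measurableTypeR R := -%R.
have mphi : measurable_fun setT phi by exact: oppr_measurable.
transitivity (\int[normal_prob 0 s]_(x in phi @^-1` setT)
   ((g : measurableTypeR R -> \bar R) \o phi) x)%E.
  by rewrite preimage_setT.
rewrite -ge0_integral_pushforward//.
by apply: eq_measure_integral => B mB _; apply: normal_probN => //; rewrite gt_eqF.
Qed.

Lemma integral_adapted_power (r : nat) (Y : T -> R) : adapted G Y ->
  (forall w, 0 <= Y w) ->
  (\int[P]_w (Y w * X w ^+ (2 * r))%:E =
    \int[normal_prob 0 s]_x (x ^+ (2 * r))%:E * \int[P]_w (Y w)%:E)%E.
Proof.
move=> aY Y0.
pose f (z : RL * TG) : \bar R := (Y z.2 * z.1 ^+ (2 * r))%:E.
have mf : measurable_fun setT f.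
  apply/measurable_EFinP/measurable_funM; first exact: (measurableT_comp aY).
  by apply: measurable_funX; exact: (measurableT_comp measurable_idL measurable_fst).
have f0 z : (0 <= f z)%E by rewrite lee_fin mulr_ge0 ?even_expr_ge0.
transitivity (\int[P]_w f (X w, w))%E; first by [].
rewrite (ge0_integral_independent lawXL mG indepL mf f0).
have m0 : (0 <= \int[normal_prob 0 s]_x (x ^+ (2 * r))%:E)%E.
  by apply: integral_ge0 => x _; rewrite lee_fin even_expr_ge0.
have [C _ /(_ s s0) hC] := normal_even_moment R r.
have mfin : (\int[normal_prob 0 s]_x (x ^+ (2 * r))%:E)%E \is a fin_num.
  by rewrite ge0_fin_numE// (le_lt_trans hC)// ltry.
rewrite -(fineK mfin) -ge0_integralZl_EFin//.
- apply: eq_integral => w _; rewrite /f/=.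
  under eq_integral do rewrite EFinM.
  rewrite ge0_integralZl_EFin//.
  + by rewrite (fineK mfin) muleC.
  + by move=> x _; rewrite lee_fin even_expr_ge0.
  + by apply/measurable_EFinP; exact: measurable_funX.
- by move=> w _; rewrite lee_fin.
- by apply/measurable_EFinP; exact: adapted_measurable.
- exact: fine_ge0.
Qed.

(** Integrability comes from |x| <= 1 + x^2. The mean vanishes by symmetry: with the G-measurable
    weight frozen, replacing X by - X exchanges the positive and the negative part of Y X, so their
    integrals coincide and cancel. *)
Lemma integral_adapted_centered (Y : T -> R) : adapted G Y ->
  P.-integrable setT (EFin \o Y) ->
  P.-integrable setT (EFin \o (fun w => Y w * X w)) /\
  \int[P]_w (Y w * X w) = 0.
Proof.
move=> aY iY; have mY := adapted_measurable aY; have mX := lawX.1.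
have mYX : measurable_fun setT (fun w => Y w * X w) by exact: measurable_funM.
have aYn : adapted G (fun w => `|Y w|) by exact: (measurableT_comp _ aY).
have iYX : P.-integrable setT (EFin \o (fun w => Y w * X w)).
  apply/integrableP; split; first exact/measurable_EFinP.
  apply: (@le_lt_trans _ _ (\int[P]_w (`|Y w|%:E + (`|Y w| * X w ^+ (2 * 1))%:E))%E).
    apply: ge0_le_integral => //.
    - by apply: (measurableT_comp (f := abse)) => //; exact/measurable_EFinP.
    - apply: emeasurable_funD; apply/measurable_EFinP.
        exact: (measurableT_comp _ mY).
      apply: measurable_funM; first exact: (measurableT_comp _ mY).
      exact: measurable_funX.
    - move=> w _; rewrite /= -EFinD lee_fin normrM -[X in X + _]mulr1 -mulrDr.
      by rewrite ler_wpM2l//; have := sqr_ge0 (`|X w| - 1); have := sqr_ge0 `|X w|;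
      rewrite -(norm_exprM2 (X w) 1) muln1; lra.
  rewrite ge0_integralD//.
  - rewrite integral_adapted_power//.
    have [C _ /(_ s s0) hC] := normal_even_moment R 1.
    have fY : (\int[P]_w (`|Y w|)%:E < +oo)%E by have /integrableP[] := iY.
    rewrite lte_add_pinfty// lte_mul_pinfty//.
    + by apply: integral_ge0 => x _; rewrite lee_fin even_expr_ge0.
    + rewrite ge0_fin_numE ?(le_lt_trans hC) ?ltry//.
      by apply: integral_ge0 => x _; rewrite lee_fin even_expr_ge0.
  - by apply/measurable_EFinP; exact: (measurableT_comp _ mY).
  - by move=> w _; rewrite lee_fin mulr_ge0// even_expr_ge0.
  - apply/measurable_EFinP; apply: measurable_funM; last exact: measurable_funX.
    exact: (measurableT_comp _ mY).
split=> //.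
pose f (z : RL * TG) : \bar R := (Num.max (Y z.2 * z.1) 0)%:E.
pose f' (z : RL * TG) : \bar R := (Num.max (Y z.2 * - z.1) 0)%:E.
have mM (g : R -> R) : measurable_fun setT g ->
    measurable_fun setT (fun z : RL * TG => (Num.max (Y z.2 * g z.1) 0)%:E).
  move=> mg; apply/measurable_EFinP; apply: (@measurable_maxr _ _ _ _ _ (cst 0)) => //.
  apply: measurable_funM; first exact: (measurableT_comp aY).
  exact: (measurableT_comp mg (measurableT_comp measurable_idL measurable_fst)).
have mf : measurable_fun setT f by exact: (mM id (@measurable_id _ _ _)).
have mo : measurable_fun [set: R] (-%R : R -> R) by exact: oppr_measurable.
have mf' : measurable_fun setT f' by exact: (mM _ mo).
have f0 z : (0 <= f z)%E by rewrite lee_fin le_max lexx orbT.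
have f'0 z : (0 <= f' z)%E by rewrite lee_fin le_max lexx orbT.
have E : (\int[P]_w f (X w, w) = \int[P]_w f' (X w, w))%E.
  rewrite (ge0_integral_independent lawXL mG indepL mf f0).
  rewrite (ge0_integral_independent lawXL mG indepL mf' f'0).
  apply: eq_integral => w _; rewrite -integral_normal_opp//.
  by apply: (measurableT_comp mf).
rewrite /Rintegral integralE.
rewrite (_ : (\int[P]_w _^\+ w)%E = (\int[P]_w f (X w, w))%E); last first.
  by apply: eq_integral => w _; rewrite /f /= funeposE/= -EFin_max.
rewrite (_ : (\int[P]_w _^\- w)%E = (\int[P]_w f (X w, w))%E); last first.
  by rewrite E; apply: eq_integral => w _; rewrite /f' /= funenegE/= mulrN EFinN -EFin_max.
rewrite subee//.
have /integrable_funepos : P.-integrable setT (EFin \o (fun w => Y w * X w)) by [].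
move=> /(_ measurableT) /integrable_fin_num -/(_ measurableT).
by under eq_integral do rewrite funeposE /= -EFin_max.
Qed.

End normal_increment.

(** The joint law of X1 and X2 is left free: the difference is split by the bound 8^j on (sqrt 2 (a
    - b))^(2j), and each increment is treated alone. Its moment of order 2 j is a multiple of h^j,
    hence of h since h <= 1. *)
Lemma increments_small_noise (R : realType) (r : nat) : (0 < r)%N ->
  exists2 M : R, 0 <= M &
  forall (dT : measure_display) (T : measurableType dT) (P : probability T R)
    (G : set (set T)) (h : R) (X1 X2 : T -> R),
  G `<=` measurable -> 0 < h -> h <= 1 ->
  has_law P X1 (normal_prob 0 (Num.sqrt h)) ->
  has_law P X2 (normal_prob 0 (Num.sqrt h)) ->
  independent2 P (preimage_set_system setT X1 measurable) <<s G >> ->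
  independent2 P (preimage_set_system setT X2 measurable) <<s G >> ->
  small_noise P G h M r (fun w => Num.sqrt 2 * (X1 w - X2 w)).
Proof.
move=> r0.
have [C1 C10 hC1] := normal_even_moment R 1.
have [Cr Cr0 hCr] := normal_even_moment R r.
exists (8 * (2 * C1) + 8 ^+ r * (2 * Cr)) => [|dT T P G h X1 X2 mG h0 h1 L1 L2 I1 I2].
  by rewrite addr_ge0 ?mulr_ge0// ?exprn_ge0// ?mulr_ge0.
have s0 : 0 < Num.sqrt h by rewrite sqrtr_gt0.
have mX1 := L1.1; have mX2 := L2.1.
have bound (a b : R) (j : nat) : (Num.sqrt 2 * (a - b)) ^+ (2 * j) <=
    8 ^+ j * (a ^+ (2 * j) + b ^+ (2 * j)).
  rewrite exprMn exprM sqr_sqrtr// -(norm_exprM2 (a - b)).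
  rewrite (_ : 8 = 2 * 2 ^+ 2 :> R); last by ring.
  rewrite exprMn -exprM -mulrA ler_wpM2l ?exprn_ge0//.
  apply: (@le_trans _ _ ((`|a| + `|b|) ^+ (2 * j))).
    by apply: lerXn2r; rewrite ?nnegrE ?addr_ge0// ler_normB.
  by rewrite (le_trans (exprD_le2 _ _ _))// !norm_exprM2.
split.
- by apply: measurable_funM => //; exact: measurable_funB.
- move=> Y aY Y0; have mY := adapted_measurable mG aY.
  have part (j : nat) (C : R) : 0 <= C -> (0 < j)%N ->
      (forall s, 0 < s -> (\int[normal_prob 0 s]_x (x ^+ (2 * j))%:E <= (C * s ^+ (2 * j))%:E)%E) ->
      (\int[P]_w (Y w * (Num.sqrt 2 * (X1 w - X2 w)) ^+ (2 * j))%:E <=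
        (8 ^+ j * (2 * C) * h)%:E * \int[P]_w (Y w)%:E)%E.
    move=> C0 j0 hC.
    have one (X : T -> R) : has_law P X (normal_prob 0 (Num.sqrt h)) ->
        independent2 P (preimage_set_system setT X measurable) <<s G >> ->
        (\int[P]_w (Y w * X w ^+ (2 * j))%:E <= (C * h)%:E * \int[P]_w (Y w)%:E)%E.
      move=> L I; rewrite (integral_adapted_power s0 mG L I)//.
      apply: lee_wpmul2r; first by apply: integral_ge0 => w _; rewrite lee_fin.
      apply: le_trans (hC _ s0) _; rewrite lee_fin ler_wpM2l// exprM sqr_sqrtr ?(ltW h0)//.
      case: j j0 {hC} => // j _; rewrite exprS ler_piMr ?(ltW h0)//.
      by rewrite exprn_ile1// ltW.
    have mp (X : T -> R) : measurable_fun setT X ->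
        measurable_fun setT (fun w => (Y w * X w ^+ (2 * j))%:E).
      move=> mX; apply/measurable_EFinP; apply: measurable_funM => //.
      exact: measurable_funX.
    have p0 (X : T -> R) w : setT w -> (0 <= (Y w * X w ^+ (2 * j))%:E)%E.
      by move=> _; rewrite lee_fin mulr_ge0// even_expr_ge0.
    apply: (@le_trans _ _ ((8 ^+ j)%:E * (\int[P]_w (Y w * X1 w ^+ (2 * j))%:E
        + \int[P]_w (Y w * X2 w ^+ (2 * j))%:E))%E).
      rewrite -ge0_integralD//; try exact: mp; try exact: p0.
      rewrite -ge0_integralZl_EFin//.
      + apply: ge0_le_integral => //; try exact: p0.
        * apply: mp; apply: measurable_funM => //; exact: measurable_funB.
        * apply: measurable_funeM; apply: emeasurable_funD; exact: mp.
        * move=> w _; rewrite -EFinD -EFinM lee_fin -mulrDr [leRHS]mulrCA ler_wpM2l//.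
      + by move=> w _; rewrite adde_ge0// p0.
      + by apply: emeasurable_funD; exact: mp.
    apply: (@le_trans _ _ ((8 ^+ j)%:E * ((C * h)%:E * \int[P]_w (Y w)%:E
        + (C * h)%:E * \int[P]_w (Y w)%:E))%E).
      by rewrite lee_wpmul2l ?lee_fin ?exprn_ge0// leeD// one.
    rewrite -ge0_muleDl ?lee_fin ?mulr_ge0 ?(ltW h0)// muleA -EFinD -EFinM.
    by rewrite le_eqVlt; apply/orP; left; apply/eqP; congr (_%:E * _)%E; ring.
  have Yx0 (j : nat) w : setT w -> (0 <= (Y w * (Num.sqrt 2 * (X1 w - X2 w)) ^+ (2 * j))%:E)%E.
    by move=> _; rewrite lee_fin mulr_ge0// even_expr_ge0.
  have mYx (j : nat) : measurable_fun setT (fun w => (Y w * (Num.sqrt 2 * (X1 w - X2 w)) ^+ (2 * j))%:E).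
    apply/measurable_EFinP; apply: measurable_funM => //; apply: measurable_funX.
    by apply: measurable_funM => //; exact: measurable_funB.
  under eq_integral do rewrite -[X in _ ^+ X + _]muln1 mulrDr EFinD.
  rewrite ge0_integralD//; try exact: mYx; try exact: Yx0.
  rewrite mulrDl EFinD ge0_muleDl ?lee_fin ?mulr_ge0 ?exprn_ge0 ?(ltW h0) ?mulr_ge0//.
  by apply: leeD; [have := part 1%N C1 C10 isT hC1; rewrite expr1|exact: part].
- move=> Y aY iY.
  have [i1 E1] := integral_adapted_centered s0 mG L1 I1 aY iY.
  have [i2 E2] := integral_adapted_centered s0 mG L2 I2 aY iY.
  have [i3 E3] := Rintegral_lin2 (Num.sqrt 2) (- Num.sqrt 2) measurableT i1 i2.
  rewrite (_ : (fun w => Y w * (Num.sqrt 2 * (X1 w - X2 w))) = (fun w =>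
    Num.sqrt 2 * (Y w * X1 w) + - Num.sqrt 2 * (Y w * X2 w))); last first.
    by apply/funext => w; ring.
  by split=> //; rewrite E3 E1 E2 !mulr0 addr0.
Qed.

Lemma g_sigma_algebra_sub (T : Type) (F G : set (set T)) :
  F `<=` <<s G >> -> <<s F >> `<=` <<s G >>.
Proof. by move=> FG; apply: smallest_sub => //; exact: smallest_sigma_algebra. Qed.

(** * Independence of Brownian increments from the past of the whole system *)

Section brownian_filtration.
Context {dT : measure_display} {T : measurableType dT} {R : realType}.
Variables (P : probability T R) (d : nat) (B : nat -> R -> T -> 'rV[R]_d).
Variable I0 : set (set T).
Hypotheses (hB : forall i, brownian P (B i))
  (hBi : mutually_independent P (fun i => sigma_of [set t | 0 <= t] (B i)))
  (I0T : I0 setT) (I0I : setI_closed I0) (mI0 : I0 `<=` measurable)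
  (hI0 : independent2 P I0 <<s \bigcup_i preimages [set t | 0 <= t] (B i) >>).

Local Notation past s i l :=
  (sigma_of [set r | 0 <= r <= s] (fun r w => B i r w ord0 l)).
Local Notation full i l :=
  (sigma_of [set r | 0 <= r] (fun r w => B i r w ord0 l)).

Lemma brownian_measurable i r : 0 <= r -> measurable_fun setT (B i r).
Proof.
move=> r0; apply: measurable_fun_mx => k l.
have [/(_ l)[h _ _ _] _] := hB i.
by rewrite (_ : k = ord0); [exact: h|exact: ord1].
Qed.

Lemma past_sub_full s i l : past s i l `<=` full i l.
Proof.
apply: g_sigma_algebra_sub => A [r /= /andP[r0 _] h].
by apply: sub_sigma_algebra; exists r.
Qed.

Lemma full_sub i l : full i l `<=` sigma_of [set t | 0 <= t] (B i).
Proof.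
apply: g_sigma_algebra_sub.
move=> _ [r r0 [A mA <-]]; apply: sub_sigma_algebra; exists r => //.
exists ((fun x : 'rV[R]_d => x ord0 l) @^-1` A); last by [].
by rewrite -[X in measurable X]setTI; exact: measurable_mxE.
Qed.

Lemma sub_brownian i : sigma_of [set t | 0 <= t] (B i) `<=`
  <<s \bigcup_i preimages [set t | 0 <= t] (B i) >>.
Proof. by apply: g_sigma_algebra_sub => A hA; apply: sub_sigma_algebra; exists i. Qed.

Lemma sigma_brownian_measurable i : sigma_of [set t | 0 <= t] (B i) `<=` measurable.
Proof.
apply: sub_g_sigma_measurable => _ [r r0 [A mA <-]].
exact: brownian_measurable.
Qed.

Lemma full_measurable i l : full i l `<=` measurable.
Proof. by apply: subset_trans (@full_sub i l) _; exact: sigma_brownian_measurable. Qed.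

Lemma bigcap_seq_g_sigma (I : eqType) (s : seq I) (F : I -> set T) (G : set (set T)) :
  (forall i, i \in s -> <<s G >> (F i)) -> <<s G >> (\bigcap_(i in [set` s]) F i).
Proof.
elim: s => [_|x s IH hF].
  rewrite (_ : \bigcap_(i in _) _ = setT); last by apply/seteqP; split.
  exact: (@measurableT _ (g_sigma_algebraType G)).
rewrite (_ : \bigcap_(i in _) _ = F x `&` \bigcap_(i in [set` s]) F i); last first.
  apply/seteqP; split=> [w h|w [hx h] i /=].
    by split=> [|i /= si]; apply: h; rewrite /= inE ?eqxx ?si ?orbT.
  by rewrite inE => /predU1P[->//|si]; exact: h.
apply: (@measurableI _ (g_sigma_algebraType G)); first by apply: hF; rewrite inE eqxx.
by apply: IH => i si; apply: hF; rewrite inE si orbT.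
Qed.

(** Three layers of independence are combined: the initial data from the noises, the noises from one
    another, and the coordinates of each noise. *)
Lemma brownian_product (A0 : set T) (A : nat -> 'I_d -> set T) (N : nat) :
  I0 A0 -> (forall i l, full i l (A i l)) ->
  P (A0 `&` \bigcap_(i in [set` iota 0 N]) \bigcap_(l in [set` enum 'I_d]) A i l) =
    (P A0 * \prod_(i <- iota 0 N) \prod_(l <- enum 'I_d) P (A i l))%E.
Proof.
move=> A0I hA.
have hi i : sigma_of [set t | 0 <= t] (B i) (\bigcap_(l in [set` enum 'I_d]) A i l).
  by apply: bigcap_seq_g_sigma => l _; exact: full_sub.
rewrite hI0//; last first.
  by apply: bigcap_seq_g_sigma => i _; exact: sub_brownian.
rewrite hBi ?iota_uniq//; congr (_ * _)%E; apply: eq_bigr => i _.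
have [_ hl] := hB i; by apply: hl; rewrite ?enum_uniq.
Qed.

(** A pi-system generating the past up to time s: an initial event and one past event per coordinate
    of finitely many Brownian motions. In this form probabilities factorize; the sets are trivial
    from n on, so the infinite intersection is a finite one. *)
Definition history (s : R) : set (set T) := [set S | exists A0 (A : nat -> 'I_d -> set T) n,
  [/\ I0 A0, (forall i l, past s i l (A i l)),
      (forall i l, (n <= i)%N -> A i l = setT) &
      S = A0 `&` \bigcap_i \bigcap_l A i l]].

Lemma bigcap_eventually_setT (A : nat -> 'I_d -> set T) (n N : nat) : (n <= N)%N ->
  (forall i l, (n <= i)%N -> A i l = setT) ->
  \bigcap_i \bigcap_l A i l =
    \bigcap_(i in [set` iota 0 N]) \bigcap_(l in [set` enum 'I_d]) A i l.
Proof.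
move=> nN hA; apply/seteqP; split=> w h i.
  by move=> _ l _; exact: h.
move=> _ l _; have [iN|Ni] := ltnP i N.
  by apply: h => /=; rewrite ?mem_iota ?mem_enum.
by rewrite hA// (leq_trans nN).
Qed.

Lemma historyT s : history s setT.
Proof.
exists setT, (fun _ _ => setT), 0%N; split=> //.
  by move=> i l; exact: (@measurableT _ (g_sigma_algebraType _)).
by rewrite setTI; apply/seteqP; split=> // w _ i _ l _.
Qed.

Lemma history_setI s : setI_closed (history s).
Proof.
move=> _ _ [A0 [A [n [A0I hA An ->]]]] [A0' [A' [n' [A0'I hA' An' ->]]]].
exists (A0 `&` A0'), (fun i l => A i l `&` A' i l), (maxn n n'); split.
- exact: I0I.
- by move=> i l; apply: (@measurableI _ (g_sigma_algebraType _)); [exact: hA|exact: hA'].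
- by move=> i l; rewrite geq_max => /andP[ni n'i]; rewrite An// An'// setTI.
- apply/seteqP; split=> [w [[h0 h] [h0' h']]|w [[h0 h0'] h]].
    by split=> // i _ l _; split; [exact: h|exact: h'].
  by split; split=> // i _ l _; have [] := h i I l I.
Qed.

Lemma history_measurable s : history s `<=` measurable.
Proof.
move=> _ [A0 [A [n [A0I hA An ->]]]]; apply: measurableI; first exact: mI0.
apply: bigcapT_measurable => i; apply: fin_bigcap_measurable => // l _.
by apply: (@full_measurable i l); exact: past_sub_full (hA i l).
Qed.

Lemma I0_history s : I0 `<=` history s.
Proof.
move=> A0 A0I; exists A0, (fun _ _ => setT), 0%N; split=> //.
  by move=> i l; exact: (@measurableT _ (g_sigma_algebraType _)).
by apply/seteqP; split=> [w Aw|w []//]; split=> // i _ l _.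
Qed.

Lemma past_history s i l : past s i l `<=` history s.
Proof.
move=> C hC; exists setT, (fun i' l' => if (i' == i) && (l' == l) then C else setT), i.+1.
split=> //.
- move=> i' l'; case: ifPn => [/andP[/eqP-> /eqP->]//|_].
  exact: (@measurableT _ (g_sigma_algebraType _)).
- by move=> i' l' ii'; rewrite gtn_eqF.
- rewrite setTI; apply/seteqP; split=> [w Cw i' _ l' _|w h].
    by case: ifP.
  by have := h i I l I; rewrite !eqxx.
Qed.

Lemma history_mono s s' : s <= s' -> history s `<=` history s'.
Proof.
move=> ss' _ [A0 [A [n [A0I hA An ->]]]]; exists A0, A, n; split=> // i l.
have : past s i l `<=` past s' i l; last exact.
apply: g_sigma_algebra_sub => C [r /= /andP[r0 rs] h]; apply: sub_sigma_algebra.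
by exists r => //=; rewrite r0 (le_trans rs).
Qed.

(** Intersecting with an event C of the increment only changes the factor of index (i, l), into A i
    l [&] C, which still depends on that coordinate alone. The product formula thus reduces the
    claim to independence of the increment from the past of a single scalar Brownian motion. *)
Lemma increment_history s s' i l : 0 <= s -> s < s' ->
  independent2 P <<s history s >>
    (sigma_of [set: unit] (fun _ w => B i s' w ord0 l - B i s w ord0 l)).
Proof.
move=> s0 ss'.
have s'0 : 0 <= s' by rewrite (le_trans s0)// ltW.
pose incr := sigma_of [set: unit] (fun _ w => B i s' w ord0 l - B i s w ord0 l).
have incr_full : incr `<=` full i l.
  apply: g_sigma_algebra_sub.
  move=> _ [u _ [C mC <-]]; rewrite setTI.
  pose G := preimages [set r : R | 0 <= r] (fun r w => B i r w ord0 l).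
  have mb r : 0 <= r ->
      measurable_fun setT ((fun w => B i r w ord0 l) : g_sigma_algebraType G -> R).
    move=> r0 _ A mA; rewrite setTI; apply: sub_sigma_algebra; exists r => //.
    by exists A => //; rewrite setTI.
  have := measurable_funB (mb _ s'0) (mb _ s0).
  by move=> /(_ measurableT _ mC); rewrite setTI.
apply: independent2_gl; [exact: history_measurable| |exact: history_setI|exact: historyT|].
  exact: subset_trans incr_full (@full_measurable i l).
move=> S C [A0 [A [n [A0I hA An ->]]]] hC.
pose A' i' l' := if (i' == i) && (l' == l) then A i l `&` C else A i' l'.
pose N := maxn n i.+1.
have nN : (n <= N)%N by exact: leq_maxl.
have iN : i \in iota 0 N by rewrite mem_iota add0n /N leq_maxr.
have A'n i' l' : (N <= i')%N -> A' i' l' = setT.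
  move=> Ni'; rewrite /A' gtn_eqF/= ?An//; first exact: leq_trans Ni'.
  by apply: leq_trans Ni'; exact: leq_maxr.
have fA i' l' : full i' l' (A i' l') by exact: past_sub_full (hA i' l').
have fA' i' l' : full i' l' (A' i' l').
  rewrite /A'; case: ifPn => [/andP[/eqP-> /eqP->]|_]; last exact: fA.
  by apply: (@measurableI _ (g_sigma_algebraType _)); [exact: fA|exact: incr_full].
have -> : (A0 `&` \bigcap_i0 \bigcap_l0 A i0 l0) `&` C =
    A0 `&` \bigcap_i0 \bigcap_l0 A' i0 l0.
  rewrite -setIA; congr (_ `&` _); apply/seteqP; split=> [w [h Cw] i' _ l' _|w h].
    rewrite /A'; case: ifPn => [_|_]; last exact: h.
    by split => //; exact: h.
  split=> [i' _ l' _|]; last by have := h i I l I; rewrite /A' !eqxx => -[].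
  have := h i' I l' I; rewrite /A'; case: ifPn => [/andP[/eqP-> /eqP->] []//|//].
rewrite (bigcap_eventually_setT (leqnn N) A'n) (bigcap_eventually_setT nN An).
rewrite !brownian_product// -muleA; congr (_ * _)%E.
rewrite (bigD1_seq i iN (iota_uniq _ _))/= [in RHS](bigD1_seq i iN (iota_uniq _ _))/=.
rewrite (bigD1_seq l (mem_enum 'I_d l) (enum_uniq _))/=.
rewrite [in RHS](bigD1_seq l (mem_enum 'I_d l) (enum_uniq _))/=.
have -> : P (A' i l) = (P (A i l) * P C)%E.
  rewrite /A' !eqxx/=; have [/(_ l)[_ _ _ ind] _] := hB i.
  exact: (ind s s' s0 ss' _ _ (hA i l) hC).
rewrite (eq_bigr (fun l' => P (A i l'))); last first.
  by move=> l' /negbTE ll'; rewrite /A' ll' andbF.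
rewrite [X in (_ * X)%E](eq_bigr (fun i' => \prod_(l' <- enum 'I_d) P (A i' l'))%E); last first.
  move=> i' /negbTE ii'; apply: eq_bigr => l' _.
  by rewrite /A' ii'.
by rewrite -!muleA; congr (_ * _)%E; rewrite muleC -muleA.
Qed.

End brownian_filtration.

(** * Mutual independence of the limit particles at a fixed time *)

Section independent_copies.
Context {dT : measure_display} {T : measurableType dT} {R : realType}.
Variables (P : probability T R) (d : nat) (B X : nat -> R -> T -> 'rV[R]_d).
Variable I0 : set (set T).
Hypotheses (hB : forall i, brownian P (B i))
  (hBi : mutually_independent P (fun i => sigma_of [set t | 0 <= t] (B i)))
  (I0E : <<s I0 >> = I0) (mI0 : I0 `<=` measurable)
  (hI0 : independent2 P I0 <<s \bigcup_i preimages [set t | 0 <= t] (B i) >>)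
  (X0I : forall i, sigma_of [set: unit] (fun _ => X i 0) `<=` I0)
  (hXi : mutually_independent P (fun i => sigma_of [set: unit] (fun _ => X i 0)))
  (mX : forall i t, 0 <= t -> measurable_fun setT (X i t))
  (aX : forall i t A, 0 <= t -> measurable A ->
    augment P <<s preimages [set 0] (X i) `|` preimages [set s | 0 <= s <= t] (B i) >>
      (X i t @^-1` A)).

Local Notation sig0 i := (sigma_of [set: unit] (fun _ => X i 0)).
Local Notation sigB i := (sigma_of [set t | 0 <= t] (B i)).

(** A pi-system for the data, initial position and whole noise, of the particles in J. *)
Definition rectangles (J : seq nat) : set (set T) := [set S | exists A C : nat -> set T,
  [/\ (forall j, sig0 j (A j)), (forall j, sigB j (C j)) &
      S = \bigcap_(j in [set` J]) (A j `&` C j)]].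

Lemma rectangles_probability (J : seq nat) (A C : nat -> set T) : uniq J ->
  (forall j, sig0 j (A j)) -> (forall j, sigB j (C j)) ->
  P (\bigcap_(j in [set` J]) (A j `&` C j)) =
    ((\prod_(j <- J) P (A j)) * \prod_(j <- J) P (C j))%E.
Proof.
move=> uJ hA hC.
have -> : \bigcap_(j in [set` J]) (A j `&` C j) =
    (\bigcap_(j in [set` J]) A j) `&` (\bigcap_(j in [set` J]) C j).
  apply/seteqP; split=> [w h|w [h1 h2] j Jj]; last by split; [exact: h1|exact: h2].
  by split=> j Jj; have [] := h j Jj.
rewrite hI0 ?(hXi uJ (fun i _ => hA i)) ?(hBi uJ (fun i _ => hC i))//.
- by rewrite -I0E; apply: bigcap_seq_g_sigma => j _; rewrite I0E; exact: X0I.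
- by apply: bigcap_seq_g_sigma => j _; exact: sub_brownian.
Qed.

Lemma rectangles_setI J : setI_closed (rectangles J).
Proof.
move=> _ _ [A [C [hA hC ->]]] [A' [C' [hA' hC' ->]]].
exists (fun j => A j `&` A' j), (fun j => C j `&` C' j); split.
- by move=> j; apply: (@measurableI _ (g_sigma_algebraType _)); [exact: hA|exact: hA'].
- by move=> j; apply: (@measurableI _ (g_sigma_algebraType _)); [exact: hC|exact: hC'].
- apply/seteqP; split=> [w [h h'] j Jj|w h].
    by have [? ?] := h j Jj; have [? ?] := h' j Jj.
  by split=> j Jj; have [[? ?] [? ?]] := h j Jj.
Qed.

Lemma rectanglesT J : rectangles J setT.
Proof.
exists (fun=> setT), (fun=> setT); split.
- by move=> j; exact: (@measurableT _ (g_sigma_algebraType _)).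
- by move=> j; exact: (@measurableT _ (g_sigma_algebraType _)).
- by apply/seteqP; split.
Qed.

Lemma rectangles_measurable J : rectangles J `<=` measurable.
Proof.
move=> _ [A [C [hA hC ->]]].
apply: (sub_g_sigma_measurable (G := measurable)) => //.
apply: bigcap_seq_g_sigma => j _; apply: sub_sigma_algebra.
apply: measurableI; first by apply: mI0; exact: X0I (hA j).
exact: (sigma_brownian_measurable hB) (hC j).
Qed.

Lemma rectangles_independent (J : seq nat) (n : nat) : uniq J -> n \notin J ->
  independent2 P (rectangles [:: n]) (rectangles J).
Proof.
move=> uJ nJ _ _ [A [C [hA hC ->]]] [A' [C' [hA' hC' ->]]].
pose A2 j := if j == n then A j else A' j.
pose C2 j := if j == n then C j else C' j.
have -> : (\bigcap_(j in [set` [:: n]]) (A j `&` C j)) `&`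
    (\bigcap_(j in [set` J]) (A' j `&` C' j)) =
    \bigcap_(j in [set` n :: J]) (A2 j `&` C2 j).
  apply/seteqP; split=> [w [h h'] j|w h].
    rewrite /= inE /A2 /C2; case: eqVneq => [-> _|jn /= Jj]; last exact: h'.
    by apply: h; rewrite /= inE.
  split=> j /=; rewrite ?inE => hj.
    by have := h j; rewrite /= inE /A2 /C2 hj => /(_ isT).
  have jn : (j == n) = false by apply/eqP => jn; move: nJ; rewrite -jn hj.
  by have := h j; rewrite /= inE /A2 /C2 jn hj => /(_ isT).
rewrite !rectangles_probability//.
- rewrite !big_cons !big_nil !mule1 /A2 /C2 eqxx.
  have e (F F' : nat -> set T) : (\prod_(j <- J) P (if j == n then F j else F' j) =
      \prod_(j <- J) P (F' j))%E.
    apply: eq_big_seq => j jJ; rewrite ifF//.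
    by apply/eqP => jn; move: nJ; rewrite -jn jJ.
  by rewrite !e -!muleA; congr (_ * _)%E; rewrite muleCA.
- by rewrite /= nJ.
- by move=> j; rewrite /A2; case: ifP.
- by move=> j; rewrite /C2; case: ifP.
Qed.

(** Adaptedness of a strong solution says that X j t is, up to null sets, a function of X j 0 and B
    j; independence of the data therefore passes to the solutions. *)
Lemma state_rectangles (J : seq nat) (j : nat) (t : R) (A : set 'rV[R]_d) :
  j \in J -> 0 <= t -> measurable A ->
  maugment P <<s rectangles J >> (X j t @^-1` A).
Proof.
move=> jJ t0 mA; split.
  by rewrite -[X in measurable X]setTI; exact: mX.
have [C hC hN] := aX j t0 mA; exists C => //.
apply: g_sigma_algebra_sub hC => S [[s /= -> [D mD <-]]|[s /= /andP[s0 st] [D mD <-]]];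
    rewrite setTI; apply: sub_sigma_algebra.
- exists (fun i => if i == j then X j 0 @^-1` D else setT), (fun=> setT); split.
  + move=> i; case: eqVneq => [->|_]; last exact: (@measurableT _ (g_sigma_algebraType _)).
    by apply: sub_sigma_algebra; exists tt => //; exists D => //; rewrite setTI.
  + by move=> i; exact: (@measurableT _ (g_sigma_algebraType _)).
  + apply/seteqP; split=> [w Dw i _|w h]; first by split => //; case: eqVneq.
    by have := h j jJ; rewrite eqxx => -[].
- exists (fun=> setT), (fun i => if i == j then B j s @^-1` D else setT); split.
  + by move=> i; exact: (@measurableT _ (g_sigma_algebraType _)).
  + move=> i; case: eqVneq => [->|_]; last exact: (@measurableT _ (g_sigma_algebraType _)).
    by apply: sub_sigma_algebra; exists s => //; exists D => //; rewrite setTI.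
  + apply/seteqP; split=> [w Dw i _|w h]; first by split => //; case: eqVneq.
    by have := h j jJ; rewrite eqxx => -[].
Qed.

Lemma copies_independent (t : R) (J : seq nat) (n : nat) : 0 <= t -> n \notin J ->
  independent2 P (preimage_set_system setT (X n t) measurable)
    (sigma_of [set` J] (fun j => X j t)).
Proof.
move=> t0 nJ.
(* Mutual independence is formulated for lists without repetition, whereas J is arbitrary; hence
   [undup]. *)
have ind : independent2 P (maugment P <<s rectangles [:: n] >>)
    (maugment P <<s rectangles (undup J) >>).
  apply: independent2_maugment.
  - exact: sub_g_sigma_measurable (@rectangles_measurable _).
  - exact: sub_g_sigma_measurable (@rectangles_measurable _).
  - apply: independent2_g; try exact: rectangles_measurable; try exact: rectangles_setI;
      try exact: rectanglesT.
    by apply: rectangles_independent; rewrite ?undup_uniq ?mem_undup.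
move=> S S' [A mA <-] hS'; rewrite setTI; apply: ind.
  by apply: state_rectangles => //; rewrite inE.
have : <<s maugment P <<s rectangles (undup J) >> >> S'.
  apply: g_sigma_algebra_sub hS' => _ [j /= jJ [D mD <-]]; rewrite setTI.
  by apply: sub_sigma_algebra; apply: state_rectangles => //; rewrite mem_undup.
rewrite sigma_algebra_id//; apply: sigma_algebra_maugment.
exact: smallest_sigma_algebra.
Qed.

End independent_copies.

(** * Differences of limit particles *)

Section euclidean.
Variables (R : realType) (d : nat).
Implicit Types x y : 'rV[R]_d.

Lemma enorm_ge0 x : 0 <= enorm x.
Proof. exact: sqrtr_ge0. Qed.

Lemma enorm_sqr x : enorm x ^+ 2 = \sum_l x ord0 l ^+ 2.
Proof.
rewrite /enorm big_ord1 sqr_sqrtr//; apply: sumr_ge0 => l _; exact: sqr_ge0.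
Qed.

Lemma enorm_even x r : enorm x ^+ (2 * r) = (\sum_l x ord0 l ^+ 2) ^+ r.
Proof. by rewrite exprM enorm_sqr. Qed.

Lemma coord_le_enorm x l : `|x ord0 l| <= enorm x.
Proof.
rewrite -(@ler_pXn2r _ 2) ?nnegrE ?enorm_ge0// real_normK ?num_real// enorm_sqr.
by rewrite (bigD1 l)//= lerDl; apply: sumr_ge0 => k _; exact: sqr_ge0.
Qed.

Lemma enorm_sqrB x y : enorm (x - y) ^+ 2 <= 2 * (enorm x ^+ 2 + enorm y ^+ 2).
Proof.
rewrite !enorm_sqr -big_split/= mulr_sumr; apply: ler_sum => l _.
by rewrite !mxE; have := sqr_ge0 (x ord0 l + y ord0 l); lra.
Qed.

Lemma grad_continuous (W : 'rV[R]_d -> R) (l : 'I_d) : smooth W ->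
  continuous ((fun x => grad W x ord0 l) : 'rV[R]_d -> R).
Proof.
move=> sW; have [_] := sW [:: l].
by rewrite (_ : (fun x => _) = partial l W)//; apply/funext => x; rewrite mxE.
Qed.

Lemma grad_measurable (W : 'rV[R]_d -> R) (l : 'I_d) : smooth W ->
  measurable_fun setT (fun x => grad W x ord0 l).
Proof. by move=> sW; apply: continuous_measurable_mx; exact: grad_continuous. Qed.

Lemma measurable_fun_rV (dT : measure_display) (T : measurableType dT)
    (X : T -> 'rV[R]_d) :
  (forall l, measurable_fun setT (fun w => X w ord0 l)) -> measurable_fun setT X.
Proof. by move=> h; apply: measurable_fun_mx => k l; rewrite ord1. Qed.

Lemma measurable_rVB (dT : measure_display) (T : measurableType dT)
    (X Y : T -> 'rV[R]_d) : measurable_fun setT X -> measurable_fun setT Y ->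
  measurable_fun setT (fun w => X w - Y w).
Proof.
move=> mX mY; apply: measurable_fun_rV => l.
rewrite (_ : (fun w => _) = (fun w => X w ord0 l - Y w ord0 l)); last first.
  by apply/funext => w; rewrite !mxE.
apply: measurable_funB.
  exact: (measurableT_comp (measurable_mxE _ _) mX).
exact: (measurableT_comp (measurable_mxE _ _) mY).
Qed.

Lemma measurable_enorm_even (dT : measure_display) (T : measurableType dT)
    (X : T -> 'rV[R]_d) r : measurable_fun setT X ->
  measurable_fun setT (fun w => enorm (X w) ^+ (2 * r)).
Proof.
move=> mX; under eq_fun do rewrite enorm_even.
apply: measurable_funX; apply: measurable_sum => l; apply: measurable_funX.
exact: (measurableT_comp (measurable_mxE _ _) mX).
Qed.

(** The inequality for F is integrated at the translated points x - z and y - z, whose difference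
    does not depend on z. The bound is therefore the same for every law mu. *)
Lemma conv_monotone (F : 'rV[R]_d -> 'rV[R]_d) (mu : probability 'rV[R]_d R)
    (lam : R) x y : conv_defined F mu ->
  (forall x y, lam * enorm (x - y) ^+ 2 <= dotv (F x - F y) (x - y)) ->
  lam * enorm (x - y) ^+ 2 <= dotv (Defs.conv F mu x - Defs.conv F mu y) (x - y).
Proof.
move=> cF hF; rewrite /dotv.
have i0 l : mu.-integrable setT (EFin \o (fun z => F (x - z) ord0 l - F (y - z) ord0 l)).
  have := integrable_EFinD measurableT (cF x l) (integrable_EFinZl (-1) measurableT (cF y l)).
  by congr (_.-integrable _ _); apply/funext => z /=; rewrite mulN1r.
have [i1 E1] := Rintegral_lincomb (index_enum 'I_d) (fun l => (x - y) ord0 l)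
  measurableT i0.
rewrite (eq_bigr (fun l => (x - y) ord0 l *
    \int[mu]_z (F (x - z) ord0 l - F (y - z) ord0 l))); last first.
  move=> l _; rewrite mulrC; congr (_ * _); rewrite RintegralB//; try exact: cF.
  by rewrite !mxE.
rewrite -E1.
have -> : lam * enorm (x - y) ^+ 2 = \int[mu]_z (lam * enorm (x - y) ^+ 2).
  by rewrite Rintegral_cst//= probability_setT mulr1.
apply: le_Rintegral => //; first exact: finite_measure_integrable_cst.
move=> z _; have := hF (x - z) (y - z).
rewrite (_ : x - z - (y - z) = x - y); last by rewrite opprB addrA subrK.
move=> /le_trans; apply; rewrite le_eqVlt; apply/orP; left; apply/eqP.
by apply: eq_bigr => l _; rewrite [RHS]mulrC !mxE.
Qed.

End euclidean.

Lemma ge0_integral_law (dT : measure_display) (T : measurableType dT) (R : realType)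
    (P : probability T R) (dE : measure_display) (E : measurableType dE)
    (mu : probability E R) (X : T -> E) (f : E -> \bar R) : has_law P X mu ->
  measurable_fun setT f -> (forall x, 0 <= f x)%E ->
  (\int[P]_w f (X w) = \int[mu]_x f x)%E.
Proof.
move=> [mX lX] mf f0.
transitivity (\int[P]_(w in X @^-1` setT) (f \o X) w)%E; first by rewrite preimage_setT.
rewrite -ge0_integral_pushforward//.
by apply: eq_measure_integral => A mA _; exact: lX.
Qed.

(** A step of length 0, excluded from the Gaussian case where the variance is positive, occurs on
    the grids of t = 0. *)
Lemma small_noise0 (dT : measure_display) (T : measurableType dT) (R : realType)
    (P : probability T R) (G : set (set T)) (M : R) (r : nat) (xi : T -> R) :
  (0 < r)%N -> (forall w, xi w = 0) -> small_noise P G 0 M r xi.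
Proof.
move=> r0 xi0; have -> : xi = fun=> 0 by apply/funext.
split=> [|Y aY Y0|Y aY iY]; first exact: measurable_cst.
  under eq_integral do rewrite !expr0n muln_eq0 (gtn_eqF r0) addr0 mulr0.
  by rewrite integral0 mulr0 mul0e.
under eq_fun do rewrite mulr0; split; first exact: integrable0.
by rewrite Rintegral_cst// mul0r.
Qed.

Lemma row_oppE (R : realType) (d : nat) (x : 'rV[R]_d) l : (- x) ord0 l = - x ord0 l.
Proof. by rewrite mxE. Qed.

Lemma row_subE (R : realType) (d : nat) (x y : 'rV[R]_d) l :
  (x - y) ord0 l = x ord0 l - y ord0 l.
Proof. by rewrite mxE row_oppE. Qed.

Lemma linear_difference (R : realType) (xi xj x0 y0 c bi bj Ii Ij I : R) :
  xi = x0 + c * bi + Ii -> xj = y0 + c * bj + Ij -> I = Ii - Ij ->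
  xi - xj = x0 - y0 + c * (bi - bj) + I.
Proof. by move=> -> -> ->; ring. Qed.

Lemma drift_difference (R : realType) (d : nat) (x y gx gy cx cy : 'rV[R]_d) :
  \sum_l (x ord0 l - y ord0 l) * ((- gx - cx) ord0 l - (- gy - cy) ord0 l) =
  - dotv (gx - gy) (x - y) - dotv (cx - cy) (x - y).
Proof.
rewrite /dotv -!sumrN -big_split; apply: eq_bigr => l _.
rewrite !row_subE !row_oppE /=; ring.
Qed.

(** * The coupled system: filtration, noise and energy of a pair of limit particles *)

Section coupled.
Context {dT : measure_display} {T : measurableType dT} {R : realType}.
Variables (P : probability T R) (d : nat) (V W : 'rV[R]_d -> R).
Variables (lV lW M : R) (m : nat) (HVW : assumptions_H V W lV lW M m).
Variables (u0 : probability 'rV[R]_d R)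
    (u0N : forall N : nat, probability 'M[R]_(N, d) R)
    (B : nat -> R -> T -> 'rV[R]_d)
    (X : forall N : nat, R -> T -> 'M[R]_(N, d))
    (u : R -> probability 'rV[R]_d R)
    (Xbar : nat -> R -> T -> 'rV[R]_d).
Hypothesis CS : coupled_system P V W u0 u0N B X u Xbar.

Definition initial_sigma : set (set T) :=
  <<s preimages setT (fun i => Xbar i 0) `|`
      \bigcup_(N in [set N | (0 < N)%N])
         preimages [set: unit] (fun _ => X N 0) >>.

Lemma limit_law i t : 0 <= t -> has_law P (Xbar i t) (u t).
Proof. by move=> t0; have [h _ _] := cs_limit CS i; exact: h. Qed.

Lemma limit_measurable i t : 0 <= t -> measurable_fun setT (Xbar i t).
Proof. by move=> t0; have [] := limit_law i t0. Qed.

Lemma limit_conv t : 0 <= t -> conv_defined (grad W) (u t).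
Proof. by move=> t0; have [_ h _] := cs_limit CS 0%N; exact: h. Qed.

Lemma initial_sigmaE : <<s initial_sigma >> = initial_sigma.
Proof. by rewrite sigma_algebra_id//; exact: smallest_sigma_algebra. Qed.

Lemma initial_sigma_measurable : initial_sigma `<=` measurable.
Proof.
apply: sub_g_sigma_measurable => A [[i _ [C mC <-]]|[N /= N0 [_ _ [C mC <-]]]].
  exact: limit_measurable.
by have [h _] := cs_particles_init CS N0; exact: h.
Qed.

Lemma initial_sub i : sigma_of [set: unit] (fun _ => Xbar i 0) `<=` initial_sigma.
Proof.
apply: g_sigma_algebra_sub => A [_ _ h]; apply: sub_sigma_algebra; left.
by exists i.
Qed.

Lemma limit_adapted i t A : 0 <= t -> measurable A ->
  augment P <<s preimages [set 0] (Xbar i) `|` preimages [set s | 0 <= s <= t] (B i) >>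
      (Xbar i t @^-1` A).
Proof. by move=> t0 mA; have [_ _ [_ h _ _]] := cs_limit CS i; exact: h. Qed.

Lemma limit_copies_independent (t : R) (J : seq nat) (n : nat) : 0 <= t -> n \notin J ->
  independent2 P (preimage_set_system setT (Xbar n t) measurable)
    (sigma_of [set` J] (fun j => Xbar j t)).
Proof.
apply: (@copies_independent _ _ _ P d B Xbar initial_sigma).
- exact: cs_brownian CS.
- exact: cs_brownian_indep CS.
- exact: initial_sigmaE.
- exact: initial_sigma_measurable.
- exact: cs_init_indep CS.
- exact: initial_sub.
- exact: cs_limit_init_indep CS.
- exact: limit_measurable.
- exact: limit_adapted.
Qed.

(** The past of all noises together with all initial data, augmented because strong solutions are
    adapted only up to null sets. *)
Definition filtration (s : R) : set (set T) :=
  maugment P <<s history B initial_sigma s >>.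

Lemma initialT : initial_sigma setT.
Proof. exact: (@measurableT _ (g_sigma_algebraType _)). Qed.

Lemma initial_setI : setI_closed initial_sigma.
Proof. by move=> A C; exact: (@measurableI _ (g_sigma_algebraType _)). Qed.

Lemma history_sub_measurable s : <<s history B initial_sigma s >> `<=` measurable.
Proof.
apply: sub_g_sigma_measurable; apply: history_measurable.
- exact: cs_brownian CS.
- exact: initial_sigma_measurable.
Qed.

Lemma filtration_measurable s : filtration s `<=` measurable.
Proof. by move=> A []. Qed.

Lemma filtrationE s : <<s filtration s >> = filtration s.
Proof.
rewrite sigma_algebra_id//; apply: sigma_algebra_maugment.
exact: smallest_sigma_algebra.
Qed.

Lemma filtration_mono s s' : s <= s' -> <<s filtration s >> `<=` <<s filtration s' >>.
Proof.
move=> ss'; rewrite !filtrationE => A [mA [C hC hN]]; split => //; exists C => //.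
apply: g_sigma_algebra_sub hC => S /(history_mono ss') h; exact: sub_sigma_algebra.
Qed.

Lemma history_filtration s : <<s history B initial_sigma s >> `<=` <<s filtration s >>.
Proof. by rewrite filtrationE; apply: sub_maugment; exact: history_sub_measurable. Qed.

Lemma brownian_adapted i l s r : 0 <= r -> r <= s ->
  adapted (history B initial_sigma s) (fun w => B i r w ord0 l).
Proof.
move=> r0 rs _ A mA; rewrite setTI; apply: sub_sigma_algebra.
apply: (past_history initialT (i := i) (l := l)); apply: sub_sigma_algebra.
by exists r; [exact/andP|exists A => //; rewrite setTI].
Qed.

Lemma adapted_filtration s (Y : T -> R) :
  adapted (history B initial_sigma s) Y -> adapted (filtration s) Y.
Proof.
by move=> aY _ A mA; have := aY measurableT A mA; rewrite !setTI; exact: history_filtration.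
Qed.

Lemma limit_adapted_filtration i l s : 0 <= s ->
  adapted (filtration s) (fun w => Xbar i s w ord0 l).
Proof.
move=> s0 _ A mA; rewrite setTI; apply: sub_sigma_algebra.
have mA' : measurable ((fun x : 'rV[R]_d => x ord0 l) @^-1` A).
  by rewrite -[X in measurable X]setTI; exact: measurable_mxE.
split.
  have := measurableT_comp (measurable_mxE ord0 l) (limit_measurable i s0).
  by move=> /(_ measurableT A mA); rewrite setTI.
have [C hC hN] := limit_adapted i s0 mA'; exists C => //.
apply: g_sigma_algebra_sub hC => S [[r /= -> h]|[r /= /andP[r0 rs] [D mD <-]]].
  apply: sub_sigma_algebra; apply: I0_history; apply: initial_sub (i) _ _.
  by apply: sub_sigma_algebra; exists tt.
pose HT := g_sigma_algebraType (history B initial_sigma s).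
have mB : measurable_fun setT (B i r : HT -> 'rV[R]_d).
  by apply: measurable_fun_rV => k; exact: brownian_adapted.
exact: mB.
Qed.

Lemma brownian_increment i l s s' : 0 <= s -> s < s' ->
  has_law P (fun w => B i s' w ord0 l - B i s w ord0 l)
    (normal_prob 0 (Num.sqrt (s' - s))) /\
  independent2 P (preimage_set_system setT
    (fun w => B i s' w ord0 l - B i s w ord0 l) measurable) <<s filtration s >>.
Proof.
move=> s0 ss'; have [/(_ l)[mb _ hl _] _] := cs_brownian CS i.
split; first exact: hl.
rewrite filtrationE; apply: independent2_sym.
have ind := @increment_history _ _ _ P d B initial_sigma (cs_brownian CS)
  (cs_brownian_indep CS) initialT initial_setI initial_sigma_measurable
  (cs_init_indep CS) s s' i l s0 ss'.
set F := sigma_of _ _ in ind.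
have mF : F `<=` measurable.
  apply: sub_g_sigma_measurable => _ [_ _ [C mC <-]].
  have s'0 : 0 <= s' by rewrite (le_trans s0)// ltW.
  by have := measurable_funB (mb _ s'0) (mb _ s0); apply.
have := independent2_maugment (@history_sub_measurable s) mF ind.
move=> h A C hA hC; apply: h => //; apply: sub_maugment => //.
by apply: sub_sigma_algebra; exists tt.
Qed.

(** Both particles are driven by the convolution with the same u s, so the drift of their difference
    is dissipative at rate lV + lW, whatever this law is. *)
Lemma difference_energy_defect i j t : 0 <= t -> 0 <= lV + lW ->
  {ae P, forall w, exists n0, forall n, (n0 <= n)%N -> (0 < n)%N ->
    \sum_(k < n) energy_defect (lV + lW) (t / n%:R)
      (fun l => Xbar i (grid t n k) w ord0 l - Xbar j (grid t n k) w ord0 l)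
      (fun l => Xbar i (grid t n k.+1) w ord0 l - Xbar j (grid t n k.+1) w ord0 l)
      (fun l => Num.sqrt 2 * (B i (grid t n k.+1) w ord0 l - B j (grid t n k.+1) w ord0 l)
         - Num.sqrt 2 * (B i (grid t n k) w ord0 l - B j (grid t n k) w ord0 l)) <= 1}.
Proof.
move=> t0 c0.
have [_ _ [_ _ ci ei]] := cs_limit CS i; have [_ _ [_ _ cj ej]] := cs_limit CS j.
apply: filterS2 (filterI ci cj) (filterI ei ej) => w [{}ci {}cj] [{}ei {}ej].
pose b s x : 'rV[R]_d := - grad V x - Defs.conv (grad W) (u s) x.
pose D l s := Xbar i s w ord0 l - Xbar j s w ord0 l.
pose a l s := b s (Xbar i s w) ord0 l - b s (Xbar j s w) ord0 l.
pose eta l s := Num.sqrt 2 * (B i s w ord0 l - B j s w ord0 l).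
have coordc k l : {within `[0, +oo[, continuous (Xbar k ^~ w)} ->
    {within `[0, t], continuous (fun s => Xbar k s w ord0 l)}.
  move=> ck; have ck' : {within `[0, t], continuous (Xbar k ^~ w)}.
    by apply: continuous_subspaceW ck => s /=; rewrite !in_itv/= andbT => /andP[].
  move=> s.
  apply: (@cvg_comp _ _ _ (Xbar k ^~ w) (fun x : 'rV[R]_d => x ord0 l) _ _ _ (ck' s)).
  exact: coord_continuous.
have ib k l s : 0 <= s -> s <= t -> (forall t0 i0 k0, 0 <= t0 ->
      lebesgue_measure.-integrable `[0, t0]
       (fun s : R => (b s (Xbar k s w) i0 k0)%:E) /\
      Xbar k t0 w i0 k0 = Xbar k 0 w i0 k0 + Num.sqrt 2 * B k t0 w i0 k0
       + \int[lebesgue_measure]_(s in `[0, t0]) b s (Xbar k s w) i0 k0) ->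
   lebesgue_measure.-integrable `[0, s] (EFin \o (fun r => b r (Xbar k r w) ord0 l)).
  by move=> s0 st h; have [] := h s ord0 l s0.
have cD l : {within `[0, t], continuous (D l)}.
  by have := within_continuousB (coordc i l ci) (coordc j l cj).
have ia l : lebesgue_measure.-integrable `[0, t] (EFin \o a l).
  have := @integrable_EFinD _ _ R lebesgue_measure `[0, t]%classic _ _
    (measurable_itv _) (ib i l t t0 (lexx _) ei)
    (@integrable_EFinZl _ _ R lebesgue_measure `[0, t]%classic (-1) _
       (measurable_itv _) (ib j l t t0 (lexx _) ej)).
  by congr (_.-integrable _ _); apply/funext => s /=; rewrite mulN1r.
have eqD l s : 0 <= s <= t ->
    D l s = D l 0 + eta l s + \int[lebesgue_measure]_(r in `[0, s]) a l r.
  move=> /andP[s0 st].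
  have [_ Ei] := ei s ord0 l s0; have [_ Ej] := ej s ord0 l s0.
  have EI := @RintegralB _ _ R lebesgue_measure `[0, s]%classic _ _ (measurable_itv _)
      (ib i l s s0 st ei) (ib j l s s0 st ej).
  exact: (linear_difference Ei Ej EI).
have diss s : 0 <= s <= t ->
    \sum_l D l s * a l s <= - (lV + lW) * \sum_l D l s ^+ 2.
  move=> /andP[s0 st].
  have hV := H_convV HVW (Xbar i s w) (Xbar j s w).
  have hW := conv_monotone (Xbar i s w) (Xbar j s w) (limit_conv s0) (H_convW HVW).
  move: hV hW; rewrite !enorm_sqr.
  have -> : \sum_l (Xbar i s w - Xbar j s w) ord0 l ^+ 2 = \sum_l D l s ^+ 2.
    by apply: eq_bigr => l _; rewrite row_subE.
  have := drift_difference (Xbar i s w) (Xbar j s w) (grad V (Xbar i s w))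
    (grad V (Xbar j s w)) (Defs.conv (grad W) (u s) (Xbar i s w))
    (Defs.conv (grad W) (u s) (Xbar j s w)).
  rewrite -/(\sum_l D l s * a l s) => -> hV hW; rewrite mulNr mulrDl opprD.
  by apply: lerD; rewrite lerN2.
have [n0 hn0] := energy_defect_sum t0 c0 cD ia eqD diss ltr01.
by exists n0 => n n0n npos; exact: hn0.
Qed.

End coupled.

Lemma difference_moment (R : realType) (d : nat) (V W : 'rV[R]_d -> R)
    (lV lW M : R) (m : nat) (HVW : assumptions_H V W lV lW M m)
    (u0 : probability 'rV[R]_d R) (q : nat) :
  finite_moment (2 * q.+1) u0 ->
  exists2 C : R, 0 <= C &
  forall (dT : measure_display) (T : measurableType dT) (P : probability T R)
    (u0N : forall N : nat, probability 'M[R]_(N, d) R)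
    (B : nat -> R -> T -> 'rV[R]_d)
    (X : forall N : nat, R -> T -> 'M[R]_(N, d))
    (u : R -> probability 'rV[R]_d R)
    (Xbar : nat -> R -> T -> 'rV[R]_d),
  coupled_system P V W u0 u0N B X u Xbar ->
  forall (i j : nat) (t : R), 0 <= t ->
  (\int[P]_w (enorm (Xbar i t w - Xbar j t w) ^+ (2 * q.+1))%:E <= C%:E)%E.
Proof.
move=> mom.
(* It is half the sum of lV and lV + 2 lW. *)
have c0 : 0 < lV + lW.
  by have := H_lV HVW; have := H_lVW HVW; lra.
have [Mn Mn0 hMn] := @increments_small_noise R q.+1 isT.
have [B0 B00 hB0] := @diffusion_moment R d q (lV + lW) Mn c0 Mn0.
pose E0 := fine (\int[u0]_x (enorm x ^+ (2 * q.+1))%:E)%E.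
have E0E : (\int[u0]_x (enorm x ^+ (2 * q.+1))%:E = E0%:E)%E.
  rewrite fineK// ge0_fin_numE//; apply: integral_ge0 => x _.
  by rewrite lee_fin exprn_ge0// enorm_ge0.
have E00 : 0 <= E0.
  by rewrite -lee_fin -E0E; apply: integral_ge0 => x _; rewrite lee_fin exprn_ge0// enorm_ge0.
pose K : R := 2 ^+ q.+1 * 4 ^+ q.+1.
have K0 : 0 <= K by rewrite mulr_ge0// exprn_ge0.
(* The level has to exceed both the invariance threshold B0 and the initial moment of the pair,
   which is bounded by the marginals alone. *)
pose Bd := Num.max B0 (K * (E0 + E0 + 1)).
exists Bd => [|dT T P u0N B X u Xbar CS i j t t0]; first by rewrite le_max B00.
under eq_integral do rewrite enorm_even.
pose D l s w := Xbar i s w ord0 l - Xbar j s w ord0 l.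
pose eta l s w := Num.sqrt 2 * (B i s w ord0 l - B j s w ord0 l).
rewrite (_ : (\int[P]_w _ = \int[P]_w ((\sum_l D l t w ^+ 2) ^+ q.+1)%:E)%E); last first.
  apply: eq_integral => w _; congr (_ ^+ _)%:E; apply: eq_bigr => l _.
  by rewrite !mxE.
apply: (hB0 _ _ P t (filtration P B X Xbar) D eta t0).
- by move=> s _; exact: filtration_measurable.
- by move=> s s' _ ss' _; exact: filtration_mono.
- move=> l s /andP[s0 _]; apply: measurable_funB; exact: (limit_adapted_filtration CS).
- move=> l s /andP[s0 _]; apply: (adapted_filtration CS); rewrite /adapted.
  pose TH := g_sigma_algebraType (history B (initial_sigma X Xbar) s).
  apply: (@measurable_funM _ TH R setT (cst (Num.sqrt 2))
    (fun w => B i s w ord0 l - B j s w ord0 l)); first exact: measurable_cst.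
  apply: (@measurable_funB _ TH R setT (fun w => B i s w ord0 l) (fun w => B j s w ord0 l)).
    by apply: brownian_adapted.
  by apply: brownian_adapted.
- move=> l s s' s0; rewrite le_eqVlt => /predU1P[<- _ _|ss' _ h1].
    by rewrite subrr; apply: small_noise0 => // w; rewrite subrr.
  have [L1 I1] := brownian_increment CS i l s0 ss'.
  have [L2 I2] := brownian_increment CS j l s0 ss'.
  rewrite (_ : (fun w => _) = (fun w => Num.sqrt 2 *
     ((B i s' w ord0 l - B i s w ord0 l) - (B j s' w ord0 l - B j s w ord0 l)))); last first.
    by apply/funext => w; rewrite /eta; ring.
  by apply: hMn => //; [exact: filtration_measurable|rewrite subr_gt0].
- exact: (difference_energy_defect HVW CS i j t0 (ltW c0)).
- by rewrite /Bd le_max lexx.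
have mX k : measurable_fun setT (Xbar k 0) by exact: (limit_measurable CS).
have pw w : (\sum_l D l 0 w ^+ 2 + 2) ^+ q.+1 <=
    K * (enorm (Xbar i 0 w) ^+ (2 * q.+1) + enorm (Xbar j 0 w) ^+ (2 * q.+1) + 1).
  rewrite !(exprM (enorm _)); set a := enorm (Xbar i 0 w) ^+ 2; set b := enorm _ ^+ 2.
  have a0 : 0 <= a by exact: sqr_ge0.
  have b0 : 0 <= b by exact: sqr_ge0.
  have r0 : 0 <= \sum_l D l 0 w ^+ 2 by apply: sumr_ge0 => l _; exact: sqr_ge0.
  have rle : \sum_l D l 0 w ^+ 2 <= 2 * (a + b).
    rewrite (_ : \sum_l _ = enorm (Xbar i 0 w - Xbar j 0 w) ^+ 2); first exact: enorm_sqrB.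
    by rewrite enorm_sqr; apply: eq_bigr => l _; rewrite !mxE.
  have ab0 : 0 <= a + b by rewrite addr_ge0.
  apply: le_trans (exprD_le2 _ r0 (ler0n _ 2)) _.
  rewrite /K -mulrA ler_wpM2l ?exprn_ge0//.
  have h1 : (\sum_l D l 0 w ^+ 2) ^+ q.+1 <= 4 ^+ q.+1 * (a ^+ q.+1 + b ^+ q.+1).
    apply: (@le_trans _ _ ((2 * (a + b)) ^+ q.+1)).
      by apply: lerXn2r; rewrite ?nnegrE// mulr_ge0.
    rewrite exprMn (_ : 4 = 2 * 2 :> R); last by ring.
    by rewrite exprMn -mulrA ler_wpM2l ?exprn_ge0// exprD_le2.
  have h2 : 2 ^+ q.+1 <= 4 ^+ q.+1 :> R by apply: lerXn2r; rewrite ?nnegrE// ler_nat.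
  by rewrite [leRHS]mulrDr mulr1 lerD.
apply: (@le_trans _ _ (\int[P]_w (K * (enorm (Xbar i 0 w) ^+ (2 * q.+1) +
    enorm (Xbar j 0 w) ^+ (2 * q.+1) + 1))%:E)%E).
  apply: ge0_le_integral => //.
  - move=> w _; rewrite lee_fin exprn_ge0// addr_ge0//; apply: sumr_ge0 => l _.
    exact: sqr_ge0.
  - apply/measurable_EFinP; apply: measurable_funX; apply: measurable_funD => //.
    apply: measurable_sum => l; apply: measurable_funX; apply: measurable_funB.
      exact: (measurableT_comp (measurable_mxE _ _) (mX i)).
    exact: (measurableT_comp (measurable_mxE _ _) (mX j)).
  - apply/measurable_EFinP; apply: measurable_funM => //; apply: measurable_funD => //.
    by apply: measurable_funD; exact: measurable_enorm_even.
  - by move=> w _; rewrite lee_fin.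
have me k : measurable_fun setT (fun w => (enorm (Xbar k 0 w) ^+ (2 * q.+1))%:E).
  by apply/measurable_EFinP; exact: measurable_enorm_even.
have e0 k w : setT w -> (0 <= (enorm (Xbar k 0 w) ^+ (2 * q.+1))%:E)%E.
  by move=> _; rewrite lee_fin exprn_ge0// enorm_ge0.
have law k : (\int[P]_w (enorm (Xbar k 0 w) ^+ (2 * q.+1))%:E = E0%:E)%E.
  rewrite (ge0_integral_law (f := fun x => (enorm x ^+ (2 * q.+1))%:E) (cs_limit_init CS k))//.
    by apply/measurable_EFinP; apply: (measurable_enorm_even (X := id)).
  by move=> x; rewrite lee_fin exprn_ge0// enorm_ge0.
under eq_integral do rewrite EFinM EFinD EFinD.
rewrite ge0_integralZl_EFin//; last 2 first.
- by move=> w _; rewrite !adde_ge0// e0.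
- by apply: emeasurable_funD => //; apply: emeasurable_funD.
rewrite ge0_integralD//; last 2 first.
- by move=> w _; rewrite adde_ge0// e0.
- exact: emeasurable_funD.
rewrite ge0_integralD//; [|exact: e0|exact: e0].
rewrite !law integral_cst//= probability_setT mule1 -!EFinD -EFinM lee_fin.
by rewrite /Bd le_max lexx orbT.
Qed.

(** * Fluctuations of the empirical interaction *)

Section jensen.
Context d (T : measurableType d) (R : realType) (mu : {measure set T -> \bar R}).

(** With I the weighted integral of h, the tangent inequality of the power n + 1 at the point b I is
    integrated against w. Only an upper bound 1 / b on the mass of w is required, since the mass
    enters with a nonnegative coefficient on the larger side. *)
Lemma weighted_jensen (D : set T) (w h : T -> R) (b : R) (n : nat) : measurable D -> 0 < b ->
  (forall x, D x -> 0 <= w x) -> (forall x, D x -> 0 <= h x) ->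
  measurable_fun D w -> measurable_fun D h ->
  (\int[mu]_(x in D) (w x)%:E <= (b^-1)%:E)%E ->
  mu.-integrable D (EFin \o (fun x => w x * h x)) ->
  ((b ^+ n * (\int[mu]_(x in D) (w x * h x)) ^+ n.+1)%:E <=
    \int[mu]_(x in D) (w x * h x ^+ n.+1)%:E)%E.
Proof.
move=> mD b0 w0 h0 mw mh wb iwh.
have [->|] := eqVneq (\int[mu]_(x in D) (w x * h x ^+ n.+1)%:E)%E +oo%E; first exact: leey.
rewrite -ltey => fin.
have iwh1 : mu.-integrable D (EFin \o (fun x => w x * h x ^+ n.+1)).
  apply/integrableP; split.
    by apply/measurable_EFinP; apply: measurable_funM => //; exact: measurable_funX.
  apply: le_lt_trans fin; rewrite le_eqVlt; apply/orP; left; apply/eqP.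
  by apply: eq_integral => x /set_mem Dx /=; rewrite ger0_norm// mulr_ge0 ?w0// exprn_ge0// h0.
have iw : mu.-integrable D (EFin \o w).
  apply/integrableP; split; first exact/measurable_EFinP.
  apply: le_lt_trans (le_lt_trans wb (ltry _)); rewrite le_eqVlt; apply/orP; left; apply/eqP.
  by apply: eq_integral => x /set_mem Dx /=; rewrite ger0_norm// w0.
rewrite (EFin_Rintegral mD iwh1) lee_fin.
set I := \int[mu]_(x in D) (w x * h x); set Q := \int[mu]_(x in D) (w x * h x ^+ n.+1).
have I0 : 0 <= I by apply: Rintegral_ge0 => x Dx; rewrite mulr_ge0 ?w0 ?h0.
have a0 : 0 <= b * I by rewrite mulr_ge0// ltW.
set m := \int[mu]_(x in D) w x.
have mb : m <= b^-1 by rewrite -lee_fin -EFin_Rintegral.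
have [i2 E2] := Rintegral_lin2 (n%:R * (b * I) ^+ n.+1) 1 mD iw iwh1.
have [i1 E1] := Rintegral_lin2 (n.+1%:R * (b * I) ^+ n) 0 mD iwh iw.
have key : n.+1%:R * (b * I) ^+ n * I <= n%:R * (b * I) ^+ n.+1 * m + Q.
  have := @le_Rintegral _ _ _ mu D _ _ mD i1 i2.
  rewrite E1 E2 mul0r addr0 mul1r; apply => x Dx.
  have := young_expr n a0 (h0 _ Dx); move/(ler_wpM2l (w0 _ Dx)).
  by congr (_ <= _); ring.
have le1 : n%:R * (b * I) ^+ n.+1 * m <= n%:R * (b ^+ n * I ^+ n.+1).
  rewrite -mulrA ler_wpM2l// exprMn.
  apply: (@le_trans _ _ (b ^+ n.+1 * I ^+ n.+1 * b^-1)).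
    by rewrite ler_wpM2l// mulr_ge0 ?exprn_ge0// ltW.
  by rewrite le_eqVlt; apply/orP; left; apply/eqP; rewrite exprS; field; rewrite gt_eqF.
move: key; rewrite (_ : _ * I = n.+1%:R * (b ^+ n * I ^+ n.+1)); last first.
  by rewrite exprMn exprSr; ring.
rewrite -natr1 mulrDl mul1r => key.
by have := le_trans key (lerD le1 (lexx Q)); rewrite lerD2l.
Qed.

End jensen.

Lemma jensen_even_expr d (T : measurableType d) (R : realType) (mu : probability T R)
    (g : T -> R) (p : nat) : mu.-integrable setT (EFin \o g) ->
  (((\int[mu]_x g x) ^+ (2 * p))%:E <= \int[mu]_x (g x ^+ (2 * p))%:E)%E.
Proof.
move=> ig; case: p => [|p].
  under eq_integral do rewrite muln0 expr0.
  by rewrite muln0 expr0 integral_cst//= probability_setT mul1e.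
have mg : measurable_fun setT g by apply/measurable_EFinP; case/integrableP: ig.
have ig' : mu.-integrable setT (EFin \o (fun x => cst 1 x * `|g x|)).
  rewrite (_ : _ \o _ = abse \o (EFin \o g)); first exact: integrable_abse.
  by apply/funext => x /=; rewrite mul1r.
rewrite -norm_exprM2.
have -> : (2 * p.+1 = (2 * p).+1.+1)%N by lia.
have := @weighted_jensen _ T R mu setT (cst 1) (fun x => `|g x|) 1 (2 * p).+1 measurableT ltr01.
rewrite expr1n mul1r => /(_ (fun _ _ => ler01) (fun _ _ => normr_ge0 _) (measurable_cst _)).
have h1 : (\int[mu]_x (1 : R)%:E <= (1^-1)%:E)%E.
  by rewrite integral_cst//= probability_setT mul1e invr1.
move=> /(_ (measurableT_comp (@normr_measurable R setT) mg) h1 ig').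
have -> : (\int[mu]_x (cst 1 x * `|g x| ^+ (2 * p).+2)%:E = \int[mu]_x (g x ^+ (2 * p).+2)%:E)%E.
  apply: eq_integral => x _ /=; rewrite mul1r (_ : (2 * p).+2 = 2 * p.+1)%N; last by lia.
  by rewrite norm_exprM2.
apply: le_trans; rewrite lee_fin; apply: lerXn2r; rewrite ?nnegrE//.
  by apply: Rintegral_ge0 => x _; rewrite mul1r.
apply: le_trans (le_normr_Rintegral _ _) _ => //.
by under eq_Rintegral do rewrite -[`|_|]mul1r.
Qed.

Lemma measurable_Rintegral2 d1 (T1 : measurableType d1) d2 (T2 : measurableType d2)
    (R : realType) (m2 : probability T2 R) (f : T1 * T2 -> R) :
  measurable_fun setT f -> measurable_fun setT (fun x => \int[m2]_y f (x, y)).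
Proof.
move=> mf; apply: (measurableT_comp (@fine_measurable R setT measurableT)).
under eq_fun do rewrite integralE.
have mp (h : T1 * T2 -> \bar R) : measurable_fun setT h -> (forall z, 0 <= h z)%E ->
    measurable_fun setT (fun x => \int[m2]_y h (x, y))%E.
  by move=> mh h0; have := measurable_fun_fubini_tonelli_F (m2 := m2) h mh h0.
have mE : measurable_fun setT (EFin \o f) by exact/measurable_EFinP.
apply: emeasurable_funB.
  have h := mp ((EFin \o f)^\+)%E (measurable_funepos mE) (fun z => funepos_ge0 _ z).
  apply: eq_measurable_fun h => x _; apply: eq_integral => y _; by rewrite !funeposE.
have h := mp ((EFin \o f)^\-)%E (measurable_funeneg mE) (fun z => funeneg_ge0 _ z).
by apply: eq_measurable_fun h => x _; apply: eq_integral => y _; rewrite !funenegE.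
Qed.

(** X i is independent of the X j with j in J, so it can be frozen at a point x. The variables F x -
    K (x, X j) are then independent and centered, and the bound for their sum is integrated over
    x. *)
Lemma fluctuation_moment (R : realType) (p : nat) : (0 < p)%N ->
  exists2 C : R, 0 < C &
  forall (dT : measure_display) (T : measurableType dT) (P : probability T R)
    (dE : measure_display) (E : measurableType dE) (mu : probability E R)
    (X : nat -> T -> E) (K : E * E -> R),
  (forall j, has_law P (X j) mu) ->
  (forall (J : seq nat) n, n \notin J ->
    independent2 P (preimage_set_system setT (X n) measurable)
      (sigma_of [set` J] X)) ->
  measurable_fun setT K -> (forall x, mu.-integrable setT (fun y => (K (x, y))%:E)) ->
  let F x := \int[mu]_y K (x, y) in
  forall (J : seq nat) (i : nat), uniq J -> i \notin J ->
    (\int[P]_w ((\sum_(j <- J) (F (X i w) - K (X i w, X j w))) ^+ (2 * p))%:E <=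
      (C * (size J)%:R ^+ p)%:E *
        (1 + \int[mu]_x \int[mu]_y ((F x - K (x, y)) ^+ (2 * p))%:E))%E.
Proof.
move=> p0; have [C C0 hC] := sum_independent_moment R p0.
exists C => // dT T P dE E mu X K lawX indX mK iK F J i uJ iJ.
have mX j : measurable_fun setT (X j) by have [] := lawX j.
have mF : measurable_fun setT F by exact: measurable_Rintegral2.
have mG : preimages [set` J] X `<=` measurable.
  by move=> _ [j _ [A mA <-]]; exact: mX.
pose G := preimages [set` J] X.
pose f (z : E * g_sigma_algebraType G) : \bar R :=
  ((\sum_(j <- J) (F z.1 - K (z.1, X j z.2))) ^+ (2 * p))%:E.
have f0 z : (0 <= f z)%E by rewrite lee_fin even_expr_ge0.
have mfG : measurable_fun setT f.
  apply/measurable_EFinP/measurable_funX.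
  (* Summation over positions makes each term carry the membership j \in J, without which X j is not
     G-measurable. *)
  under eq_fun do rewrite (big_nth 0%N) big_mkord.
  apply: measurable_sum => k; set j := nth _ _ _.
  have jJ : j \in J by exact: mem_nth.
  apply: measurable_funB; first exact: (measurableT_comp mF measurable_fst).
  apply: (measurableT_comp mK); apply/measurable_fun_pairP; split; first exact: measurable_fst.
  have mXG : measurable_fun setT (X j : g_sigma_algebraType G -> E).
    by move=> _ A mA; apply: sub_sigma_algebra; exists j => //; exists A.
  exact: (measurableT_comp mXG measurable_snd).
have mf : measurable_fun setT (f : E * T -> \bar R).
  apply/measurable_EFinP/measurable_funX; apply: measurable_sum => j.
  apply: measurable_funB; first exact: (measurableT_comp mF measurable_fst).
  apply: (measurableT_comp mK); apply/measurable_fun_pairP; split; first exact: measurable_fst.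
  exact: (measurableT_comp (mX j) measurable_snd).
have -> : (\int[P]_w ((\sum_(j <- J) (F (X i w) - K (X i w, X j w))) ^+ (2 * p))%:E
   = \int[P]_w \int[mu]_x f (x, w))%E.
  exact: (ge0_integral_independent (lawX i) mG (indX J i iJ) mfG f0).
have -> : (\int[P]_w \int[mu]_x f (x, w) = \int[mu]_x \int[P]_w f (x, w))%E.
  by rewrite (@fubini_tonelli _ _ _ _ _ mu P).
pose Q x := (\int[mu]_y ((F x - K (x, y)) ^+ (2 * p))%:E)%E.
have Q0 x : (0 <= Q x)%E by apply: integral_ge0 => y _; rewrite lee_fin even_expr_ge0.
have mQ : measurable_fun setT Q.
  have := measurable_fun_fubini_tonelli_F (m2 := mu)
    (fun z : E * E => ((F z.1 - K z) ^+ (2 * p))%:E).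
  rewrite /fubini_F; apply.
    apply/measurable_EFinP/measurable_funX/measurable_funB => //.
    exact: (measurableT_comp mF measurable_fst).
  by move=> z; rewrite lee_fin even_expr_ge0.
have ic : mu.-integrable setT (EFin \o cst (1 : R)) by exact: finite_measure_integrable_cst.
have hl x := Rintegral_lin2 (F x) (-1) measurableT ic (iK x).
have c0 : 0 <= C * (size J)%:R ^+ p by rewrite mulr_ge0 ?exprn_ge0// ltW.
apply: (@le_trans _ _ (\int[mu]_x ((C * (size J)%:R ^+ p)%:E * (1 + Q x)))%E).
  apply: ge0_le_integral => //.
  - by move=> x _; apply: integral_ge0.
  - exact: (measurable_fun_fubini_tonelli_F (m2 := P)).
  - by apply: emeasurable_funM => //; apply: emeasurable_funD.
  - move=> x _; apply: (hC _ _ P _ _ mu X (fun y => F x - K (x, y))) => //.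
    + apply: measurable_funB => //; apply: (measurableT_comp mK).
      apply/measurable_fun_pairP; split; [exact: measurable_cst|exact: measurable_id].
    + by move: (hl x).1; congr (_.-integrable _ _); apply/funext => y /=; rewrite mulr1 mulN1r.
    + under eq_Rintegral do rewrite -[F x]mulr1 -mulN1r.
      by rewrite (hl x).2 Rintegral_cst//= probability_setT !mulr1 mulN1r subrr.
rewrite ge0_integralZl_EFin//; [|by move=> x _; rewrite adde_ge0|exact: emeasurable_funD].
by rewrite ge0_integralD// integral_cst//= probability_setT mul1e.
Qed.

Lemma even_exprD_le2 (R : realFieldType) (a b : R) (r : nat) :
  (a + b) ^+ (2 * r) <= 2 ^+ (2 * r) * (a ^+ (2 * r) + b ^+ (2 * r)).
Proof.
rewrite -norm_exprM2 -(norm_exprM2 a) -(norm_exprM2 b).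
apply: le_trans (exprD_le2 _ (normr_ge0 a) (normr_ge0 b)).
by apply: lerXn2r; rewrite ?nnegrE ?addr_ge0// ler_normD.
Qed.

Lemma integral_le_sum2 d (T : measurableType d) (R : realType)
    (mu : {measure set T -> \bar R}) (f g h : T -> R) (c : R) : 0 <= c ->
  (forall x, 0 <= f x) -> (forall x, 0 <= g x) -> (forall x, 0 <= h x) ->
  measurable_fun setT f -> measurable_fun setT g -> measurable_fun setT h ->
  (forall x, f x <= c * (g x + h x)) ->
  (\int[mu]_x (f x)%:E <= c%:E * (\int[mu]_x (g x)%:E + \int[mu]_x (h x)%:E))%E.
Proof.
move=> c0 f0 g0 h0 mf mg mh le; rewrite -ge0_integralD//; last 4 first.
- by move=> x _; rewrite lee_fin.
- exact/measurable_EFinP.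
- by move=> x _; rewrite lee_fin.
- exact/measurable_EFinP.
rewrite -ge0_integralZl_EFin//; last 2 first.
- by move=> x _; rewrite -EFinD lee_fin addr_ge0.
- by apply: emeasurable_funD; exact/measurable_EFinP.
apply: ge0_le_integral => //.
- by move=> x _; rewrite lee_fin.
- exact/measurable_EFinP.
- by apply/measurable_EFinP/measurable_funM => //; exact: measurable_funD.
- by move=> x _; rewrite -EFinD -EFinM lee_fin.
Qed.

Lemma finite_moment_le (R : realType) (m n a b : nat) (mu : probability 'M[R]_(m, n) R) :
  (a <= b)%N -> finite_moment (2 * b) mu -> finite_moment (2 * a) mu.
Proof.
move=> ab; rewrite /finite_moment => fb.
have me r : measurable_fun setT (fun x : 'M[R]_(m, n) => enorm x ^+ (2 * r)).
  rewrite (_ : (fun x => _) = fun x : 'M[R]_(m, n) => (\sum_(i < m) \sum_(j < n) x i j ^+ 2) ^+ r).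
    apply: measurable_funX; apply: measurable_sum => i; apply: measurable_sum => j.
    by apply: measurable_funX; exact: measurable_mxE.
  apply/funext => x; rewrite exprM /enorm sqr_sqrtr//.
  by apply: sumr_ge0 => i _; apply: sumr_ge0 => j _; exact: sqr_ge0.
apply: (@le_lt_trans _ _ (1%:E * (\int[mu]_x 1%:E + \int[mu]_x (enorm x ^+ (2 * b))%:E))%E).
  apply: integral_le_sum2 => //; try by move=> x; rewrite even_expr_ge0.
  move=> x; rewrite mul1r; have e0 : 0 <= enorm x by exact: sqrtr_ge0.
  have [h|h] := leP (enorm x) 1.
    by apply: (@le_trans _ _ 1); rewrite ?exprn_ile1// lerDl even_expr_ge0.
  apply: (@le_trans _ _ (enorm x ^+ (2 * b))); last by rewrite lerDr.
  by rewrite ler_eXn2l//; lia.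
by rewrite mul1e integral_cst//= probability_setT mul1e lte_add_pinfty// ltry.
Qed.

Lemma difference_growth_moment (R : realType) (d : nat) (V W : 'rV[R]_d -> R)
    (lV lW M : R) (m p : nat) (HVW : assumptions_H V W lV lW M m)
    (u0 : probability 'rV[R]_d R) : (0 < p)%N ->
  finite_moment (2 * m ^ 2 * p) u0 ->
  exists2 C : R, 0 <= C &
  forall (dT : measure_display) (T : measurableType dT) (P : probability T R)
    (u0N : forall N : nat, probability 'M[R]_(N, d) R)
    (B : nat -> R -> T -> 'rV[R]_d)
    (X : forall N : nat, R -> T -> 'M[R]_(N, d))
    (u : R -> probability 'rV[R]_d R)
    (Xbar : nat -> R -> T -> 'rV[R]_d),
  coupled_system P V W u0 u0N B X u Xbar ->
  forall (i j : nat) (t : R), 0 <= t ->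
  (\int[P]_w (enorm (Xbar i t w - Xbar j t w) ^+ (2 * (m * p)))%:E <= C%:E)%E.
Proof.
(* For m = 0 the exponent vanishes, while [difference_moment] speaks of positive even exponents. *)
move=> p0 mom; case: (posnP m) => [m0|m0].
  exists 1 => // dT T P u0N B X u Xbar _ i j t _; rewrite m0 mul0n muln0.
  by under eq_integral do rewrite expr0; rewrite integral_cst//= probability_setT mul1e.
have mp : (m * p = (m * p).-1.+1)%N by rewrite prednK// muln_gt0 m0.
have mom' : finite_moment (2 * (m * p).-1.+1) u0.
  rewrite -mp; apply: (@finite_moment_le _ _ _ _ (m ^ 2 * p)) => //; last by rewrite mulnA.
  by rewrite leq_mul2r expnS expn1 leq_pmulr// orbT.
by have [C C0 hC] := difference_moment HVW mom'; exists C => //; rewrite mp.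
Qed.

Section interaction.
Variables (R : realType) (d : nat) (V W : 'rV[R]_d -> R).
Variables (lV lW M : R) (m : nat) (HVW : assumptions_H V W lV lW M m).

Lemma grad_odd0 : grad W 0 = 0.
Proof.
have := H_odd HVW 0; rewrite oppr0 => /eqP; rewrite -subr_eq0 opprK => /eqP h.
apply/matrixP => i j; have := congr1 (fun A : 'rV[R]_d => A i j) h; rewrite !mxE; lra.
Qed.

Lemma grad_growth z : enorm (grad W z) <= M * (2 + enorm z ^+ m).
Proof.
have := H_growthW HVW z 0; rewrite grad_odd0 !subr0 => /le_trans; apply.
have e0 : 0 <= enorm z by exact: enorm_ge0.
have M0 := ltW (H_M HVW).
have -> : enorm (0 : 'rV[R]_d) = 0.
  by rewrite /enorm big_ord1 big1 ?sqrtr0// => l _; rewrite mxE expr0n.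
rewrite -mulrA; apply: ler_wpM2l => //.
apply: (@le_trans _ _ (1 * (1 + enorm z ^+ m + 0 ^+ m))).
  apply: ler_wpM2r; last by rewrite ge_min lexx orbT.
  by rewrite !addr_ge0// exprn_ge0.
(* For m = 0 the power 0 ^+ m equals 1, whence the constant 2 and not 1. *)
rewrite mul1r expr0n; have : (m == 0%N)%:R <= 1 :> R by case: (m == 0%N).
lra.
Qed.

Lemma grad_growth_even z l r :
  (grad W z) ord0 l ^+ (2 * r) <=
    (M * 2) ^+ (2 * r) * (2 ^+ (2 * r) + enorm z ^+ (2 * (m * r))).
Proof.
have M0 := ltW (H_M HVW).
rewrite -norm_exprM2; apply: (@le_trans _ _ ((M * (2 + enorm z ^+ m)) ^+ (2 * r))).
  apply: lerXn2r; rewrite ?nnegrE//; last exact: le_trans (coord_le_enorm _ _) (grad_growth _).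
  by rewrite mulr_ge0// addr_ge0// exprn_ge0// enorm_ge0.
rewrite !exprMn -mulrA; apply: ler_wpM2l; first exact: exprn_ge0.
apply: le_trans (even_exprD_le2 _ _ _) _.
by rewrite -!exprM (_ : m * (2 * r) = 2 * (m * r))%N//; lia.
Qed.

End interaction.

Lemma measurable_interaction (R : realType) (d : nat) (W : 'rV[R]_d -> R) l : smooth W ->
  measurable_fun setT (fun z : 'rV[R]_d * 'rV[R]_d => grad W (z.1 - z.2) ord0 l).
Proof.
move=> sW; apply: (measurableT_comp (grad_measurable l sW)).
by apply: measurable_rVB; [exact: measurable_fst|exact: measurable_snd].
Qed.

(** The double integral against u t is the expectation of grad W at the difference of two
    independent limit particles, those of index 0 and 1; by the growth of grad W it is controlled by
    moments of that difference, which are bounded uniformly in time. *)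
Lemma interaction_moment (R : realType) (d : nat) (V W : 'rV[R]_d -> R)
    (lV lW M : R) (m p : nat) (HVW : assumptions_H V W lV lW M m)
    (u0 : probability 'rV[R]_d R) : (0 < p)%N ->
  finite_moment (2 * m ^ 2 * p) u0 ->
  exists2 C : R, 0 <= C &
  forall (dT : measure_display) (T : measurableType dT) (P : probability T R)
    (u0N : forall N : nat, probability 'M[R]_(N, d) R)
    (B : nat -> R -> T -> 'rV[R]_d)
    (X : forall N : nat, R -> T -> 'M[R]_(N, d))
    (u : R -> probability 'rV[R]_d R)
    (Xbar : nat -> R -> T -> 'rV[R]_d),
  coupled_system P V W u0 u0N B X u Xbar ->
  forall (t : R) (l : 'I_d), 0 <= t ->
  (\int[u t]_x \int[u t]_y (grad W (x - y) ord0 l ^+ (2 * p))%:E <= C%:E)%E.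
Proof.
move=> p0 mom; have [C C0 hC] := difference_growth_moment HVW p0 mom.
have c0 : 0 <= (M * 2) ^+ (2 * p) by exact: even_expr_ge0.
exists ((M * 2) ^+ (2 * p) * (2 ^+ (2 * p) + C)).
  by rewrite mulr_ge0// addr_ge0// even_expr_ge0.
move=> dT T P u0N B X u Xbar CS t l t0; set mu := u t.
pose h (z : 'rV[R]_d * 'rV[R]_d) := (grad W (z.2 - z.1) ord0 l ^+ (2 * p))%:E.
have mh : measurable_fun setT h.
  apply/measurable_EFinP/measurable_funX.
  exact: (measurableT_comp (measurable_interaction l (H_smoothW HVW)) (@measurable_swap _ _ _ _)).
have h0 z : (0 <= h z)%E by rewrite lee_fin even_expr_ge0.
have L j : has_law P (Xbar j t) mu by exact: (limit_law CS).
have mX j : measurable_fun setT (Xbar j t) by have [] := L j.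
have ind : independent2 P (preimage_set_system setT (Xbar 0%N t) measurable)
    (sigma_of [set` [:: 1%N]] (fun j => Xbar j t)) by exact: (limit_copies_independent CS).
set G := preimages [set` [:: 1%N]] (fun j => Xbar j t) in ind.
have mG : G `<=` measurable by move=> _ [j _ [A mA <-]]; exact: mX.
pose f (z : 'rV[R]_d * g_sigma_algebraType G) := h (z.1, Xbar 1%N t z.2).
have mX1 : measurable_fun setT (Xbar 1%N t : g_sigma_algebraType G -> 'rV[R]_d).
  move=> _ A mA; apply: sub_sigma_algebra; exists 1%N; first by rewrite /= inE.
  by exists A.
have mf : measurable_fun setT f.
  apply: (measurableT_comp mh); apply/measurable_fun_pairP; split; first exact: measurable_fst.
  exact: (measurableT_comp mX1 measurable_snd).
have -> : (\int[mu]_x \int[mu]_y (grad W (x - y) ord0 l ^+ (2 * p))%:E =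
    \int[P]_w h (Xbar 0%N t w, Xbar 1%N t w))%E.
  rewrite (ge0_integral_independent (L 0%N) mG ind mf (fun z => h0 _)).
  rewrite -(ge0_integral_law (f := fun y => \int[mu]_x h (x, y))%E (L 1%N))//.
    exact: (measurable_fun_fubini_tonelli_G (m1 := mu)).
  by move=> x; apply: integral_ge0.
have mE r : measurable_fun setT (fun w => enorm (Xbar 1%N t w - Xbar 0%N t w) ^+ (2 * r)).
  by apply: measurable_enorm_even; exact: measurable_rVB.
have := @integral_le_sum2 _ T R P (fun w => grad W (Xbar 1%N t w - Xbar 0%N t w) ord0 l ^+ (2 * p))
  (cst (2 ^+ (2 * p))) (fun w => enorm (Xbar 1%N t w - Xbar 0%N t w) ^+ (2 * (m * p)))
  ((M * 2) ^+ (2 * p)) c0.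
move=> /(_ (fun _ => even_expr_ge0 _ _) (fun _ => even_expr_ge0 _ _) (fun _ => even_expr_ge0 _ _)).
have mg : measurable_fun setT (fun w => grad W (Xbar 1%N t w - Xbar 0%N t w) ord0 l ^+ (2 * p)).
  apply: measurable_funX; apply: (measurableT_comp (grad_measurable l (H_smoothW HVW))).
  exact: measurable_rVB.
move=> /(_ mg (measurable_cst _) (mE _) (fun _ => grad_growth_even HVW _ _ _)) /le_trans; apply.
rewrite EFinM EFinD; apply: lee_wpmul2l; first by rewrite lee_fin.
have -> : (\int[P]_w (cst (2 ^+ (2 * p) : R) w)%:E = (2 ^+ (2 * p))%:E)%E.
  by rewrite (integral_cst P measurableT (2 ^+ (2 * p))%:E)//= probability_setT mule1.
by apply: leeD2l; exact: (hC _ _ _ _ _ _ _ _ CS).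
Qed.

(** The coordinate l of the vector G^i, taken separately because the moment bounds for independent
    sums are scalar. *)
Definition fluctuation {dT : measure_display} {T : measurableType dT} {R : realType}
    {d : nat} (W : 'rV[R]_d -> R) (u : R -> probability 'rV[R]_d R)
    (Xbar : nat -> R -> T -> 'rV[R]_d) (N i : nat) (l : 'I_d) (t : R) (w : T) : R :=
  Defs.conv (grad W) (u t) (Xbar i t w) ord0 l -
  N%:R^-1 * \sum_(j < N) grad W (Xbar i t w - Xbar j t w) ord0 l.

(** The diagonal term of the empirical sum vanishes because grad W 0 = 0. Hence N times the
    fluctuation is a centered sum over j != i, of moment of order N^p, plus one term F (Xbar i),
    bounded through Jensen's inequality; division by N^(2p) leaves N^-p. *)
Lemma fluctuation_bound (R : realType) (d : nat) (V W : 'rV[R]_d -> R)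
    (lV lW M : R) (m p : nat) (HVW : assumptions_H V W lV lW M m)
    (u0 : probability 'rV[R]_d R) : (0 < p)%N ->
  finite_moment (2 * m ^ 2 * p) u0 ->
  exists2 C : R, 0 <= C &
  forall (dT : measure_display) (T : measurableType dT) (P : probability T R)
    (u0N : forall N : nat, probability 'M[R]_(N, d) R)
    (B : nat -> R -> T -> 'rV[R]_d)
    (X : forall N : nat, R -> T -> 'M[R]_(N, d))
    (u : R -> probability 'rV[R]_d R)
    (Xbar : nat -> R -> T -> 'rV[R]_d),
  coupled_system P V W u0 u0N B X u Xbar ->
  forall (N i : nat) (t : R) (l : 'I_d), (i < N)%N -> 0 <= t ->
  measurable_fun setT (fluctuation W u Xbar N i l t) /\
  (\int[P]_w (fluctuation W u Xbar N i l t w ^+ (2 * p))%:E <= (C / N%:R ^+ p)%:E)%E.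
Proof.
move=> p0 mom; have [K K0 hK] := interaction_moment HVW p0 mom.
have [C1 C10 hC1] := fluctuation_moment R p0.
pose c : R := 2 ^+ (2 * p).
have c0 : 0 <= c by exact: even_expr_ge0.
exists (c * (C1 * (1 + c * (K + K)) + K)).
  by rewrite mulr_ge0// addr_ge0// mulr_ge0 ?ltW// ltr_wpDr// mulr_ge0// addr_ge0.
move=> dT T P u0N B X u Xbar CS N i t l iN t0; set mu := u t.
have L j : has_law P (Xbar j t) mu by exact: (limit_law CS).
have mX j : measurable_fun setT (Xbar j t) by have [] := L j.
pose Kl (z : 'rV[R]_d * 'rV[R]_d) := grad W (z.1 - z.2) ord0 l.
have mK : measurable_fun setT Kl by exact: (measurable_interaction l (H_smoothW HVW)).
have iK x : mu.-integrable setT (fun y => (Kl (x, y))%:E) by exact: (limit_conv CS t0 x l).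
pose F x := \int[mu]_y Kl (x, y).
have mF : measurable_fun setT F by exact: measurable_Rintegral2.
pose J := [seq j <- index_iota 0 N | j != i].
have uJ : uniq J by rewrite filter_uniq// iota_uniq.
have iJ : i \notin J by rewrite mem_filter eqxx.
have sJ : (size J <= N)%N by rewrite size_filter (leq_trans (count_size _ _))// size_iota subn0.
have N0 : 0 < N%:R :> R by rewrite ltr0n; exact: leq_ltn_trans iN.
pose S w := \sum_(j <- J) (F (Xbar i t w) - Kl (Xbar i t w, Xbar j t w)).
have fE w : fluctuation W u Xbar N i l t w = N%:R^-1 * (S w + F (Xbar i t w)).
  have sumE : \sum_(j < N) (F (Xbar i t w) - Kl (Xbar i t w, Xbar j t w)) =
      S w + F (Xbar i t w).
    rewrite -(big_mkord xpredT (fun j => F (Xbar i t w) - Kl (Xbar i t w, Xbar j t w))).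
    rewrite (bigD1_seq i) ?iota_uniq ?mem_index_iota//= -big_filter addrC; congr (_ + _).
    by rewrite /Kl/= subrr (grad_odd0 HVW) mxE subr0.
  rewrite -sumE sumrB sumr_const card_ord -[F _ *+ N]mulr_natl mulrBr mulKf ?lt0r_neq0//.
  by rewrite /fluctuation /Defs.conv mxE.
have mS : measurable_fun setT S.
  apply: measurable_sum => j; apply: measurable_funB; first exact: (measurableT_comp mF).
  apply: (measurableT_comp mK); apply/measurable_fun_pairP; split; exact: mX.
have mFX : measurable_fun setT (fun w => F (Xbar i t w)) by exact: (measurableT_comp mF).
have mfl : measurable_fun setT (fluctuation W u Xbar N i l t).
  rewrite (_ : fluctuation _ _ _ _ _ _ _ = fun w => N%:R^-1 * (S w + F (Xbar i t w))).
    by apply: measurable_funM => //; exact: measurable_funD.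
  by apply/funext => w; rewrite fE.
split => //.
have c10 : 0 <= N%:R^-1 ^+ (2 * p) * c by rewrite mulr_ge0// even_expr_ge0.
pose Q := (\int[mu]_x \int[mu]_y (Kl (x, y) ^+ (2 * p))%:E)%E.
have QK : (Q <= K%:E)%E by exact: (hK _ _ _ _ _ _ _ _ CS).
have mKp : measurable_fun setT (fun x => \int[mu]_y (Kl (x, y) ^+ (2 * p))%:E)%E.
  apply: (measurable_fun_fubini_tonelli_F (m2 := mu) (fun z => (Kl z ^+ (2 * p))%:E)).
    by apply/measurable_EFinP; exact: (measurable_funX (2 * p) mK).
  by move=> z; rewrite lee_fin even_expr_ge0.
have Kp0 x : (0 <= \int[mu]_y (Kl (x, y) ^+ (2 * p))%:E)%E.
  by apply: integral_ge0 => y _; rewrite lee_fin even_expr_ge0.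
have mFp : measurable_fun setT (fun x => (F x ^+ (2 * p))%:E).
  by apply/measurable_EFinP; exact: (measurable_funX (2 * p) mF).
have FQ : (\int[mu]_x (F x ^+ (2 * p))%:E <= K%:E)%E.
  apply: le_trans QK; apply: ge0_le_integral => //.
  - by move=> x _; rewrite lee_fin even_expr_ge0.
  - by move=> x _; exact: (jensen_even_expr p (iK x)).
have mKx x : measurable_fun setT (fun y => Kl (x, y)).
  apply: (measurableT_comp mK); apply/measurable_fun_pairP.
  by split; [exact: measurable_cst|exact: measurable_id].
have FKQ : (\int[mu]_x \int[mu]_y ((F x - Kl (x, y)) ^+ (2 * p))%:E <=
    c%:E * (K%:E + K%:E))%E.
  apply: (@le_trans _ _ (\int[mu]_x (c%:E * ((F x ^+ (2 * p))%:E +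
      \int[mu]_y (Kl (x, y) ^+ (2 * p))%:E)))%E).
    apply: ge0_le_integral => //.
    - by move=> x _; apply: integral_ge0 => y _; rewrite lee_fin even_expr_ge0.
    - apply: (measurable_fun_fubini_tonelli_F (m2 := mu)
        (fun z : 'rV[R]_d * 'rV[R]_d => ((F z.1 - Kl z) ^+ (2 * p))%:E)).
        apply/measurable_EFinP; apply: (measurable_funX (2 * p)).
        exact: (measurable_funB (measurableT_comp mF measurable_fst) mK).
      by move=> z; rewrite lee_fin even_expr_ge0.
    - by apply: emeasurable_funM => //; apply: emeasurable_funD.
    - move=> x _.
      have := @integral_le_sum2 _ _ R mu (fun y => (F x - Kl (x, y)) ^+ (2 * p))
        (cst (F x ^+ (2 * p))) (fun y => Kl (x, y) ^+ (2 * p)) c c0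
        (fun _ => even_expr_ge0 _ _) (fun _ => even_expr_ge0 _ _) (fun _ => even_expr_ge0 _ _).
      rewrite (integral_cst mu measurableT (F x ^+ (2 * p))%:E)//= probability_setT mule1; apply.
      + exact: (measurable_funX (2 * p) (measurable_funB (measurable_cst _) (mKx x))).
      + exact: measurable_cst.
      + exact: (measurable_funX (2 * p) (mKx x)).
      + move=> y; apply: le_trans (even_exprD_le2 _ _ _) _.
        by rewrite -(norm_exprM2 (- _)) normrN norm_exprM2.
  rewrite ge0_integralZl_EFin//; last 2 first.
  - by move=> x _; rewrite adde_ge0// lee_fin even_expr_ge0.
  - by apply: emeasurable_funD.
  rewrite ge0_integralD//; last first.
    by move=> x _; rewrite lee_fin even_expr_ge0.
  by apply: lee_wpmul2l; rewrite ?lee_fin//; exact: leeD.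
have := @integral_le_sum2 _ _ R P (fun w => fluctuation W u Xbar N i l t w ^+ (2 * p))
  (fun w => S w ^+ (2 * p)) (fun w => F (Xbar i t w) ^+ (2 * p)) _ c10
  (fun _ => even_expr_ge0 _ _) (fun _ => even_expr_ge0 _ _) (fun _ => even_expr_ge0 _ _)
  (measurable_funX _ mfl) (measurable_funX _ mS) (measurable_funX _ mFX).
have pw w : fluctuation W u Xbar N i l t w ^+ (2 * p) <=
    N%:R^-1 ^+ (2 * p) * c * (S w ^+ (2 * p) + F (Xbar i t w) ^+ (2 * p)).
  by rewrite fE exprMn -mulrA ler_wpM2l ?even_expr_ge0// even_exprD_le2.
move=> /(_ pw) /le_trans; apply.
have SQ : (\int[P]_w (S w ^+ (2 * p))%:E <=
    (C1 * N%:R ^+ p * (1 + c * (K + K)))%:E)%E.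
  apply: le_trans (hC1 _ _ P _ _ mu _ Kl L (fun J n => limit_copies_independent CS t0)
    mK iK J i uJ iJ) _.
  rewrite [leRHS]EFinM; apply: lee_pmul.
  - by rewrite lee_fin mulr_ge0 ?exprn_ge0// ltW.
  - by rewrite adde_ge0//; apply: integral_ge0 => x _; apply: integral_ge0 => y _;
      rewrite lee_fin even_expr_ge0.
  - rewrite lee_fin; apply: ler_wpM2l; first exact: ltW.
    by apply: lerXn2r; rewrite ?nnegrE ?ler_nat.
  - by rewrite EFinD EFinM EFinD; exact: leeD2l.
have FX : (\int[P]_w (F (Xbar i t w) ^+ (2 * p))%:E <= K%:E)%E.
  rewrite (ge0_integral_law (f := fun x => (F x ^+ (2 * p))%:E) (L i))//.
  by move=> x; rewrite lee_fin even_expr_ge0.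
apply: (@le_trans _ _ ((N%:R^-1 ^+ (2 * p) * c)%:E *
   ((C1 * N%:R ^+ p * (1 + c * (K + K)))%:E + K%:E))%E).
  by apply: lee_wpmul2l; rewrite ?lee_fin//; exact: leeD.
rewrite -EFinD -EFinM lee_fin.
have Np : 1 <= N%:R ^+ p :> R by rewrite exprn_ege1// ler1n (leq_ltn_trans _ iN).
have Np0 : 0 < N%:R ^+ p :> R by rewrite exprn_gt0.
rewrite ler_pdivlMr// mulnC exprM exprVn; move: (N%:R ^+ p) Np Np0 => x x1 x0.
set A := C1 * (1 + _).
rewrite [leLHS](_ : _ = c * (A + K * x^-1)); last first.
  by rewrite (_ : C1 * x * _ = A * x); [field; rewrite lt0r_neq0|rewrite /A; ring].
by rewrite ler_wpM2l// lerD2l ler_piMr// invf_le1.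
Qed.

(** * Integration of the fluctuations in time *)

Section caratheodory.
Context {dT : measure_display} {T : measurableType dT} {R : realType}.
Local Notation RL := (measurableTypeR R).

(** A process measurable at each time with continuous paths is the pointwise limit of its values at
    the times k / (n + 1) just below s, and these approximations are measurable on countably many
    product sets. [Num.max 0] freezes the path at negative times, where nothing is assumed. *)
Lemma caratheodory_measurable (f : R -> T -> R) :
  (forall s, 0 <= s -> measurable_fun setT (f s)) ->
  (forall w, {within `[0, +oo[, continuous (f ^~ w)}) ->
  measurable_fun setT (fun z : RL * T => f (Num.max 0 z.1) z.2).
Proof.
move=> mf cf.
pose k n (s : R) := Num.truncn (Num.max 0 s * n.+1%:R).
pose g n (z : RL * T) := f ((k n z.1)%:R / n.+1%:R) z.2.
have n0 n : 0 < n.+1%:R :> R by rewrite ltr0Sn.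
have max0 (s : R) : 0 <= Num.max 0 s by rewrite le_max lexx.
have kP n s : (k n s)%:R <= Num.max 0 s * n.+1%:R < (k n s).+1%:R.
  by apply: truncn_itv; rewrite mulr_ge0.
apply: (@measurable_fun_cvg _ _ _ _ g) => [n|[s w] _] /=.
  move=> _ A mA; rewrite setTI.
  pose Dj (j : nat) : set RL := (fun s => Num.max 0 s * n.+1%:R) @^-1` `[j%:R, j.+1%:R[.
  have -> : g n @^-1` A = \bigcup_j (Dj j `*` (f (j%:R / n.+1%:R) @^-1` A)).
    apply/seteqP; split=> [[s w] /= h|[s w] [j _ [/= Ds h]]].
      by exists (k n s) => //; split => //=; rewrite /Dj /= in_itv/= kP.
    have E : k n s = j by apply: truncn_def; move: Ds; rewrite /Dj/= in_itv.
    by rewrite /preimage/= /g/= E.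
  apply: bigcupT_measurable => j; apply: measurableX.
    have mm : measurable_fun setT (fun s : RL => Num.max 0 s * n.+1%:R).
      by apply: measurable_funM => //; apply: measurable_maxr.
    by rewrite -[X in measurable X]setTI; apply: mm => //; exact: measurable_itv.
  by rewrite -[X in measurable X]setTI; apply: mf; rewrite ?divr_ge0.
set x := Num.max 0 s; have x0 : 0 <= x by exact: max0.
have := cf w x; rewrite /continuous_at => cx.
have Ax : `[0, +oo[%classic x by rewrite /= in_itv/= andbT.
apply: (@cvg_comp _ _ _ (fun n => (k n s)%:R / n.+1%:R : R) (f ^~ w) _ (within `[0, +oo[ (nbhs x))).
  move=> U; rewrite /within/= => hU.
  have h : (fun n => (k n s)%:R / n.+1%:R : R) @ \oo --> x.
    apply/cvgrPdist_le => e e0.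
    have := near_infty_natSinv_lt (PosNum e0); apply: filterS => n /= /ltW hn.
    apply: le_trans hn; have /andP[h1 h2] := kP n s.
    have -> : x - (k n s)%:R / n.+1%:R = (x * n.+1%:R - (k n s)%:R) / n.+1%:R.
      by field; rewrite lt0r_neq0.
    rewrite ger0_norm; last by rewrite divr_ge0// subr_ge0.
    by rewrite ler_pdivrMr// mulVf ?lt0r_neq0// lerBlDl natr1 ltW.
  apply: (@filterS _ (nbhs \oo) _ (fun n => (`[0, +oo[%classic : set R)
    ((k n s)%:R / n.+1%:R) -> U ((k n s)%:R / n.+1%:R)) _ _ (h _ hU)) => n hn; apply: hn.
  by rewrite /= in_itv/= andbT divr_ge0.
by move: cx; rewrite (nbhs_subspace_in Ax).
Qed.

End caratheodory.

Lemma integral_expRM_le (R : realType) (b t : R) : 0 < b -> 0 <= t ->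
  (\int[lebesgue_measure]_(s in `[0%R, t]) (expR (b * s))%:E <= (b^-1 * expR (b * t))%:E)%E.
Proof.
move=> b0; rewrite le_eqVlt => /predU1P[<-|t0].
  by rewrite set_itv1 integral_set1 lee_fin mulr_ge0 ?invr_ge0 ?ltW// expR_gt0.
pose F s : R := b^-1 * expR (b * s).
have dF (s : R) : is_derive s 1 F (expR (b * s)).
  apply: is_derive_eq; rewrite /GRing.scale/= mulr1.
  by field; rewrite gt_eqF.
rewrite (@continuous_FTC2 _ _ F)//.
- by rewrite -EFinB lee_fin /F lerBlDr lerDl mulr_ge0 ?invr_ge0 ?ltW// expR_gt0.
- exact/continuous_subspaceT/expRM_continuous.
- have cF : continuous F.
    by move=> s; apply: cvgMr; exact: expRM_continuous.
  split; first by move=> s _; have [] := dF s.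
    by apply: cvg_at_right_filter; exact: cF.
  by apply: cvg_at_left_filter; exact: cF.
- by move=> s _; rewrite derive1E; have [] := dF s.
Qed.

Lemma has_law_ae {dT : measure_display} {T : measurableType dT} {R : realType}
    (P : probability T R) {dE : measure_display} {E : measurableType dE}
    (mu : set E -> \bar R) (X Y : T -> E) (A : set T) : has_law P X mu ->
  measurable_fun setT Y -> measurable A -> P A = 0%E -> (forall w, ~ A w -> Y w = X w) ->
  has_law P Y mu.
Proof.
move=> [mX lX] mY mA PA XY; split => // C mC; rewrite -lX//.
rewrite -[Y @^-1` C]setIT -[X @^-1` C]setIT; apply: probability_sym_diff => //.
- by rewrite -[X in measurable X]setTI; exact: mY.
- by rewrite -[X in measurable X]setTI; exact: mX.
- exists A; split=> // w /= [[h1 h2]|[h1 h2]]; apply: contrapT => nA; apply: h2;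
    by move: h1; rewrite /preimage/= XY.
Qed.

Lemma Rintegral_law (dT : measure_display) (T : measurableType dT) (R : realType)
    (P : probability T R) (dE : measure_display) (E : measurableType dE)
    (mu : probability E R) (X : T -> E) (f : E -> R) : has_law P X mu ->
  measurable_fun setT f -> \int[P]_w f (X w) = \int[mu]_x f x.
Proof.
move=> lX mf; congr fine; rewrite [LHS]integralE [RHS]integralE.
have mE : measurable_fun setT (EFin \o f) by exact/measurable_EFinP.
congr (_ - _)%E.
  rewrite -(ge0_integral_law (f := ((EFin \o f)^\+)%E) lX).
  - by apply: eq_integral => w _; rewrite !funeposE.
  - exact: measurable_funepos.
  - by move=> x; exact: funepos_ge0.
rewrite -(ge0_integral_law (f := ((EFin \o f)^\-)%E) lX).
- by apply: eq_integral => w _; rewrite !funenegE.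
- exact: measurable_funeneg.
- by move=> x; exact: funeneg_ge0.
Qed.

(* The paths are replaced by zero on a null set, which makes them continuous
   everywhere, hence jointly measurable as required by Tonelli's theorem; [Z] is
   the integral of the modified integrand. *)
Lemma time_fluctuation {dT : measure_display} {T : measurableType dT} {R : realType}
    (P : probability T R) (d : nat) (V W : 'rV[R]_d -> R) (lV lW M : R) (m : nat)
    (u0 : probability 'rV[R]_d R)
    (u0N : forall N : nat, probability 'M[R]_(N, d) R)
    (B : nat -> R -> T -> 'rV[R]_d)
    (X : forall N : nat, R -> T -> 'M[R]_(N, d))
    (u : R -> probability 'rV[R]_d R)
    (Xbar : nat -> R -> T -> 'rV[R]_d)
    (N i : nat) (l : 'I_d) (r : nat) (b t K : R) :
  assumptions_H V W lV lW M m -> coupled_system P V W u0 u0N B X u Xbar ->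
  0 < b -> 0 <= t -> 0 <= K ->
  (forall s, 0 <= s -> measurable_fun setT (fluctuation W u Xbar N i l s) /\
     (\int[P]_w (fluctuation W u Xbar N i l s w ^+ (2 * r))%:E <= K%:E)%E) ->
  exists Z : T -> \bar R, [/\ measurable_fun setT Z, (forall w, 0 <= Z w)%E,
    {ae P, forall w, (\int[lebesgue_measure]_(s in `[0%R, t])
       (expR (b * s) * fluctuation W u Xbar N i l s w ^+ (2 * r))%:E = Z w)%E} &
    (\int[P]_w Z w <= (K * (b^-1 * expR (b * t)))%:E)%E].
Proof.
move=> HVW CS b0 t0 K0 hfl.
have : {ae P, forall w, forall j, {within `[0, +oo[, continuous (Xbar j ^~ w)}}.
  by apply: ae_foralln => j; have [_ _ []] := cs_limit CS j.
move=> [A [mA PA hA]].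
pose RL := measurableTypeR R.
pose x j s k w := \1_(~` A) w * Xbar j s w ord0 k.
have xE j s k w : ~ A w -> x j s k w = Xbar j s w ord0 k.
  by move=> nA; rewrite /x indicE mem_set// mul1r.
have mx j s k : 0 <= s -> measurable_fun setT (x j s k).
  move=> s0; apply: measurable_funM.
    by apply: measurable_indic; exact: measurableC.
  exact: (measurableT_comp (measurable_mxE _ _) (limit_measurable CS j s0)).
have cx j k w : {within `[0, +oo[, continuous (fun s => x j s k w)}.
  have [Aw|nA] := pselect (A w).
    rewrite (_ : (fun s => _) = cst 0); first by apply/continuous_subspaceT => z; exact: cvg_cst.
    by apply/funext => s; rewrite /x indicE memNset ?mul0r//= => /(_ Aw).
  have cj : {within `[0, +oo[, continuous (Xbar j ^~ w)}.
    by move: j; apply: contrapT => h; apply: nA; apply: hA.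
  rewrite (_ : (fun s => _) = (fun s => Xbar j s w ord0 k)); last first.
    by apply/funext => s; rewrite xE.
  move=> s; apply: (@cvg_comp _ _ _ (Xbar j ^~ w) (fun y : 'rV[R]_d => y ord0 k) _ _ _ (cj s)).
  exact: coord_continuous.
pose Y j (z : RL * T) : 'rV[R]_d := \row_k x j (Num.max 0 z.1) k z.2.
have mY j : measurable_fun setT (Y j).
  apply: measurable_fun_rV => k; under eq_fun do rewrite mxE.
  apply: (@caratheodory_measurable _ T R (fun s w => x j s k w)) => [s s0|w].
    exact: mx.
  exact: cx.
have YE j s w : 0 <= s -> ~ A w -> Y j (s, w) = Xbar j s w.
  move=> s0 nA; apply/rowP => k; rewrite mxE/= xE//; congr (Xbar _ _ _ _ _).
  exact: max_r.
have mYs j s : measurable_fun setT (fun w => Y j (s, w)).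
  by apply: (measurableT_comp (mY j)); apply: measurable_pair1.
have LY j s : 0 <= s -> has_law P (fun w => Y j (s, w)) (u s).
  move=> s0; apply: (has_law_ae (limit_law CS j s0) (mYs j s) mA PA) => w nA.
  exact: YE.
(* The convolution with u s is written as an integral over a second sample w' of particle 0, whose
   law at time s is u s. Joint measurability in (s, w) then comes from the paths and requires none
   of s -> u s. *)
pose g (z : (RL * T) * T) := grad W (Y i z.1 - Y 0%N (z.1.1, z.2)) ord0 l.
have mg : measurable_fun setT g.
  apply: (measurableT_comp (grad_measurable l (H_smoothW HVW))); apply: measurable_rVB.
    exact: (measurableT_comp (mY i) measurable_fst).
  apply: (measurableT_comp (mY 0%N)); apply/measurable_fun_pairP; split.
    exact: (measurableT_comp measurable_fst measurable_fst).
  exact: measurable_snd.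
pose H (z : RL * T) := \int[P]_w' g (z, w') -
  N%:R^-1 * \sum_(j < N) grad W (Y i z - Y j z) ord0 l.
have mH : measurable_fun setT H.
  apply: measurable_funB; first exact: measurable_Rintegral2.
  apply: measurable_funM => //; apply: measurable_sum => j.
  apply: (measurableT_comp (grad_measurable l (H_smoothW HVW))).
  exact: measurable_rVB.
have HE s w : 0 <= s -> ~ A w -> H (s, w) = fluctuation W u Xbar N i l s w.
  move=> s0 nA; rewrite /H /fluctuation (YE i s w s0 nA); congr (_ - _ * _).
    rewrite /Defs.conv mxE /g/= (YE i s w s0 nA).
    have mgx : measurable_fun setT (fun y : 'rV[R]_d => grad W (Xbar i s w - y) ord0 l).
      apply: (measurableT_comp (grad_measurable l (H_smoothW HVW))).
      by apply: measurable_rVB; [exact: measurable_cst|exact: measurable_id].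
    have hR := Rintegral_law (LY 0%N s s0) mgx.
    exact: hR.
  by apply: eq_bigr => j _; rewrite (YE j s w s0 nA).
pose h (z : RL * T) : \bar R :=
  (\1_(`[0, t]%classic : set RL) z.1 * (expR (b * z.1) * H z ^+ (2 * r)))%:E.
have e0 s : 0 <= expR (b * s) :> R by exact: expR_ge0.
have h0 z : (0 <= h z)%E.
  by rewrite lee_fin mulr_ge0// ?mulr_ge0 ?even_expr_ge0// indicE.
have mexp : measurable_fun setT (fun s : RL => expR (b * s)).
  by apply: continuous_measurable_fun; exact: expRM_continuous.
have mh : measurable_fun setT h.
  apply/measurable_EFinP; apply: measurable_funM.
    by apply: (measurableT_comp (@measurable_indic _ RL R setT _ (measurable_itv _)));
      exact: measurable_fst.
  apply: measurable_funM; last exact: (measurable_funX (2 * r) mH).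
  exact: (measurableT_comp mexp measurable_fst).
exists (fun w => \int[lebesgue_measure]_s h (s, w))%E; split.
- exact: (measurable_fun_fubini_tonelli_G (m1 := lebesgue_measure)).
- by move=> w; apply: integral_ge0.
- exists A; split => // w /= hw; apply: contrapT => nA; apply: hw.
  rewrite integral_mkcond; apply: eq_integral => s _; rewrite patchE /h/= indicE.
  case: ifPn => [|_]; last by rewrite mul0r.
  by rewrite inE/= in_itv/= => /andP[s0 _]; rewrite mul1r HE.
rewrite -(@fubini_tonelli _ _ _ _ _ lebesgue_measure P)//.
apply: (@le_trans _ _ (\int[lebesgue_measure]_(s in `[0%R, t]) (K%:E * (expR (b * s))%:E))%E).
  rewrite [leRHS]integral_mkcond; apply: ge0_le_integral => //.
  - by move=> s _; apply: integral_ge0.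
  - exact: (measurable_fun_fubini_tonelli_F (m2 := P)).
  - apply/(measurable_restrictT _ _).1 => //; apply: measurable_funTS.
    by apply: emeasurable_funM => //; exact/measurable_EFinP.
  - move=> s _; rewrite patchE /h; case: ifPn => [|ns]; last first.
      by under eq_integral do rewrite /= indicE (negbTE ns) mul0r; rewrite integral0.
    move=> st; under eq_integral do rewrite /= indicE st mul1r EFinM.
    move: st; rewrite inE/= in_itv/= => /andP[s0 _].
    rewrite ge0_integralZl_EFin//; last 2 first.
    + by move=> w _; rewrite lee_fin even_expr_ge0.
    + apply/measurable_EFinP; apply: (measurable_funX (2 * r)).
      by apply: (measurableT_comp mH); apply: measurable_pair1.
    rewrite muleC; apply: lee_wpmul2r; first by rewrite lee_fin.
    have [mfl fle] := hfl s s0; apply: le_trans fle.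
    rewrite le_eqVlt; apply/orP; left; apply/eqP; apply: ge0_ae_eq_integral => //.
    + apply/measurable_EFinP; apply: (measurable_funX (2 * r)).
      by apply: (measurableT_comp mH); apply: measurable_pair1.
    + by apply/measurable_EFinP; exact: (measurable_funX (2 * r) mfl).
    + by move=> w _; rewrite lee_fin even_expr_ge0.
    + by move=> w _; rewrite lee_fin even_expr_ge0.
    + exists A; split => // w /= hw; apply: contrapT => nA; apply: hw => _.
      by rewrite HE.
rewrite ge0_integralZl_EFin//; last first.
  by apply: measurable_funTS; exact/measurable_EFinP.
rewrite [leRHS]EFinM; apply: lee_wpmul2l; first by rewrite lee_fin.
exact: integral_expRM_le.
Qed.

(** * Dissipativity of the particle system *)

Section dotv.
Variables (R : realType) (d : nat).
Implicit Types x y z : 'rV[R]_d.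

Lemma dotvC x y : dotv x y = dotv y x.
Proof. by apply: eq_bigr => k _; rewrite mulrC. Qed.

Lemma dotvDl x y z : dotv (x + y) z = dotv x z + dotv y z.
Proof. by rewrite -big_split; apply: eq_bigr => k _; rewrite mxE mulrDl. Qed.

Lemma dotvZl c x y : dotv (c *: x) y = c * dotv x y.
Proof. by rewrite mulr_sumr; apply: eq_bigr => k _; rewrite mxE mulrA. Qed.

Lemma dotvNl x y : dotv (- x) y = - dotv x y.
Proof. by rewrite -scaleN1r dotvZl mulN1r. Qed.

Lemma dotvBl x y z : dotv (x - y) z = dotv x z - dotv y z.
Proof. by rewrite dotvDl dotvNl. Qed.

Lemma dotvDr x y z : dotv x (y + z) = dotv x y + dotv x z.
Proof. by rewrite dotvC dotvDl !(dotvC x). Qed.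

Lemma dotvZr c x y : dotv x (c *: y) = c * dotv x y.
Proof. by rewrite dotvC dotvZl dotvC. Qed.

Lemma dotvNr x y : dotv x (- y) = - dotv x y.
Proof. by rewrite dotvC dotvNl dotvC. Qed.

Lemma dotvBr x y z : dotv x (y - z) = dotv x y - dotv x z.
Proof. by rewrite dotvDr dotvNr. Qed.

Lemma dotv_suml (I : Type) (s : seq I) (f : I -> 'rV[R]_d) y :
  dotv (\sum_(i <- s) f i) y = \sum_(i <- s) dotv (f i) y.
Proof.
elim: s => [|i s IH]; last by rewrite !big_cons dotvDl IH.
by rewrite !big_nil; apply: big1 => k _; rewrite mxE mul0r.
Qed.

Lemma dotv_sumr (I : Type) (s : seq I) (f : I -> 'rV[R]_d) x :
  dotv x (\sum_(i <- s) f i) = \sum_(i <- s) dotv x (f i).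
Proof. by rewrite dotvC dotv_suml; apply: eq_bigr => i _; rewrite dotvC. Qed.

Lemma dotvv x : dotv x x = enorm x ^+ 2.
Proof. by rewrite enorm_sqr; apply: eq_bigr => k _; rewrite expr2. Qed.

Lemma dotv_le x y : dotv x y <= enorm x * enorm y.
Proof.
have [h|/ltW h] := leP 0 (dotv x y); last first.
  by apply: le_trans h _; rewrite mulr_ge0// enorm_ge0.
rewrite -(@ler_pXn2r _ 2) ?nnegrE ?mulr_ge0 ?enorm_ge0//.
by rewrite exprMn !enorm_sqr; exact: sqr_sum_mul_le.
Qed.

Lemma dotv_amgm x y : 2 * `|dotv x y| <= enorm x ^+ 2 + enorm y ^+ 2.
Proof.
have h c : 0 <= enorm (x + c *: y) ^+ 2 by exact: sqr_ge0.
have := h 1; have := h (-1); rewrite -!dotvv !dotvDl !dotvDr !dotvZl !dotvZr.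
rewrite (dotvC y x); move: (dotv x y) (dotv x x) (dotv y y) => D A C h1 h2.
by have [D0|D0] := ger0P D; lra.
Qed.

(** The gradient of |x|^(2 (q + 1)) up to the factor 2 (q + 1); it is the test vector of the energy
    estimate for p = q + 1. *)
Definition powv (q : nat) x : 'rV[R]_d := enorm x ^+ (2 * q) *: x.

Lemma powv_dotv q x : dotv (powv q x) x = enorm x ^+ (2 * q.+1).
Proof. by rewrite dotvZl dotvv -exprD; congr (_ ^+ _); lia. Qed.

Lemma chebyshev_expr (a b : R) q : 0 <= a -> 0 <= b -> 0 <= (a ^+ q - b ^+ q) * (a - b).
Proof.
move=> a0 b0; have [ab|/ltW ba] := leP a b.
  by rewrite mulr_le0// subr_le0//; apply: lerXn2r.
by rewrite mulr_ge0// subr_ge0//; apply: lerXn2r.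
Qed.

(** With A = |x|^2 and C = |y|^2, the pairing is A^(q+1) + C^(q+1) - (A^q + C^q) x . y with |x . y|
    <= (A + C) / 2. Both bounds then reduce to (A^q - C^q) (A - C) >= 0. The upper one is needed
    when lW < 0. *)
Lemma powv_monotone q x y :
  0 <= dotv (powv q x - powv q y) (x - y) <=
    2 * (enorm x ^+ (2 * q.+1) + enorm y ^+ (2 * q.+1)).
Proof.
have := dotv_amgm x y; have A0 := sqr_ge0 (enorm x); have B0 := sqr_ge0 (enorm y).
rewrite dotvBl !dotvBr !powv_dotv /powv !dotvZl (dotvC y x) !(exprM (enorm _)).
move: (enorm x ^+ 2) (enorm y ^+ 2) A0 B0 => A C A0 C0; rewrite !exprSr.
have := chebyshev_expr q A0 C0; have := exprn_ge0 q A0; have := exprn_ge0 q C0.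
move: (A ^+ q) (C ^+ q) (dotv x y) => eA eC D eC0 eA0 ch am.
have : `|(eA + eC) * D| <= (eA + eC) * ((A + C) / 2).
  rewrite normrM (ger0_norm (addr_ge0 eA0 eC0)); apply: ler_wpM2l; first exact: addr_ge0.
  by rewrite ler_pdivlMr// mulrC.
rewrite ler_norml => /andP[h1 h2].
by apply/andP; split; nra.
Qed.

End dotv.

(** The property of grad W required after symmetrization, with x and y the deviations of particles i
    and j, and z, z' the relative positions in the two systems, which differ by x - y. It isolates
    the only place where the cases q = 0, d = 1 and quadratic W are told apart. *)
Definition monotone_interaction (R : realType) (d : nat) (F : 'rV[R]_d -> 'rV[R]_d)
    (lam : R) (q : nat) : Prop := forall x y z z' : 'rV[R]_d, z - z' = x - y ->
  lam * dotv (powv q x - powv q y) (x - y) <= dotv (powv q x - powv q y) (F z - F z').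

Lemma monotone_interaction0 (R : realType) (d : nat) (F : 'rV[R]_d -> 'rV[R]_d) (lam : R) :
  (forall x y, lam * enorm (x - y) ^+ 2 <= dotv (F x - F y) (x - y)) ->
  monotone_interaction F lam 0.
Proof.
move=> hF x y z z' zz'; rewrite /powv muln0 !expr0 !scale1r -zz' dotvv dotvC.
exact: le_trans (hF _ _) _.
Qed.

Lemma monotone_interaction_linear (R : realType) (d : nat) (F : 'rV[R]_d -> 'rV[R]_d)
    (lam : R) q : (forall x, F x = lam *: x) -> monotone_interaction F lam q.
Proof. by move=> hF x y z z' zz'; rewrite !hF -scalerBr zz' dotvZr. Qed.

(** On the line, powv q x - powv q y is a nonnegative multiple of x - y, so the convexity inequality
    is simply multiplied by this ratio. *)
Lemma monotone_interaction_dim1 (R : realType) (F : 'rV[R]_1 -> 'rV[R]_1) (lam : R) q :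
  (forall x y, lam * enorm (x - y) ^+ 2 <= dotv (F x - F y) (x - y)) ->
  monotone_interaction F lam q.
Proof.
move=> hF x y z z' zz'.
have e1 (v : 'rV[R]_1) : enorm v ^+ 2 = v ord0 ord0 ^+ 2 by rewrite enorm_sqr big_ord1.
have [xy|xy] := eqVneq x y.
  have v0 (v : 'rV[R]_1) : dotv (0 : 'rV[R]_1) v = 0 by rewrite /dotv big1// => k _; rewrite mxE mul0r.
  by rewrite xy !subrr !v0 mulr0.
have v0 : (x - y) ord0 ord0 != 0.
  apply: contra xy => /eqP h; rewrite -subr_eq0; apply/eqP/matrixP => i j.
  by rewrite !ord1 h mxE.
have := hF z z'; rewrite zz' e1.
have := powv_monotone q x y; rewrite /dotv !big_ord1 => /andP[+ _].
move: v0; move: ((powv q x - powv q y) ord0 ord0) ((x - y) ord0 ord0) ((F z - F z') ord0 ord0).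
move=> D v f v0 Dv h.
have c0 : 0 <= D / v.
  have -> : D / v = D * v / v ^+ 2 by field.
  by rewrite divr_ge0// sqr_ge0.
have := ler_wpM2l c0 h.
have -> : D / v * (lam * v ^+ 2) = lam * (D * v) by field.
by have -> : D / v * (f * v) = D * f by field.
Qed.

Lemma grad_quadratic (R : realType) (d : nat) (W : 'rV[R]_d -> R) (lam : R) x :
  (forall y, W y = lam * (enorm y ^+ 2 / 2)) -> grad W x = lam *: x.
Proof.
move=> hW; apply/rowP => k; rewrite !mxE /partial /derive.
apply: (@cvg_lim R^o) => //.
have step (h : R) : h != 0 ->
    h^-1 *: ((W (h *: delta_mx ord0 k + x) : R^o) - W x) = lam * (x ord0 k + h / 2).
  move=> h0; rewrite !hW !enorm_sqr.
  have -> : \sum_l (h *: delta_mx ord0 k + x) ord0 l ^+ 2 =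
      \sum_l x ord0 l ^+ 2 + (h ^+ 2 + 2 * h * x ord0 k).
    rewrite [in RHS](bigD1 k)//= [LHS](bigD1 k)//= !mxE !eqxx /= mulr1.
    rewrite [X in _ + X = _](eq_bigr (fun l => x ord0 l ^+ 2)); first by ring.
    by move=> l lk; rewrite !mxE (negbTE lk)/= mulr0 add0r.
  by rewrite /GRing.scale/=; field.
have lim : (fun h : R => lam * (x ord0 k + h / 2)) h @[h --> 0^'] --> lam * x ord0 k.
  have -> : lam * x ord0 k = lam * (x ord0 k + 0 / 2) by rewrite mul0r addr0.
  apply: cvg_within_filter; apply: cvgM; first exact: cvg_cst.
  by apply: cvgD; [exact: cvg_cst|apply: cvgM; [exact: cvg_id|exact: cvg_cst]].
apply: cvg_trans lim; apply: near_eq_cvg.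
by apply: filterS (nbhs_dnbhs_neq _) => h /step ->.
Qed.

(** * Energy dissipation of N interacting particles against N reference points *)

Section dissipation.
Variables (R : realType) (d : nat) (V W : 'rV[R]_d -> R).
Variables (lV lW M : R) (m : nat) (HVW : assumptions_H V W lV lW M m).
Variables (q N : nat) (hN : (0 < N)%N) (hU : monotone_interaction (grad W) lW q).
Variables x y : 'I_N -> 'rV[R]_d.
Let z i := x i - y i.
Let ph i := powv q (z i).
Let Wd i j := grad W (x i - x j) - grad W (y i - y j).

Lemma interaction_symmetrized :
  2 * \sum_i \sum_j dotv (ph i) (Wd i j) = \sum_i \sum_j dotv (ph i - ph j) (Wd i j).
Proof.
have anti i j : Wd j i = - Wd i j.
  by rewrite /Wd -(opprB (x i)) -(opprB (y i)) !(H_odd HVW) opprB opprK addrC.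
have -> : \sum_i \sum_j dotv (ph i - ph j) (Wd i j) =
    \sum_i \sum_j dotv (ph i) (Wd i j) + \sum_i \sum_j dotv (ph j) (Wd j i).
  rewrite -big_split; apply: eq_bigr => i _; rewrite -big_split; apply: eq_bigr => j _ /=.
  by rewrite dotvBl (anti i j) dotvNr.
by rewrite [X in _ = _ + X]exchange_big /= mulr2n mulrDl mul1r.
Qed.

(** Origin of the two cases of [beta]. By symmetrization the double sum is at least lW D / 2, where
    0 <= D <= 4 N S. It is nonnegative for lW >= 0, and at least 2 lW N S for lW < 0. *)
Lemma interaction_lower :
  (if 0 <= lW then 0 else 2 * lW) * (N%:R * \sum_i enorm (z i) ^+ (2 * q.+1)) <=
  \sum_i \sum_j dotv (ph i) (Wd i j).
Proof.
pose D := \sum_i \sum_j dotv (ph i - ph j) (z i - z j).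
have D0 : 0 <= D.
  by apply: sumr_ge0 => i _; apply: sumr_ge0 => j _; have /andP[] := powv_monotone q (z i) (z j).
pose S := \sum_i enorm (z i) ^+ (2 * q.+1).
have D4 : D <= 4 * (N%:R * S).
  apply: (@le_trans _ _ (\sum_(i < N) \sum_(j < N)
      2 * (enorm (z i) ^+ (2 * q.+1) + enorm (z j) ^+ (2 * q.+1)))).
    by apply: ler_sum => i _; apply: ler_sum => j _; have /andP[] := powv_monotone q (z i) (z j).
  have -> : \sum_(i < N) \sum_(j < N)
      2 * (enorm (z i) ^+ (2 * q.+1) + enorm (z j) ^+ (2 * q.+1)) =
      2 * (\sum_(i < N) (N%:R * enorm (z i) ^+ (2 * q.+1) + S)).
    rewrite mulr_sumr; apply: eq_bigr => i _; rewrite -mulr_sumr big_split/=.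
    by rewrite sumr_const card_ord -[_ *+ N]mulr_natl.
  rewrite big_split/= -mulr_sumr sumr_const card_ord -[S *+ N]mulr_natl -/S.
  by rewrite le_eqVlt; apply/orP; left; apply/eqP; ring.
have lW2 : lW * D <= 2 * \sum_i \sum_j dotv (ph i) (Wd i j).
  rewrite interaction_symmetrized mulr_sumr; apply: ler_sum => i _; rewrite mulr_sumr.
  apply: ler_sum => j _; apply: hU.
  by rewrite /z opprB addrACA [- x j + _]addrC -addrACA opprB.
rewrite -/S; move: (N%:R * S) D4 => K D4; case: ifPn => [l0|]; last rewrite -ltNge => l0.
  rewrite mul0r -(@pmulr_rge0 _ 2)//; apply: le_trans lW2; exact: mulr_ge0.
have := ler_wnM2l (ltW l0) D4; move: lW2; move: (\sum_i _) => I h1 h2.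
by rewrite -(@ler_pM2l _ 2)//; lra.
Qed.

Variables (F : 'I_N -> 'rV[R]_d).
Let g i := F i - N%:R^-1 *: \sum_j grad W (y i - y j).

Lemma drift_dissipative :
  \sum_i dotv (ph i)
     ((- grad V (x i) - N%:R^-1 *: \sum_j grad W (x i - x j)) - (- grad V (y i) - F i)) <=
  - beta lV lW * \sum_i enorm (z i) ^+ (2 * q.+1) + \sum_i dotv (ph i) (g i).
Proof.
have E i : dotv (ph i)
     ((- grad V (x i) - N%:R^-1 *: \sum_j grad W (x i - x j)) - (- grad V (y i) - F i)) =
   - dotv (ph i) (grad V (x i) - grad V (y i))
   - N%:R^-1 * \sum_j dotv (ph i) (Wd i j) + dotv (ph i) (g i).
  have -> : \sum_j dotv (ph i) (Wd i j) =
      dotv (ph i) (\sum_j grad W (x i - x j)) - dotv (ph i) (\sum_j grad W (y i - y j)).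
    by rewrite -dotvBr -sumrB dotv_sumr.
  by rewrite /g !dotvBr !dotvNr !dotvZr; ring.
rewrite (eq_bigr _ (fun i _ => E i)) big_split/= lerD2r sumrB sumrN -mulr_sumr.
have VV : lV * \sum_i enorm (z i) ^+ (2 * q.+1) <=
    \sum_i dotv (ph i) (grad V (x i) - grad V (y i)).
  rewrite mulr_sumr; apply: ler_sum => i _.
  rewrite /ph /powv dotvZl (_ : 2 * q.+1 = 2 * q + 2)%N ?(exprD _ (2 * q) 2); last by lia.
  rewrite mulrCA; apply: ler_wpM2l; first exact: even_expr_ge0.
  by rewrite dotvC; exact: (H_convV HVW).
have N0 : 0 < N%:R :> R by rewrite ltr0n.
have : 0 <= N%:R^-1 :> R by rewrite invr_ge0 ltW.
move=> /ler_wpM2l /(_ _ _ interaction_lower).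
move: VV; set S := \sum_i enorm (z i) ^+ (2 * q.+1).
set A := \sum_i dotv (ph i) (grad V (x i) - grad V (y i)).
set I := \sum_i \sum_j dotv (ph i) (Wd i j) => VV.
rewrite mulrCA (mulrA N%:R^-1) mulVf ?lt0r_neq0// mul1r /beta.
by case: ifP => _ h; lra.
Qed.

End dissipation.

(** * Pathwise comparison *)

Section root.
Variables (R : realType) (n : nat).

Definition root (x : R) : R := x `^ n.+1%:R^-1.

Lemma root_ge0 x : 0 <= root x. Proof. exact: powR_ge0. Qed.

Lemma rootK x : 0 <= x -> root x ^+ n.+1 = x.
Proof.
by move=> x0; rewrite -powR_mulrn ?root_ge0// -powRrM mulVf ?powRr1// pnatr_eq0.
Qed.

Lemma exprD_ge (a b : R) : 0 <= a -> 0 <= b -> a ^+ n.+1 + b ^+ n.+1 <= (a + b) ^+ n.+1.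
Proof.
move=> a0 b0; elim: n => [|k IH]; first by rewrite !expr1.
rewrite [leRHS]exprS; apply: le_trans (ler_wpM2l (addr_ge0 a0 b0) IH).
rewrite mulrDl !mulrDr -!exprS lerD//; first by rewrite lerDl mulr_ge0// exprn_ge0.
by rewrite lerDr mulr_ge0// exprn_ge0.
Qed.

Lemma root_sum_le (I : finType) (a : I -> R) : (forall i, 0 <= a i) ->
  root (\sum_i a i ^+ n.+1) <= \sum_i a i.
Proof.
move=> a0; rewrite -(@ler_pXn2r _ n.+1)// ?nnegrE ?root_ge0 ?sumr_ge0//.
rewrite rootK; last by apply: sumr_ge0 => i _; exact: exprn_ge0.
have [] : \sum_i a i ^+ n.+1 <= (\sum_i a i) ^+ n.+1 /\ 0 <= \sum_i a i; last by [].
elim/big_rec2 : _ => [|i y x _ [h x0]]; first by rewrite expr0n.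
split; last exact: addr_ge0.
by apply: le_trans (exprD_ge (a0 i) x0); rewrite lerD2l.
Qed.

(** The root is Hoelder continuous: (a - b)^(n+1) <= a^(n+1) - b^(n+1) for a >= b >= 0. This also
    covers the zeros of f, where the root is not differentiable. *)
Lemma root_continuous (A : set R) (f : R -> R) : (forall s, 0 <= f s) ->
  {within A, continuous f} -> {within A, continuous (fun s => root (f s))}.
Proof.
move=> f0 cf x; apply/cvgrPdist_le => e e0.
have e0' : 0 < e ^+ n.+1 by exact: exprn_gt0.
have := cf x; move=> /cvgrPdist_le/(_ _ e0'); apply: filterS => y h.
have key a b : 0 <= b -> b <= a -> a ^+ n.+1 - b ^+ n.+1 <= e ^+ n.+1 -> a - b <= e.
  move=> b0 ba hab; rewrite -(@ler_pXn2r _ n.+1) ?nnegrE ?subr_ge0//; last exact: ltW.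
  apply: le_trans hab; rewrite lerBrDr.
  have ab0 : 0 <= a - b by rewrite subr_ge0.
  by have := exprD_ge ab0 b0; rewrite subrK.
have rx := root_ge0 (f x); have ry := root_ge0 (f y).
have {}h : `|root (f x) ^+ n.+1 - root (f y) ^+ n.+1| <= e ^+ n.+1 by rewrite !rootK.
have [xy|/ltW yx] := leP (root (f x)) (root (f y)).
  rewrite distrC ger0_norm ?subr_ge0//; apply: key => //.
  by apply: le_trans h; rewrite distrC ler_norm.
rewrite ger0_norm ?subr_ge0//; apply: key => //.
by apply: le_trans h; rewrite ler_norm.
Qed.

End root.

Lemma sum_dotv_le (R : realType) (d N n : nat) (x y : 'I_N -> 'rV[R]_d) :
  \sum_i enorm (x i) ^+ n * enorm (y i) <=
  root n (\sum_i enorm (x i) ^+ n.+1) ^+ n * root n (\sum_i enorm (y i) ^+ n.+1).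
Proof.
have p0 (v : 'I_N -> 'rV[R]_d) : 0 <= \sum_i enorm (v i) ^+ n.+1.
  by apply: sumr_ge0 => i _; rewrite exprn_ge0// enorm_ge0.
apply: hoelder_sum; rewrite ?root_ge0 ?rootK//; by move=> i; exact: enorm_ge0.
Qed.

Lemma within_continuousM (R : realType) (A : set R) (f g : R -> R) :
  {within A, continuous f} -> {within A, continuous g} ->
  {within A, continuous (fun s => f s * g s)}.
Proof. by move=> cf cg s; apply: cvgM; [exact: cf|exact: cg]. Qed.

Lemma enorm_le_sum (R : realType) (d : nat) (v : 'rV[R]_d) : enorm v <= \sum_l `|v ord0 l|.
Proof.
have [->|] := eqVneq (enorm v) 0; first exact: sumr_ge0.
rewrite neq_lt ltNge enorm_ge0/= => v0.
rewrite -(ler_pM2l v0) -expr2 enorm_sqr mulr_sumr; apply: ler_sum => l _.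
by rewrite -real_normK ?num_real// expr2 ler_wpM2r// coord_le_enorm.
Qed.

(** * The energy estimate along one path *)

Section pathwise.
Variables (R : realType) (d : nat) (V W : 'rV[R]_d -> R).
Variables (lV lW M : R) (m : nat) (HVW : assumptions_H V W lV lW M m).
Variables (q N : nat) (hN : (0 < N)%N) (hU : monotone_interaction (grad W) lW q).
Variables (x y F : R -> 'I_N -> 'rV[R]_d) (t : R) (t0 : 0 <= t).
Let ax s i := - grad V (x s i) - N%:R^-1 *: \sum_j grad W (x s i - x s j).
Let ay s i := - grad V (y s i) - F s i.
Let G s i := F s i - N%:R^-1 *: \sum_j grad W (y s i - y s j).
Let z s i := x s i - y s i.
Let n := (2 * q).+1.
Local Notation lmu := (@lebesgue_measure R).
Hypothesis cx : forall i l, {within `[0, t], continuous (fun s => x s i ord0 l)}.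
Hypothesis cy : forall i, {within `[0, t], continuous (fun s => y s i)}.
Hypothesis iax : forall i l, lmu.-integrable `[0, t] (EFin \o (fun s => ax s i ord0 l)).
Hypothesis iay : forall i l, lmu.-integrable `[0, t] (EFin \o (fun s => ay s i ord0 l)).
Hypothesis eqz : forall i l s, 0 <= s <= t -> z s i ord0 l = z 0 i ord0 l +
  (\int[lmu]_(r in `[0, s]) ax r i ord0 l - \int[lmu]_(r in `[0, s]) ay r i ord0 l).

Lemma path_comp_continuous (f : 'rV[R]_d -> R) (v : R -> 'rV[R]_d) : continuous f ->
  {within `[0, t], continuous v} -> {within `[0, t], continuous (fun s => f (v s))}.
Proof. by move=> cf cv s; apply: (@cvg_comp _ _ _ v f _ _ _ (cv s)); exact: cf. Qed.

Lemma coord_path_continuous i l : {within `[0, t], continuous (fun s => y s i ord0 l)}.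
Proof.
apply: (path_comp_continuous (f := fun v : 'rV[R]_d => v ord0 l)); last exact: cy.
exact: coord_continuous.
Qed.

Lemma z_continuous i l : {within `[0, t], continuous (fun s => z s i ord0 l)}.
Proof.
rewrite (_ : (fun s => _) = (fun s => x s i ord0 l - y s i ord0 l)).
  by move=> s; apply: cvgB; [exact: cx|exact: coord_path_continuous].
by apply/funext => s; rewrite row_subE.
Qed.

Lemma z_power_continuous i r : {within `[0, t], continuous (fun s => enorm (z s i) ^+ (2 * r))}.
Proof.
rewrite (_ : (fun s => _) = (fun s => (\sum_l z s i ord0 l ^+ 2) ^+ r)).
  by apply/within_continuousX/within_continuous_sum => l; apply/within_continuousX/z_continuous.
by apply/funext => s; rewrite enorm_even.
Qed.

Lemma continuous_integrable (f : R -> R) : {within `[0, t], continuous f} ->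
  lmu.-integrable `[0, t] (EFin \o f).
Proof. by move=> cf; apply: continuous_compact_integrable => //; exact: segment_compact. Qed.

(** Nothing is assumed on F as a function of time; since F = - ay - grad V (y), integrability of G
    follows from that of the drift of y and from the continuity of the paths. *)
Lemma fluctuation_integrable i l :
  lmu.-integrable `[0, t] (EFin \o (fun s => G s i ord0 l)).
Proof.
have cV : {within `[0, t], continuous (fun s => grad V (y s i) ord0 l)}.
  apply: (path_comp_continuous (f := fun v => grad V v ord0 l)); last exact: cy.
  exact: grad_continuous (H_smoothV HVW).
have cW j : {within `[0, t], continuous (fun s => grad W (y s i - y s j) ord0 l)}.
  apply: (path_comp_continuous (f := fun v => grad W v ord0 l)).
    exact: grad_continuous (H_smoothW HVW).
  by move=> s; apply: cvgB; exact: cy.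
have cS : {within `[0, t], continuous (fun s =>
    - 1 * grad V (y s i) ord0 l + - N%:R^-1 * \sum_(j < N) grad W (y s i - y s j) ord0 l)}.
  move=> s; apply: cvgD; apply: cvgM; try exact: cvg_cst; first exact: cV.
  by apply: within_continuous_sum => j; exact: cW.
have := (@Rintegral_lin2 _ _ R lmu `[0, t]%classic (-1) 1 _ _ (measurable_itv _) (iay i l)
  (continuous_integrable cS)).1.
congr (_.-integrable _ _); apply/funext => s /=; congr EFin.
rewrite /ay /G !row_subE row_oppE.
have -> : (N%:R^-1 *: \sum_j grad W (y s i - y s j)) ord0 l =
    N%:R^-1 * \sum_(j < N) grad W (y s i - y s j) ord0 l by rewrite mxE summxE.
by move: (\sum_(j < N) _) => S; ring.
Qed.

Let H s := root n (\sum_i enorm (G s i) ^+ n.+1).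

Let nE : n.+1 = (2 * q.+1)%N. Proof. by rewrite /n; lia. Qed.

Lemma fluctuation_coord_measurable i l :
  measurable_fun `[0, t]%classic (fun s => G s i ord0 l).
Proof. by apply/measurable_EFinP; case/integrableP: (fluctuation_integrable i l). Qed.

Lemma fluctuation_power_measurable i :
  measurable_fun `[0, t]%classic (fun s => enorm (G s i) ^+ n.+1).
Proof.
rewrite (_ : (fun s => _) = (fun s => (\sum_l G s i ord0 l ^+ 2) ^+ q.+1)); last first.
  by apply/funext => s; rewrite nE enorm_even.
apply: measurable_funX; apply: measurable_sum => l; apply: measurable_funX.
exact: fluctuation_coord_measurable.
Qed.

Lemma fluctuation_norm_measurable : measurable_fun `[0, t]%classic H.
Proof.
apply: (measurableT_comp (measurable_powR _)); apply: measurable_sum => i.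
exact: fluctuation_power_measurable.
Qed.

Lemma fluctuation_norm_integrable : lmu.-integrable `[0, t] (EFin \o H).
Proof.
have iS : lmu.-integrable `[0, t] (EFin \o (fun s => \sum_(k : 'I_N * 'I_d)
    1 * `|G s k.1 ord0 k.2|)).
  apply: (@Rintegral_lincomb _ _ R lmu `[0, t]%classic _ _ (fun=> 1) _ (measurable_itv _) _).1 => k.
  exact: integrable_abs (fluctuation_integrable _ _).
apply: le_integrable iS => //.
  by apply/measurable_EFinP; exact: fluctuation_norm_measurable.
move=> s _ /=; rewrite lee_fin ger0_norm ?root_ge0// ger0_norm; last first.
  by apply: sumr_ge0 => k _; rewrite mul1r.
apply: le_trans (root_sum_le _ (fun i => enorm_ge0 _)) _.
rewrite (eq_bigr (fun k => `|G s k.1 ord0 k.2|)); last by move=> k _; rewrite mul1r.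
rewrite -(pair_bigA _ (fun i l => `|G s i ord0 l|))/=; apply: ler_sum => i _.
exact: enorm_le_sum.
Qed.

Lemma powv_dotv_sum_le (v w : 'I_N -> 'rV[R]_d) :
  \sum_i dotv (powv q (v i)) (w i) <=
  root n (\sum_i enorm (v i) ^+ n.+1) ^+ n * root n (\sum_i enorm (w i) ^+ n.+1).
Proof.
apply: le_trans (sum_dotv_le _ _ _); apply: ler_sum => i _.
rewrite dotvZl /n exprSr -mulrA; apply: ler_wpM2l; last exact: dotv_le.
exact: even_expr_ge0.
Qed.

Let S s := root n (\sum_i enorm (z s i) ^+ n.+1).

(** The scalar Gronwall lemma is applied to the family indexed by pairs of a particle and a
    coordinate, with the coordinates of powv as multipliers; Hoelder's inequality supplies the
    duality it asks for. *)
Lemma particles_gronwall : 0 <= beta lV lW ->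
  expR (beta lV lW * t) * S t <= S 0 +
    \int[lmu]_(s in `[0, t]) (expR (beta lV lW * s) * H s).
Proof.
move=> b0.
have pairE (f : 'I_N -> 'rV[R]_d) (g : 'I_N -> 'rV[R]_d) :
    \sum_(k : 'I_N * 'I_d) f k.1 ord0 k.2 * g k.1 ord0 k.2 = \sum_i dotv (f i) (g i).
  by rewrite -(pair_bigA _ (fun i l => f i ord0 l * g i ord0 l)).
have pn0 (v : 'I_N -> 'rV[R]_d) : 0 <= \sum_i enorm (v i) ^+ n.+1.
  by apply: sumr_ge0 => i _; rewrite exprn_ge0// enorm_ge0.
apply: (@gronwall_norm R ('I_N * 'I_d)%type (fun k s => z s k.1 ord0 k.2)
  (fun k s => ax s k.1 ord0 k.2 - ay s k.1 ord0 k.2)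
  (fun k s => powv q (z s k.1) ord0 k.2) S H n t (beta lV lW)) => //.
- move=> k; rewrite (_ : (fun s => _) =
    (fun s => enorm (z s k.1) ^+ (2 * q) * z s k.1 ord0 k.2)).
    by apply: within_continuousM; [exact: z_power_continuous|exact: z_continuous].
  by apply/funext => s; rewrite mxE.
- apply: root_continuous => //; apply: within_continuous_sum => i.
  by rewrite nE; exact: z_power_continuous.
- move=> k.
  have := (@Rintegral_lin2 _ _ R lmu `[0, t]%classic 1 (-1) _ _ (measurable_itv _)
    (iax k.1 k.2) (iay k.1 k.2)).1.
  by congr (_.-integrable _ _); apply/funext => s /=; rewrite mul1r mulN1r.
- exact: fluctuation_norm_integrable.
- by move=> s _; exact: root_ge0.
- by move=> s _; exact: root_ge0.
- move=> k s st; rewrite eqz//; congr (_ + _); have /andP[s0 s1] := st.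
  by rewrite RintegralB//; apply: integrable_subitv.
- move=> a c _ _; rewrite (pairE (fun i => powv q (z c i)) (z a)); exact: powv_dotv_sum_le.
- move=> c _; rewrite (pairE (fun i => powv q (z c i)) (z c)) rootK//; apply: eq_bigr => i _.
  by rewrite powv_dotv nE.
- move=> s _.
  rewrite (eq_bigr (fun k => powv q (z s k.1) ord0 k.2 * (ax s k.1 - ay s k.1) ord0 k.2));
    last by move=> k _; rewrite (row_subE (ax s k.1) (ay s k.1)).
  rewrite (pairE (fun i => powv q (z s i)) (fun i => ax s i - ay s i)).
  apply: le_trans (drift_dissipative HVW hN hU (x s) (y s) (F s)) _.
  rewrite lerD//; last exact: powv_dotv_sum_le.
  by rewrite rootK// nE.
Qed.

Lemma fluctuation_norm_moment (b : R) :
  (\int[lmu]_(s in `[0%R, t]) (expR (b * s) * H s ^+ n.+1)%:E <=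
    (d%:R ^+ q.+1)%:E * \sum_(i < N) \sum_(l < d)
      \int[lmu]_(s in `[0%R, t]) (expR (b * s) * G s i ord0 l ^+ (2 * q.+1))%:E)%E.
Proof.
have e0 s : 0 <= expR (b * s) :> R by exact: expR_ge0.
have mexp : measurable_fun `[0, t]%classic (fun s : R => expR (b * s)).
  apply: measurable_funTS; apply: continuous_measurable_fun; exact: expRM_continuous.
have mG i l : measurable_fun `[0, t]%classic
    (fun s => (expR (b * s) * G s i ord0 l ^+ (2 * q.+1))%:E).
  apply/measurable_EFinP; apply: measurable_funM => //.
  exact: (measurable_funX (2 * q.+1) (fluctuation_coord_measurable i l)).
have G0 i l s : (0 <= (expR (b * s) * G s i ord0 l ^+ (2 * q.+1))%:E)%E.
  by rewrite lee_fin mulr_ge0// even_expr_ge0.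
have -> : (\sum_(i < N) \sum_(l < d)
      \int[lmu]_(s in `[0%R, t]) (expR (b * s) * G s i ord0 l ^+ (2 * q.+1))%:E =
    \int[lmu]_(s in `[0%R, t]) \sum_(i < N) \sum_(l < d)
      (expR (b * s) * G s i ord0 l ^+ (2 * q.+1))%:E)%E.
  rewrite ge0_integral_sum//; last 2 first.
  - by move=> i; apply: emeasurable_sum => l; exact: mG.
  - by move=> i s _; apply: sume_ge0 => l _; exact: G0.
  apply: eq_bigr => i _; by rewrite ge0_integral_sum// => l; exact: mG.
rewrite -ge0_integralZl_EFin ?exprn_ge0//; last 2 first.
- by move=> s _; apply: sume_ge0 => i _; apply: sume_ge0 => l _; exact: G0.
- by apply: emeasurable_sum => i; apply: emeasurable_sum => l; exact: mG.
apply: ge0_le_integral => //.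
- by move=> s _; rewrite lee_fin mulr_ge0// exprn_ge0// root_ge0.
- apply/measurable_EFinP; apply: measurable_funM => //.
  exact: (measurable_funX n.+1 fluctuation_norm_measurable).
- apply: emeasurable_funM; first exact: measurable_cst.
  by apply: emeasurable_sum => i; apply: emeasurable_sum => l; exact: mG.
move=> s _; rewrite rootK; last first.
  by apply: sumr_ge0 => i _; rewrite exprn_ge0// enorm_ge0.
have -> : (\sum_(i < N) \sum_(l < d) (expR (b * s) * G s i ord0 l ^+ (2 * q.+1))%:E =
    (\sum_(i < N) \sum_(l < d) (expR (b * s) * G s i ord0 l ^+ (2 * q.+1))%R)%:E)%E.
  by rewrite -sumEFin; apply: eq_bigr => i _; rewrite sumEFin.
rewrite -EFinM lee_fin !mulr_sumr; apply: ler_sum => i _.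
rewrite nE enorm_even -mulr_sumr mulrCA; apply: ler_wpM2l => //.
have <- : \sum_l (G s i ord0 l ^+ 2) ^+ q.+1 = \sum_l G s i ord0 l ^+ (2 * q.+1).
  by apply: eq_bigr => l _; rewrite exprM.
have := @expr_sum_le R 'I_d (fun l => G s i ord0 l ^+ 2) q.+1.
by rewrite card_ord; apply => // l; exact: sqr_ge0.
Qed.

(** Gronwall's bound is raised to the power n + 1 = 2 (q + 1). Jensen's inequality for the weight
    exp(b s), of mass at most exp(b t) / b, bounds the power n + 1 of the integral at the price of
    (exp(b t) / b)^n. Against the factor exp(- (n + 1) b t), exactly exp(- b t) remains, to be
    compensated by the mass of the weight once the integrand is bounded in mean. *)
Lemma pathwise_moment (C : R) : 0 < beta lV lW -> 0 <= C ->
  (forall a b, 0 <= a -> 0 <= b ->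
    (a + b) ^+ (2 * q.+1) <= 2 ^+ q.+1 * a ^+ (2 * q.+1) + C * b ^+ (2 * q.+1)) ->
  ((\sum_i enorm (z t i) ^+ (2 * q.+1))%:E <=
   (2 ^+ q.+1 * expR (- (2 * q.+1%:R * beta lV lW * t)))%:E *
     (\sum_i enorm (z 0 i) ^+ (2 * q.+1))%:E +
   (C * beta lV lW ^- n * expR (- (beta lV lW * t)) * d%:R ^+ q.+1)%:E *
     \sum_(i < N) \sum_(l < d) \int[lmu]_(s in `[0%R, t])
       (expR (beta lV lW * s) * G s i ord0 l ^+ (2 * q.+1))%:E)%E.
Proof.
set b := beta lV lW => b0 C0 hC.
have gr : expR (b * t) * S t <= S 0 + \int[lmu]_(s in `[0, t]) (expR (b * s) * H s).
  exact: particles_gronwall (ltW b0).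
have SE s : S s ^+ (2 * q.+1) = \sum_i enorm (z s i) ^+ (2 * q.+1).
  by rewrite -nE rootK//; apply: sumr_ge0 => i _; rewrite exprn_ge0// enorm_ge0.
set I := \int[lmu]_(s in `[0, t]) (expR (b * s) * H s) in gr *.
have I0 : 0 <= I by apply: Rintegral_ge0 => s _; rewrite mulr_ge0 ?expR_ge0 ?root_ge0.
pose E := expR (b * t).
have E0 : 0 < E by exact: expR_gt0.
have bE : 0 < b / E by rewrite divr_gt0.
have mexp : measurable_fun `[0, t]%classic (fun s : R => expR (b * s)).
  apply: measurable_funTS; apply: continuous_measurable_fun; exact: expRM_continuous.
have wle : (\int[lmu]_(s in `[0%R, t]) (expR (b * s))%:E <= ((b / E)^-1)%:E)%E.
  by apply: le_trans (integral_expRM_le b0 t0) _; rewrite lee_fin invf_div mulrC.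
have jen := @weighted_jensen _ _ R lmu `[0, t]%classic (fun s => expR (b * s)) H (b / E) n
  (measurable_itv _) bE (fun s _ => expR_ge0 _) (fun s _ => root_ge0 _ _) mexp
  fluctuation_norm_measurable wle (integrable_expM (ltW b0) fluctuation_norm_integrable).
have real : S t ^+ (2 * q.+1) <=
    2 ^+ q.+1 * expR (- (2 * q.+1%:R * b * t)) * S 0 ^+ (2 * q.+1) +
    C * b ^- n * expR (- (b * t)) * ((b / E) ^+ n * I ^+ n.+1).
  have h := le_trans (lerXn2r (2 * q.+1) _ _ gr) (hC _ _ (root_ge0 _ _) I0).
  have {}h : E ^+ (2 * q.+1) * S t ^+ (2 * q.+1) <=
      2 ^+ q.+1 * S 0 ^+ (2 * q.+1) + C * I ^+ (2 * q.+1).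
    rewrite -exprMn; apply: h; rewrite nnegrE.
      by rewrite mulr_ge0 ?expR_ge0 ?root_ge0.
    by rewrite addr_ge0 ?root_ge0.
  have Ep : 0 < E ^+ (2 * q.+1) by rewrite exprn_gt0.
  have -> : expR (- (2 * q.+1%:R * b * t)) = (E ^+ (2 * q.+1))^-1.
    rewrite expRN /E -expRM_natl; congr (expR _)^-1; by rewrite natrM; ring.
  have -> : C * b ^- n * expR (- (b * t)) * ((b / E) ^+ n * I ^+ n.+1) =
      (E ^+ (2 * q.+1))^-1 * (C * I ^+ (2 * q.+1)).
    rewrite expRN -/E -nE expr_div_n [E ^+ n.+1]exprS.
    by field; rewrite !lt0r_neq0 ?exprn_gt0.
  rewrite -(ler_pM2l Ep) mulrDr; apply: le_trans h _.
  rewrite le_eqVlt; apply/orP; left; apply/eqP.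
  by field; rewrite lt0r_neq0.
rewrite -!SE; apply: (@le_trans _ _ _ _ _ (_ : (_ <= _%:E)%E)); first by rewrite lee_fin; exact: real.
rewrite EFinD -EFinM; apply: leeD2l; rewrite [X in (X <= _)%E]EFinM [X in (_ <= X * _)%E]EFinM -muleA.
apply: lee_wpmul2l.
  by rewrite lee_fin !mulr_ge0 ?expR_ge0// invr_ge0 exprn_ge0// ltW.
apply: le_trans jen _; exact: fluctuation_norm_moment.
Qed.

End pathwise.

(** * Conclusion *)

Lemma coupled_pathwise {dT : measure_display} {T : measurableType dT} {R : realType}
    (P : probability T R) (d : nat) (V W : 'rV[R]_d -> R) (lV lW M : R) (m : nat)
    (u0 : probability 'rV[R]_d R)
    (u0N : forall N : nat, probability 'M[R]_(N, d) R)
    (B : nat -> R -> T -> 'rV[R]_d)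
    (X : forall N : nat, R -> T -> 'M[R]_(N, d))
    (u : R -> probability 'rV[R]_d R)
    (Xbar : nat -> R -> T -> 'rV[R]_d) (q N : nat) (t C : R) :
  assumptions_H V W lV lW M m -> coupled_system P V W u0 u0N B X u Xbar ->
  monotone_interaction (grad W) lW q -> 0 < beta lV lW -> (0 < N)%N -> 0 <= t -> 0 <= C ->
  (forall a b, 0 <= a -> 0 <= b ->
    (a + b) ^+ (2 * q.+1) <= 2 ^+ q.+1 * a ^+ (2 * q.+1) + C * b ^+ (2 * q.+1)) ->
  {ae P, forall w,
    ((\sum_(i < N) enorm (row i (X N t w) - Xbar i t w) ^+ (2 * q.+1))%:E <=
     (2 ^+ q.+1 * expR (- (2 * q.+1%:R * beta lV lW * t)))%:E *
       (\sum_(i < N) enorm (row i (X N 0 w) - Xbar i 0 w) ^+ (2 * q.+1))%:E +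
     (C * beta lV lW ^- (2 * q).+1 * expR (- (beta lV lW * t)) * d%:R ^+ q.+1)%:E *
       \sum_(i < N) \sum_(l < d) \int[lebesgue_measure]_(s in `[0%R, t])
         (expR (beta lV lW * s) * fluctuation W u Xbar N i l s w ^+ (2 * q.+1))%:E)%E}.
Proof.
move=> HVW CS hU b0 N0 t0 C0 hC.
have [_ _ cX eX] := cs_particles CS N0.
have cY : {ae P, forall w, forall j, {within `[0, +oo[, continuous (Xbar j ^~ w)}}.
  by apply: ae_foralln => j; have [_ _ []] := cs_limit CS j.
have eY : {ae P, forall w, forall j t i k, 0 <= t ->
         lebesgue_measure.-integrable `[0, t]
           (fun s => ((- grad V (Xbar j s w) - Defs.conv (grad W) (u s) (Xbar j s w)) i k)%:E) /\
         Xbar j t w i k = Xbar j 0 w i k + Num.sqrt 2 * B j t w i k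
           + \int[lebesgue_measure]_(s in `[0, t])
              (- grad V (Xbar j s w) - Defs.conv (grad W) (u s) (Xbar j s w)) i k}.
  by apply: ae_foralln => j; have [_ _ []] := cs_limit CS j.
apply: filterS2 (filterI cX cY) (filterI eX eY) => w [{}cX {}cY] [{}eX {}eY].
have sub (U : topologicalType) (f : R -> U) : {within `[0, +oo[, continuous f} ->
    {within `[0, t], continuous f}.
  by apply: continuous_subspaceW => s /=; rewrite !in_itv/= andbT => /andP[].
pose x s (i : 'I_N) : 'rV[R]_d := row i (X N s w).
pose y s (i : 'I_N) : 'rV[R]_d := Xbar i s w.
pose F s (i : 'I_N) : 'rV[R]_d := Defs.conv (grad W) (u s) (Xbar i s w).
have driftE s (i : 'I_N) l : particle_drift V W (X N s w) i l =
    (- grad V (x s i) - N%:R^-1 *: \sum_j grad W (x s i - x s j)) ord0 l.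
  by rewrite mxE.
have cx i l : {within `[0, t], continuous (fun s => x s i ord0 l)}.
  rewrite (_ : (fun s => _) = (fun s => X N s w i l)); last by apply/funext => s; rewrite mxE.
  move=> s; apply: (@cvg_comp _ _ _ (fun s => X N s w) (fun A : 'M[R]_(N, d) => A i l) _ _ _
    (sub _ _ cX s)).
  exact: coord_continuous.
have iax i l s : 0 <= s -> (@lebesgue_measure R).-integrable `[0, s] (EFin \o (fun s =>
    (- grad V (x s i) - N%:R^-1 *: \sum_j grad W (x s i - x s j)) ord0 l)).
  move=> s0; have [+ _] := eX s i l s0.
  by congr (_.-integrable _ _); apply/funext => r /=; rewrite driftE.
have iay i l s : 0 <= s -> (@lebesgue_measure R).-integrable `[0, s]
    (EFin \o (fun s => (- grad V (y s i) - F s i) ord0 l)).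
  by move=> s0; have [] := eY i s ord0 l s0.
have eqz i l s : 0 <= s <= t -> (x s i - y s i) ord0 l = (x 0 i - y 0 i) ord0 l +
   (\int[lebesgue_measure]_(r in `[0, s])
      (- grad V (x r i) - N%:R^-1 *: \sum_j grad W (x r i - x r j)) ord0 l -
    \int[lebesgue_measure]_(r in `[0, s]) (- grad V (y r i) - F r i) ord0 l).
  move=> /andP[s0 _].
  have [_ Ex] := eX s i l s0; have [_ Ey] := eY i s ord0 l s0.
  have {}Ex : x s i ord0 l = x 0 i ord0 l + Num.sqrt 2 * B i s w ord0 l +
      \int[lebesgue_measure]_(r in `[0, s])
        (- grad V (x r i) - N%:R^-1 *: \sum_j grad W (x r i - x r j)) ord0 l.
    rewrite [LHS]mxE Ex mxE; congr (_ + _ + _); first by rewrite mxE.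
    by apply: eq_Rintegral => r _; rewrite driftE.
  by rewrite row_subE (linear_difference Ex Ey erefl) subrr mulr0 addr0 row_subE.
have := @pathwise_moment R d V W lV lW M m HVW q N N0 hU x y F t t0 cx
  (fun i => sub _ _ (cY i)) (fun i l => iax i l t t0) (fun i l => iay i l t t0) eqz C b0 C0 hC.
move=> /le_trans; apply; apply: leeD2l; apply: lee_wpmul2l.
  by rewrite lee_fin !mulr_ge0 ?expR_ge0 ?exprn_ge0// invr_ge0 exprn_ge0// ltW.
rewrite le_eqVlt; apply/orP; left; apply/eqP.
apply: eq_bigr => i _; apply: eq_bigr => l _; apply: eq_integral => s _.
have sE (c : R) (f : 'I_N -> 'rV[R]_d) : (c *: \sum_j f j) ord0 l = c * \sum_j f j ord0 l.
  by rewrite mxE summxE.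
by congr ((_ * _ ^+ _)%:E); rewrite /= row_subE sE.
Qed.

Lemma measurable_coupling {dT : measure_display} {T : measurableType dT} {R : realType}
    (P : probability T R) (d : nat) (V W : 'rV[R]_d -> R)
    (u0 : probability 'rV[R]_d R)
    (u0N : forall N : nat, probability 'M[R]_(N, d) R)
    (B : nat -> R -> T -> 'rV[R]_d)
    (X : forall N : nat, R -> T -> 'M[R]_(N, d))
    (u : R -> probability 'rV[R]_d R)
    (Xbar : nat -> R -> T -> 'rV[R]_d) (r N : nat) (t : R) (i : 'I_N) :
  coupled_system P V W u0 u0N B X u Xbar -> (0 < N)%N -> 0 <= t ->
  measurable_fun setT (fun w => enorm (row i (X N t w) - Xbar i t w) ^+ (2 * r)).
Proof.
move=> CS N0 t0; apply: measurable_enorm_even; apply: measurable_rVB.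
  apply: measurable_fun_rV => l; under eq_fun do rewrite mxE.
  have [h _ _ _] := cs_particles CS N0.
  exact: (measurableT_comp (measurable_mxE i l) (h t t0)).
exact: (limit_measurable CS).
Qed.

Lemma coupling_momentE {dT : measure_display} {T : measurableType dT} {R : realType}
    (P : probability T R) (d : nat) (V W : 'rV[R]_d -> R)
    (u0 : probability 'rV[R]_d R)
    (u0N : forall N : nat, probability 'M[R]_(N, d) R)
    (B : nat -> R -> T -> 'rV[R]_d)
    (X : forall N : nat, R -> T -> 'M[R]_(N, d))
    (u : R -> probability 'rV[R]_d R)
    (Xbar : nat -> R -> T -> 'rV[R]_d) (r N : nat) (t : R) :
  coupled_system P V W u0 u0N B X u Xbar -> (0 < N)%N -> 0 <= t ->
  coupling_moment P X Xbar (2 * r) N t =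
  (\int[P]_w (\sum_(i < N) enorm (row i (X N t w) - Xbar i t w) ^+ (2 * r))%:E)%E.
Proof.
move=> CS N0 t0; under eq_integral do rewrite -sumEFin.
rewrite ge0_integral_sum//.
- by rewrite /coupling_moment; apply: eq_bigr => i _; rewrite unlock.
- by move=> i; apply/measurable_EFinP; exact: (measurable_coupling _ i CS).
- by move=> i w _; rewrite lee_fin exprn_ge0// enorm_ge0.
Qed.

Lemma coupling_bound (R : realType) (d : nat) (V W : 'rV[R]_d -> R) (lV lW M : R) (m q : nat)
    (u0 : probability 'rV[R]_d R)
    (u0N : forall N : nat, probability 'M[R]_(N, d) R) :
  assumptions_H V W lV lW M m -> monotone_interaction (grad W) lW q ->
  finite_moment (2 * m ^ 2 * q.+1) u0 ->
  exists2 C : R, 0 < C &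
     forall (dT : measure_display) (T : measurableType dT)
       (P : probability T R)
       (B : nat -> R -> T -> 'rV[R]_d)
       (X : forall N : nat, R -> T -> 'M[R]_(N, d))
       (u : R -> probability 'rV[R]_d R)
       (Xbar : nat -> R -> T -> 'rV[R]_d),
       coupled_system P V W u0 u0N B X u Xbar ->
       forall (t : R) (N : nat), 0 <= t -> (0 < N)%N ->
         (coupling_moment P X Xbar (2 * q.+1) N t <=
          (2 ^+ q.+1 * expR (- (2 * q.+1%:R * beta lV lW * t)))%:E *
            coupling_moment P X Xbar (2 * q.+1) N 0
          + (C / N%:R ^+ q)%:E)%E.
Proof.
move=> HVW hU mom.
have b0 : 0 < beta lV lW.
  by rewrite /beta; case: ifP => _; [exact: (H_lV HVW)|exact: (H_lVW HVW)].
set b := beta lV lW in b0 *.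
have [C1 C10 hC1] := exprD_le_pow2 R q.+1.
have [K K0 hK] := fluctuation_bound HVW (ltn0Sn q) mom.
(* Each of the N d coordinates contributes K / N^(q+1) times the mass exp(b t) / b of the weight.
   The exponential cancels against exp(- b t), and the sum over particles takes back one power of
   N. *)
pose C := C1 * b ^- (2 * q).+1 * d%:R ^+ q.+1 * (d%:R * K * b^-1).
have C0 : 0 <= C by rewrite !mulr_ge0 ?exprn_ge0 ?invr_ge0 ?exprn_ge0// ltW.
exists (C + 1) => [|dT T P B X u Xbar CS t N t0 N0]; first by rewrite ltr_wpDl.
have Np0 r : 0 < N%:R ^+ r :> R by rewrite exprn_gt0// ltr0n.
pose Kn := K / N%:R ^+ q.+1.
have Kn0 : 0 <= Kn by rewrite divr_ge0// ltW.
have /choice[Z hZ] : forall k : 'I_N * 'I_d, exists Z : T -> \bar R,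
    [/\ measurable_fun setT Z, (forall w, 0 <= Z w)%E,
    {ae P, forall w, (\int[lebesgue_measure]_(s in `[0%R, t])
       (expR (b * s) * fluctuation W u Xbar N k.1 k.2 s w ^+ (2 * q.+1))%:E = Z w)%E} &
    (\int[P]_w Z w <= (Kn * (b^-1 * expR (b * t)))%:E)%E].
  move=> [i l]; apply: (@time_fluctuation _ _ _ P _ V W _ _ _ _ _ _ _ _ _ _ N i l q.+1 b t Kn
    HVW CS b0 t0 Kn0) => s s0.
  exact: (hK _ _ _ _ _ _ _ _ CS).
pose A := 2 ^+ q.+1 * expR (- (2 * q.+1%:R * b * t)).
pose D := C1 * b ^- (2 * q).+1 * expR (- (b * t)) * d%:R ^+ q.+1.
have A0 : 0 <= A by rewrite mulr_ge0 ?exprn_ge0 ?expR_ge0.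
have D0 : 0 <= D by rewrite !mulr_ge0 ?expR_ge0 ?exprn_ge0// invr_ge0 exprn_ge0// ltW.
pose Y s w := \sum_(i < N) enorm (row i (X N s w) - Xbar i s w) ^+ (2 * q.+1).
have Y0 s w : (0 <= (Y s w)%:E)%E.
  by rewrite lee_fin; apply: sumr_ge0 => i _; rewrite exprn_ge0// enorm_ge0.
have mY s : 0 <= s -> measurable_fun setT (fun w => (Y s w)%:E).
  move=> s0; apply/measurable_EFinP; apply: measurable_sum => i.
  exact: (measurable_coupling _ i CS).
have mZ k : measurable_fun setT (Z k) by have [] := hZ k.
have Z0 k w : (0 <= Z k w)%E by have [] := hZ k.
have mZS : measurable_fun setT (fun w => \sum_(k : 'I_N * 'I_d) Z k w)%E.
  by apply: emeasurable_sum => k.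
have ZS0 w : (0 <= \sum_(k : 'I_N * 'I_d) Z k w)%E by apply: sume_ge0 => k _.
rewrite !(coupling_momentE _ CS)// -/A.
apply: (@le_trans _ _ (\int[P]_w (A%:E * (Y 0 w)%:E + D%:E * \sum_(k : 'I_N * 'I_d) Z k w))%E).
  apply: ae_ge0_le_integral => //.
  - by move=> w _; exact: (Y0 t w).
  - exact: (mY t t0).
  - by move=> w _; rewrite adde_ge0// mule_ge0// lee_fin.
  - apply: emeasurable_funD; apply: emeasurable_funM; try exact: measurable_cst.
      exact: mY.
    exact: mZS.
  have aeZ : {ae P, forall w, forall k : 'I_N * 'I_d, (\int[lebesgue_measure]_(s in `[0%R, t])
       (expR (b * s) * fluctuation W u Xbar N k.1 k.2 s w ^+ (2 * q.+1))%:E = Z k w)%E}.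
    by apply: filter_forall => k; have [] := hZ k.
  apply: filterS2 (coupled_pathwise HVW CS hU b0 N0 t0 C10 hC1) aeZ => w h hz _.
  apply: le_trans h _; apply: leeD2l; apply: lee_wpmul2l; first by rewrite lee_fin.
  rewrite le_eqVlt; apply/orP; left; apply/eqP.
  rewrite -(eq_bigr _ (fun k _ => hz k)).
  by rewrite -(pair_bigA _ (fun (i : 'I_N) (l : 'I_d) => \int[lebesgue_measure]_(s in `[0%R, t])
       (expR (b * s) * fluctuation W u Xbar N i l s w ^+ (2 * q.+1))%:E)%E).
rewrite ge0_integralD//; last 4 first.
- by move=> w _; rewrite mule_ge0// lee_fin.
- by apply: emeasurable_funM; [exact: measurable_cst|exact: mY].
- by move=> w _; rewrite mule_ge0// lee_fin.
- by apply: emeasurable_funM; [exact: measurable_cst|exact: mZS].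
rewrite ge0_integralZl_EFin//; last exact: mY.
apply: leeD2l; rewrite ge0_integralZl_EFin// ge0_integral_sum//.
apply: (@le_trans _ _ (D%:E * \sum_(k : 'I_N * 'I_d) (Kn * (b^-1 * expR (b * t)))%:E)%E).
  apply: lee_wpmul2l; first by rewrite lee_fin.
  by apply: lee_sum => k _; have [] := hZ k.
rewrite sumEFin -EFinM lee_fin sumr_const card_prod !card_ord -[X in D * X]mulr_natl.
have -> : D * ((N * d)%:R * (Kn * (b^-1 * expR (b * t)))) = C / N%:R ^+ q.
  rewrite /D /C /Kn natrM [N%:R ^+ q.+1]exprSr expRN; move: (d%:R ^+ q.+1) (b ^- _) => x y.
  by field; rewrite (gt_eqF (Np0 q)) (gt_eqF b0) pnatr_eq0 (gtn_eqF N0) (gt_eqF (expR_gt0 _)).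
by apply: ler_wpM2r; rewrite ?invr_ge0 ?lerDl// ltW.
Qed.

Theorem theorem1 (R : realType) (d : nat) (d_gt0 : (0 < d)%N)
    (V W : 'rV[R]_d -> R) (lV lW M : R) (m : nat)
    (HVW : assumptions_H V W lV lW M m)
    (u0 : probability 'rV[R]_d R)
    (u0N : forall N : nat, probability 'M[R]_(N, d) R) :
  (finite_moment (2 * m ^ 2) u0 ->
   (forall N, (0 < N)%N -> finite_moment 2 (u0N N)) ->
   exists2 C : R, 0 < C &
     forall (dT : measure_display) (T : measurableType dT)
       (P : probability T R)
       (B : nat -> R -> T -> 'rV[R]_d)
       (X : forall N : nat, R -> T -> 'M[R]_(N, d))
       (u : R -> probability 'rV[R]_d R)
       (Xbar : nat -> R -> T -> 'rV[R]_d),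
       coupled_system P V W u0 u0N B X u Xbar ->
       forall (t : R) (N : nat), 0 <= t -> (0 < N)%N ->
         (coupling_moment P X Xbar 2 N t <=
          (2 * expR (- (2 * beta lV lW * t)))%:E *
            coupling_moment P X Xbar 2 N 0 + C%:E)%E) /\
  (forall p : nat, (1 <= p)%N ->
   finite_moment (2 * m ^ 2 * p) u0 ->
   (forall N, (0 < N)%N -> finite_moment (2 * p) (u0N N)) ->
   d = 1%N \/ (forall x, W x = lW * (enorm x ^+ 2 / 2)) ->
   exists2 C : R, 0 < C &
     forall (dT : measure_display) (T : measurableType dT)
       (P : probability T R)
       (B : nat -> R -> T -> 'rV[R]_d)
       (X : forall N : nat, R -> T -> 'M[R]_(N, d))
       (u : R -> probability 'rV[R]_d R)
       (Xbar : nat -> R -> T -> 'rV[R]_d),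
       coupled_system P V W u0 u0N B X u Xbar ->
       forall (t : R) (N : nat), 0 <= t -> (0 < N)%N ->
         (coupling_moment P X Xbar (2 * p) N t <=
          (2 ^+ p * expR (- (2 * p%:R * beta lV lW * t)))%:E *
            coupling_moment P X Xbar (2 * p) N 0
          + (C / N%:R ^+ p.-1)%:E)%E).
Proof.
(* With p = q + 1, the first claim is the case q = 0, for which [monotone_interaction] is the
   convexity hypothesis on W itself. *)
split=> [mom _|[//|q] _ mom _ hW].
  have hU := monotone_interaction0 (H_convW HVW).
  have mom' : finite_moment (2 * m ^ 2 * 1) u0 by rewrite muln1.
  have [C C0 hC] := coupling_bound u0N HVW hU mom'.
  exists C => // dT T P B X u Xbar CS t N t0 N0.
  have := hC _ _ _ _ _ _ _ CS t N t0 N0.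
  by rewrite mulr1 expr1 expr0 divr1 muln1.
have hU : monotone_interaction (grad W) lW q.
  case: hW => [d1|hW]; last first.
    by apply: monotone_interaction_linear => x; exact: grad_quadratic hW.
  have := H_convW HVW; move: (grad W); rewrite d1 => F; exact: monotone_interaction_dim1.
have [C C0 hC] := coupling_bound u0N HVW hU mom.
by exists C => // dT T P B X u Xbar CS t N t0 N0; exact: (hC _ _ _ _ _ _ _ CS).
Qed.
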